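(* Let $H$ be a Hilbert space and $A:D(A)\subset H\to H$ a densely defined operator with eigenvectors $\phi_p\in D(A)$, $A\phi_p=\lambda_p\phi_p$ $(p=1,2,\dots)$, where $0<\lambda_p\le\lambda_{p+1}$, $\lim_{p\to\infty}\lambda_p=\infty$ and $\{\phi_p\}$ is an orthonormal basis of $H$. Let $T>0$, $s\ge0$, $0<\alpha_0<\alpha_1<1$, $0<\beta_0<\beta_1$, $\alpha\in[\alpha_0,\alpha_1]$, $\beta\in[\beta_0,\beta_1]$. Consider $$\partial_t^\alpha v+A^\beta v=0,\quad t\in(0,T),\qquad v(0)=\theta.\quad(\ast)$$ (a) For $\theta\in H^s$ the problem $(\ast)$ has a unique solution $$v=v_{\alpha,\beta,\theta}\in C([0,T];H^s)\cap C_\alpha(T;H^{\beta+s}),\qquad \partial_t^\alpha v_{\alpha,\beta,\theta}\in C_\alpha(T;H^s),$$ which has the form $$v_{\alpha,\beta,\theta}(t)=\sum_{p=1}^\infty\langle\theta,\phi_p\rangle E_{\alpha,1}(-\lambda_p^\beta t^\alpha)\phi_p.$$ Moreover there is a constant $C$ independent of $\alpha,\beta,\theta$ such that $$\|v\|_{C([0,T];H^s)}+\|v\|_{C_\alpha(T;H^{\beta+s})}+\|\partial_t^\alpha v\|_{C_\alpha(T;H^s)}\le C\|\theta\|_{H^s}.$$ If, in addition, $s\ge\beta$, then $\partial_t^\alpha v_{\alpha,\beta,\theta}\in C([0,T];H^{s-\beta})$ and $\|\partial_t^\alpha v\|^2_{C([0,T];H^{s-\beta})}\le C\|\theta\|^2_{H^s}$.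 (b) Let $\alpha,\alpha'\in(0,1)$, $\beta'\in[\beta_0,\beta_1]$, $\theta,\theta'\in H^s$. (i) If $\theta'\to\theta$ in $H^s$ and $\alpha'\to\alpha$, $\beta'\to\beta$ in $\mathbb{R}$, then for every $t\in[0,T]$ $$\|v_{\alpha',\beta',\theta'}(t)-v_{\alpha,\beta,\theta}(t)\|_{H^s}\to0.$$ (ii) If $s>\rho\ge0$, $\alpha,\alpha'\in[\alpha_0,\alpha_1]$ and $\beta,\beta'\in[\beta_0,\beta_1]$, then there is a constant $C$ depending on $\alpha_0,\alpha_1,\beta_0,\beta_1,s,\rho$ (and on the fixed $T$ and $A$) such that for every $t\in[0,T]$ $$\|v_{\alpha',\beta',\theta'}(t)-v_{\alpha,\beta,\theta}(t)\|_{H^\rho}^2\le C\|\theta'-\theta\|_{H^s}^2+C\|\theta\|_{H^s}^2\bigl(|\alpha'-\alpha|+|\beta'-\beta|\bigr)^{2\gamma},$$ where $\gamma=\min\{1,(s-\rho)/\beta_1\}$.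
   Context: For $s\ge0$, $H^s=\{v\in H:\ \|v\|_{H^s}^2=\sum_{p=1}^\infty\lambda_p^{2s}|\langle v,\phi_p\rangle|^2<\infty\}$; $H^0=H$, $H^1=D(A)$. For $\beta>0$, $A^\beta v=\sum_{p=1}^\infty\lambda_p^\beta\langle v,\phi_p\rangle\phi_p$ with $D(A^\beta)=H^\beta$. $E_{\alpha,1}(x)=\sum_{k=0}^\infty x^k/\Gamma(k\alpha+1)$ is the Mittag-Leffler function. For a Banach space $X$ and $0<\alpha<1$, $C_\alpha(T;X)=\{h\in C((0,T];X):\sup_{0<t\le T}t^\alpha\|h(t)\|<\infty\}$ with norm $\sup_{0<t\le T}t^\alpha\|h(t)\|$. The Caputo derivative $\partial_t^\alpha v$ is understood as $D_t^\alpha(v-v(0))=\frac{d}{dt}J^{1-\alpha}(v-v(0))$ where $J^{1-\alpha}w(t)=\frac1{\Gamma(1-\alpha)}\int_0^t(t-s)^{-\alpha}w(s)\,ds$, so that $(\ast)$ reads $D_t^\alpha(v-\theta)+A^\beta v=0$, $v(0)=\theta$. *)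

(* Defs.v *)
From HB Require Import structures.
From mathcomp Require Import all_boot all_order all_algebra.
From mathcomp Require Import complex.
From mathcomp Require Import all_classical all_reals all_analysis.
Set Implicit Arguments.
Unset Strict Implicit.
Unset Printing Implicit Defensive.
Import Order.TTheory GRing.Theory Num.Theory.
Import numFieldNormedType.Exports.
Local Open Scope classical_set_scope.
Local Open Scope ring_scope.

(** The scalar field of the Hilbert space is either [R] or [R[i]]. *)
Variant scalar_kind := RealScalars | ComplexScalars.

Definition scalar_field (R : realType) (k : scalar_kind) : numFieldType :=
  match k with RealScalars => R | ComplexScalars => R[i] end.

Definition scalar_of (R : realType) (k : scalar_kind) : R -> scalar_field R k :=
  match k with RealScalars => id | ComplexScalars => real_complex R end.

Definition scalar_re (R : realType) (k : scalar_kind) : scalar_field R k -> R :=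
  match k with RealScalars => id | ComplexScalars => @complex.Re R end.

Definition scalar_conj (R : realType) (k : scalar_kind) :
    scalar_field R k -> scalar_field R k :=
  match k with
  | RealScalars => id
  | ComplexScalars => fun z : R[i] => Num.conj z
  end.

(** MathComp norms take values in the scalar field; these are the real-valued
    versions. *)
Definition scalar_abs (R : realType) (k : scalar_kind) (z : scalar_field R k) : R :=
  scalar_re `|z|.

Definition rnorm (R : realType) (k : scalar_kind)
  (H : normedModType (scalar_field R k)) (v : H) : R := scalar_re `|v|.

Section SpecialFunctions.
Context {R : realType}.

Definition Gamma (x : R) : R :=
  \int[lebesgue_measure]_(t in `]0, +oo[) (t `^ (x - 1) * expR (- t)).

(** The Mittag-Leffler function [E_{a,1}]. *)
Definition mittag_leffler (a x : R) : R :=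
  limn (series (fun n : nat => x ^+ n / Gamma (n%:R * a + 1))).

End SpecialFunctions.

(** Hilbert spaces: Banach spaces whose norm comes from the inner product
    [ip], which is linear in its first argument. *)
Section Hilbert.
Context {R : realType} {k : scalar_kind}.
Variable H : completeNormedModType (scalar_field R k).

Definition inner_product_norm (ip : {dot H for @scalar_conj R k}) :=
  forall v : H, `|v| ^+ 2 = ip v v.

Definition orthonormal_basis (ip : {dot H for @scalar_conj R k})
    (phi : nat -> H) :=
  (forall p q, ip (phi p) (phi q) = (p == q)%:R) /\
  (forall v : H, series (fun p => ip v (phi p) *: phi p) @ \oo --> v).

(** An unbounded operator is given by a domain [D] and a total function [A]
    whose values outside [D] are irrelevant. *)
Definition densely_defined_operator (D : set H) (A : H -> H) :=
  [/\ D 0,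
      forall (a : scalar_field R k) u v, D u -> D v -> D (a *: u + v),
      forall (a : scalar_field R k) u v, D u -> D v ->
        A (a *: u + v) = a *: A u + A v
    & dense D].

End Hilbert.

(** The library integral is scalar-valued; this is the Bochner integral over
    [D] of an [H]-valued function with respect to Lebesgue measure. *)
Section Bochner.
Context {R : realType} {k : scalar_kind}.
Variable H : completeNormedModType (scalar_field R k).
Local Notation mu := (@lebesgue_measure R).

Record simple_fun := SimpleFun {
  sf_size : nat;
  sf_set : 'I_sf_size -> set R;
  sf_val : 'I_sf_size -> H;
  sf_measurable : forall i, measurable (sf_set i);
  sf_finite : forall i, (mu (sf_set i) < +oo)%E
}.

Definition sf_fun (f : simple_fun) (t : R) : H :=
  \sum_(i < sf_size f) scalar_of k (\1_(sf_set i) t) *: sf_val i.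

Definition sf_integral (D : set R) (f : simple_fun) : H :=
  \sum_(i < sf_size f) scalar_of k (fine (mu (D `&` sf_set i))) *: sf_val i.

Definition is_bochner (D : set R) (f : R -> H) (w : H) :=
  exists g : nat -> simple_fun,
  [/\ {ae mu, forall t, D t -> sf_fun (g n) t @[n --> \oo] --> f t},
      (\int[mu]_(t in D) (rnorm (f t - sf_fun (g n) t))%:E)%E @[n --> \oo]
        --> 0%E
    & sf_integral D (g n) @[n --> \oo] --> w].

End Bochner.

Section FractionalDerivative.
Context {R : realType} {k : scalar_kind} {H : completeNormedModType (scalar_field R k)}.
Implicit Types (u v : R -> H) (a t T : R).

(** [y] is [J^{1-a} u (t)]. *)
Definition is_frac_int a u t (y : H) :=
  exists2 I : H,
    is_bochner `]0, t[ (fun r => scalar_of k ((t - r) `^ (- a)) *: u r) I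
    & y = scalar_of k (Gamma (1 - a))^-1 *: I.

(** [d] is [D_t^a u (t) = d/dt J^{1-a} u (t)], with [u] considered on [[0, T]]
    only; thus the derivative is one-sided at [0] and [T]. *)
Definition is_RL_derivative a T u t (d : H) :=
  exists J : R -> H,
    (forall r, r \in `[0, T] -> is_frac_int a u r (J r)) /\
    (scalar_of k (r - t)^-1 *: (J r - J t))
      @[r --> within `[0, T] (dnbhs t)] --> d.

Definition is_caputo a T v t (d : H) :=
  is_RL_derivative a T (fun r => v r - v 0) t d.

End FractionalDerivative.

(** Spaces of continuous functions with values in a subspace [X] of [H]
    equipped with its own norm [N]. *)
Section FunctionSpaces.
Context {R : realType} {k : scalar_kind} {H : completeNormedModType (scalar_field R k)}.
Implicit Types (X : set H) (N : H -> R) (D : set R) (u : R -> H) (a T : R).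

Definition continuous_into X N D u :=
  (forall t, D t -> X (u t)) /\
  (forall t, D t -> N (u r - u t) @[r --> within D (nbhs t)] --> (0 : R)).

Definition in_C X N T u := continuous_into X N `[0, T] u.

Definition norm_C N T u : \bar R := ereal_sup [set (N (u t))%:E | t in `[0, T]].

Definition norm_Ca N a T u : \bar R :=
  ereal_sup [set (t `^ a * N (u t))%:E | t in `]0, T]].

Definition in_Ca X N a T u :=
  continuous_into X N `]0, T] u /\ (norm_Ca N a T u < +oo)%E.

End FunctionSpaces.

(** Eigenpairs [(lam p, phi p)] are indexed from [p = 0]. *)
Section Spectral.
Context {R : realType} {k : scalar_kind} {H : completeNormedModType (scalar_field R k)}.
Variables (ip : {dot H for @scalar_conj R k}) (lam : nat -> R) (phi : nat -> H).

Definition Hs_sqnorm (s : R) (v : H) : \bar R :=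
  (\sum_(0 <= p <oo)
     (lam p `^ (2 * s) * scalar_abs (ip v (phi p)) ^+ 2)%:E)%E.

Definition Hs (s : R) : set H := [set v | (Hs_sqnorm s v < +oo)%E].

(** Meaningful on [Hs s] only. *)
Definition Hs_norm (s : R) (v : H) : R := Num.sqrt (fine (Hs_sqnorm s v)).

(** [A^b], with domain [Hs b]. *)
Definition op_power (b : R) (v : H) : H :=
  limn (series (fun p =>
    (scalar_of k (lam p `^ b) * ip v (phi p)) *: phi p)).

Definition solves (a b T : R) (theta : H) (v : R -> H) :=
  v 0 = theta /\
  (forall t, t \in `]0, T[ -> Hs b (v t) /\
     exists2 d, is_caputo a T v t d & d + op_power b (v t) = 0).

(** [v] is a solution in the regularity class of the well-posedness statement,
    and [w] is its Caputo derivative on [(0, T]]. *)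
Definition regular_solution_with (s a b T : R) (theta : H) (v w : R -> H) :=
  [/\ solves a b T theta v,
      in_C (Hs s) (Hs_norm s) T v,
      in_Ca (Hs (b + s)) (Hs_norm (b + s)) a T v,
      forall t, t \in `]0, T] -> is_caputo a T v t (w t)
    & in_Ca (Hs s) (Hs_norm s) a T w].

Definition regular_solution (s a b T : R) (theta : H) (v : R -> H) :=
  exists w, regular_solution_with s a b T theta v w.

End Spectral.

(* Main.v *)
Require Import Defs.
From HB Require Import structures.
From mathcomp Require Import all_boot all_order all_algebra.
From mathcomp Require Import complex.
From mathcomp Require Import all_classical all_reals all_analysis.
From mathcomp Require Import measurable_realfun ring lra.
Set Implicit Arguments.
Unset Strict Implicit.
Unset Printing Implicit Defensive.
Import Order.TTheory GRing.Theory Num.Theory.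
Import numFieldNormedType.Exports.
Local Open Scope classical_set_scope.
Local Open Scope ring_scope.

(** Along an eigenvector the problem is the scalar Caputo equation whose solution is
    [e(t) = E_{a,1}(- m t^a)] with [m = lam p `^ b], so everything rests on bounds for
    [e] that are uniform in [a] and [m].  Let [J^a] be the fractional integral.  The
    semigroup law [J^a J^b = J^(a+b)] turns the Caputo equation into the Volterra
    equation [e + m J^a e = 1].  A solution of [y + m J^a y = f] is positive as soon as
    [f(0) > 0] and [t^(1-a) f(t)] is nondecreasing: applied to [e], to
    [e(t) - e(t + h)] and to differences of two such [e] plus a barrier, this gives
    [0 < e <= 1], monotonicity, the decay [m t^a e(t) <= 2] and Lipschitz dependence on
    [m] and [a], with no complex analysis.  Parseval's identity transfers these bounds to
    the norms of [H^s], dominated convergence for the coefficient sums gives continuity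
    and the time derivative, and a regular solution is identified by testing its Bochner
    integrals against the eigenvectors, which yields the scalar equation back. *)

(** * Convolutions and the Gamma function *)

(** The obstacle is memory: [J^a y (t + h)] is not the fractional integral of the shifted function,
    since the past on [(0, h)] keeps contributing ([frac_past]). That contribution decreases in [t],
    but not faster than [t^(a-1)], because the kernel [(t + h - r)^(a-1)] does not; this is why the
    positivity criterion weights its source by [t^(1-a)] instead of asking for a nondecreasing one.
    Dependence on [a] is harder than on [m]: varying the exponent of the kernel produces a
    logarithm, which is absorbed by passing to the kernel of order [al0 / 2], where [al0] bounds the
    orders from below; this kernel supplies the barrier. The resulting Lipschitz bound for the
    coefficients grows like [lam p] to the power [b1], and the smoothness [s - rho] has to pay for
    it. Interpolating with the trivial bound 1 to the exponent [gamma] costs only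
    [b1 * gamma <= s - rho], which is the origin of [gamma]. For [rho = s] nothing is left to pay
    with, so only convergence without a rate is obtained. *)

Section AffineChange.
Context {R : realType}.
Local Notation mu := (@lebesgue_measure R).
Local Open Scope ereal_scope.

Lemma affine_preimage_ocitv (c b x y : R) : (0 < c)%R ->
  (fun r : R => (c * r + b)%R) @^-1` `]x, y] =
  `](x - b) / c, (y - b) / c]%classic%R.
Proof.
move=> c0; apply/seteqP; split => r /=; rewrite !in_itv /=;
  by rewrite ltr_pdivrMr // ler_pdivlMr // ltrBlDr lerBrDr (mulrC r).
Qed.

Lemma measurable_affine (c b : R) :
  measurable_fun [set: R] (fun r : R => (c * r + b)%R : R).
Proof.
apply: continuous_measurable_fun => r; apply: cvgD; last exact: cvg_cst.
by apply: cvgMr; exact: cvg_id.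
Qed.

(** Lebesgue measure is determined by its values on half-open intervals, and the pushforward under
    the affine map, scaled by [c], has the same values there. *)
Lemma lebesgue_measure_affine (c b : R) (c0 : (0 < c)%R) (A : set R) :
  measurable A -> mu A = c%:E * mu ((fun r => (c * r + b)%R) @^-1` A).
Proof.
move=> mA; pose f := fun r : measurableTypeR R => (c * r + b)%R : measurableTypeR R.
have mf : measurable_fun setT f := measurable_affine c b.
pose m := (measure_function_pushforward__canonical__measure_function_Measure mu mf).
apply: (@lebesgue_measure_unique R (mscale (NngNum (ltW c0)) m) _ A mA).
move=> _ [[x y]] _ <- /=.
rewrite /mscale/= /pushforward affine_preimage_ocitv// !lebesgue_measure_itv/=.
rewrite !lte_fin ltr_pM2r ?invr_gt0// ltrD2r; case: ifPn => _; last by rewrite mule0.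
by rewrite -!EFinB -EFinM; congr EFin; field; rewrite gt_eqF.
Qed.

Lemma ge0_integral_affine (c b : R) (c0 : (0 < c)%R) (f : R -> \bar R) :
  measurable_fun setT f -> (forall x, 0 <= f x) ->
  \int[mu]_x f x = c%:E * \int[mu]_x f (c * x + b)%R.
Proof.
move=> mf f0; pose g := fun r : measurableTypeR R => (c * r + b)%R : measurableTypeR R.
have mg : measurable_fun setT g := measurable_affine c b.
pose m := (measure_function_pushforward__canonical__measure_function_Measure mu mg).
transitivity (\int[mscale (NngNum (ltW c0)) m]_x f x).
  by apply: eq_measure_integral => A mA _; exact: lebesgue_measure_affine.
rewrite (@ge0_integral_mscale _ _ _ m setT measurableT _ f)//; congr (_ * _).
by rewrite (ge0_integral_pushforward mg).
Qed.

End AffineChange.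

(** * Convolutions of nonnegative functions on the line *)

Section Convolution.
Context {R : realType}.
Local Notation mu := (@lebesgue_measure R).
Local Open Scope ereal_scope.
Variables (f g : R -> R).
Hypotheses (mf : measurable_fun setT f) (mg : measurable_fun setT g).
Hypotheses (f0 : forall x, (0 <= f x)%R) (g0 : forall x, (0 <= g x)%R).

Lemma ge0_integral_translate (b : R) :
  \int[mu]_x (f x)%:E = \int[mu]_x (f (x + b))%:E.
Proof.
rewrite (@ge0_integral_affine _ 1 b ltr01 (EFin \o f))//.
- by rewrite mul1e; apply: eq_integral => x _ /=; rewrite mul1r.
- exact/measurable_EFinP.
Qed.

(** Tonelli and translation invariance. Applied to two Gamma integrands it produces a product of
    Gamma values. *)
Lemma integral_convolution :
  \int[mu]_t \int[mu]_x (f (t - x) * g x)%:E =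
  (\int[mu]_x (f x)%:E) * (\int[mu]_x (g x)%:E).
Proof.
rewrite (@fubini_tonelli _ _ _ _ _ mu mu (fun p => (f (p.1 - p.2) * g p.2)%:E))/=; last first.
- by move=> x; rewrite lee_fin mulr_ge0.
- apply/measurable_EFinP; apply: measurable_funM.
    apply: (measurableT_comp mf); apply: measurable_funB => //.
  exact: (measurableT_comp mg).
transitivity (\int[mu]_x ((\int[mu]_y (f y)%:E) * (g x)%:E)).
  apply: eq_integral => x _.
  under eq_integral => t _ do rewrite EFinM.
  rewrite ge0_integralZr//; last first.
  - by rewrite lee_fin.
  - by move=> t _; rewrite lee_fin.
  - apply/measurable_EFinP; apply: (measurableT_comp mf).
    by apply: measurable_funB => //; exact: measurable_id.
  by congr (_ * _); rewrite (ge0_integral_translate (- x)).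
rewrite ge0_integralZl//; last first.
- by apply: integral_ge0 => x _; rewrite lee_fin.
- by move=> x _; rewrite lee_fin.
- exact/measurable_EFinP.
Qed.

(** Exchange the integrals, then translate the inner variable by [z]. This is the source of the
    semigroup law for fractional integrals. *)
Lemma convolution_assoc (h : R -> R) (t : R) :
  measurable_fun setT h -> (forall x, 0 <= h x)%R ->
  \int[mu]_x ((h (t - x))%:E * \int[mu]_z (f (x - z) * g z)%:E) =
  \int[mu]_z (\int[mu]_x (h (t - z - x) * f x)%:E * (g z)%:E).
Proof.
move=> mh h0.
transitivity (\int[mu]_x \int[mu]_z (h (t - x) * (f (x - z) * g z))%:E).
  apply: eq_integral => x _; rewrite -ge0_integralZl//.
  - apply/measurable_EFinP; apply: measurable_funM => //.
    apply: (measurableT_comp mf); apply: measurable_funB => //.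
  - by move=> z _; rewrite lee_fin mulr_ge0.
  - by rewrite lee_fin.
rewrite (@fubini_tonelli _ _ _ _ _ mu mu
    (fun p => (h (t - p.1) * (f (p.1 - p.2) * g p.2))%:E))/=; last first.
- by move=> x; rewrite lee_fin mulr_ge0// mulr_ge0.
- apply/measurable_EFinP; apply: measurable_funM.
    by apply: (measurableT_comp mh); apply: measurable_funB.
  apply: measurable_funM.
    apply: (measurableT_comp mf); apply: measurable_funB => //.
  exact: (measurableT_comp mg).
apply: eq_integral => z _.
transitivity (\int[mu]_x ((h (t - x) * f (x - z))%:E * (g z)%:E)).
  by apply: eq_integral => x _; rewrite -EFinM mulrA.
rewrite ge0_integralZr//; last first.
- by rewrite lee_fin.
- by move=> x _; rewrite lee_fin mulr_ge0.
- apply/measurable_EFinP; apply: measurable_funM.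
    by apply: (measurableT_comp mh); apply: measurable_funB.
  by apply: (measurableT_comp mf); apply: measurable_funB.
congr (_ * _).
rewrite (@ge0_integral_affine _ 1 z ltr01); last first.
- by move=> x; rewrite lee_fin mulr_ge0.
- apply/measurable_EFinP; apply: measurable_funM.
    by apply: (measurableT_comp mh); apply: measurable_funB.
  by apply: (measurableT_comp mf); apply: measurable_funB.
rewrite mul1e; apply: eq_integral => x _; rewrite mul1r addrK.
by rewrite opprD addrA addrAC.
Qed.

End Convolution.

(** * The Gamma function and the Beta integral *)

Section GammaFunction.
Context {R : realType}.
Local Notation mu := (@lebesgue_measure R).
Implicit Types a b s t x : R.

(** The kernel of order [a] cut off to the positive axis, so that fractional integrals become
    convolutions over the whole line. In particular [kpow 1] is the indicator of the open
    half-line. *)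
Definition kpow a s : R := if 0 < s then s `^ (a - 1) else 0.

Lemma kpow_ge0 a s : 0 <= kpow a s.
Proof. by rewrite /kpow; case: ifP => // _; exact: powR_ge0. Qed.

Lemma measurable_kpow a : measurable_fun setT (kpow a).
Proof.
apply: measurable_fun_if => //.
- exact: measurable_fun_ltr.
- by apply: measurable_funTS; exact: measurable_powR.
Qed.

Lemma kpowZ a (c : R) s : 0 < c -> kpow a (c * s) = c `^ (a - 1) * kpow a s.
Proof.
move=> c0; rewrite /kpow pmulr_rgt0//; case: ifP => s0; last by rewrite mulr0.
by rewrite powRM// ltW.
Qed.

Lemma powR_continuous_pos a s : 0 < s -> {for s, continuous (fun x => x `^ a)}.
Proof.
move=> s0; apply: differentiable_continuous; apply/derivable1_diffP.
by apply: derivable_powR; rewrite in_itv/= s0.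
Qed.

Lemma integral_kpow01 a : 0 < a ->
  (\int[mu]_(s in `]0%R, 1%R]) (s `^ (a - 1))%:E <= a^-1%:E)%E.
Proof.
move=> a0.
pose F n : set R := `[n.+1%:R^-1, 1%R]%classic.
have -> : `]0%R, 1%R]%classic = \bigcup_n F n.
  apply/seteqP; split => [s /=|s [n _]]; rewrite /F/= !in_itv/=.
    move=> /andP[s0 s1]; exists (Num.truncn s^-1) => //=.
    rewrite in_itv/= s1 andbT -[X in _ <= X](invrK s) lef_pV2 ?posrE ?invr_gt0// ltW//.
    exact: truncnS_gt.
  by move=> /andP[ns ->]; rewrite andbT (lt_le_trans _ ns)// invr_gt0.
have mp (D : set R) : measurable_fun D (fun s => (s `^ (a - 1))%:E).
  by apply/measurable_EFinP; apply: measurable_funTS; exact: measurable_powR.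
have Fcvg : (\int[mu]_(s in F n) (s `^ (a - 1))%:E @[n --> \oo] -->
    \int[mu]_(s in \bigcup_n F n) (s `^ (a - 1))%:E)%E.
  apply: ge0_nondecreasing_set_cvg_integral => //.
  - move=> m n mn; apply/subsetPset => s; rewrite /F/= !in_itv/= => /andP[ms ->].
    rewrite andbT (le_trans _ ms)// lef_pV2 ?posrE//.
    by rewrite ler_nat.
  - by move=> n; exact: measurable_itv.
  - by move=> n; exact: mp.
  - by move=> n x _; rewrite lee_fin powR_ge0.
rewrite -(cvg_lim _ Fcvg)//; apply: lime_le; first exact: cvgP Fcvg.
(* For [n = 0] the interval is the single point 1 and is treated apart, since integration by an
   antiderivative requires a nondegenerate interval. *)
apply: nearW => -[|n].
  rewrite /F invr1 set_itv1 integral_set1 lee_fin invr_ge0; exact: ltW.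
have n1 : (n.+2%:R^-1 < 1 :> R) by rewrite invf_lt1// ltr1n.
have n0 : (0 < n.+2%:R^-1 :> R) by rewrite invr_gt0.
rewrite (@continuous_FTC2 _ _ (fun s => a^-1 * s `^ a))//.
- rewrite -EFinB lee_fin powR1 mulr1 lerBlDr lerDl mulr_ge0 ?powR_ge0// invr_ge0 ltW//.
- apply: continuous_in_subspaceT => s; rewrite inE/= in_itv/= => /andP[ns _].
  by apply: powR_continuous_pos; exact: lt_le_trans ns.
- have co s : 0 < s -> {for s, continuous (fun s : R => a^-1 * s `^ a)}.
    by move=> s0; apply: cvgMr; exact: powR_continuous_pos.
  split.
  + move=> s; rewrite in_itv/= => /andP[ns _]; apply: derivableM => //.
    by apply: derivable_powR; rewrite in_itv/= (lt_trans n0 ns).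
  + by apply: cvg_at_right_filter; exact: co.
  + by apply: cvg_at_left_filter; apply: co.
- move=> s; rewrite in_itv/= => /andP[ns _].
  have s0 : s \in `]0, +oo[ by rewrite in_itv/= (lt_trans n0 ns).
  rewrite derive1E deriveM//; last exact: derivable_powR.
  rewrite derive_cst scaler0 addr0 -derive1E powR_derive1//.
  by rewrite /GRing.scale/= mulrA mulVf ?mul1r// gt_eqF.
Qed.


(** Rescale by [2 * a] and raise [x <= exp x] to the power [a]. The rate 1/2 leaves half of the
    decay of [exp (- s)] for convergence at infinity. *)
Lemma powR_le_expR a s : 0 < a -> 1 <= s ->
  s `^ (a - 1) <= (2 * a) `^ a * expR (2^-1 * s).
Proof.
move=> a0 s1; have s0 : 0 < s := lt_le_trans ltr01 s1.
have a20 : 0 < 2 * a by rewrite mulr_gt0.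
apply: (@le_trans _ _ (s `^ a)); first by apply: ler_powR => //; rewrite gerBl.
have -> : s `^ a = (2 * a) `^ a * (s / (2 * a)) `^ a.
  rewrite -powRM ?divr_ge0 ?(ltW a20) ?(ltW s0)//.
  by rewrite mulrC divfK// gt_eqF.
rewrite ler_wpM2l ?powR_ge0//.
apply: (@le_trans _ _ ((expR (s / (2 * a))) `^ a)).
  apply: ge0_ler_powR; rewrite ?nnegrE ?ltW// ?divr_gt0 ?expR_gt0//.
  by apply: lt_le_trans (expR_ge1Dx _); rewrite ltrDr.
rewrite -expRM ler_expR; rewrite le_eqVlt; apply/orP; left; apply/eqP.
by rewrite invfM mulrA -mulrA mulVf ?gt_eqF// mulr1 mulrC.
Qed.

Lemma integral_kpow_expR_lty a : 0 < a ->
  (\int[mu]_s (kpow a s * expR (- s))%:E < +oo)%E.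
Proof.
move=> a0; pose C := (2 * a) `^ a.
pose f1 := (fun s => s `^ (a - 1)) \_ (`]0%R, 1%R] : set R).
(* The exponential density of rate 1/2 carries a factor 1/2, which the 2 in [2 * C] cancels. *)
pose f2 := fun s => (2 * C)  * exponential_pdf 2^-1 s.
have f10 s : 0 <= f1 s by rewrite /f1 patchE; case: ifP => // _; exact: powR_ge0.
have C0 : 0 <= 2 * C by rewrite mulr_ge0// powR_ge0.
have f20 s : 0 <= f2 s by rewrite mulr_ge0// exponential_pdf_ge0.
have mf1 : measurable_fun setT f1.
  apply/(measurable_restrictT _ _).1 => //.
  by apply: measurable_funTS; exact: measurable_powR.
have mf2 : measurable_fun setT f2.
  by apply: measurable_funM => //; exact: measurable_exponential_pdf.
apply: (@le_lt_trans _ _ (\int[mu]_s ((f1 s)%:E + (f2 s)%:E)))%E.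
  apply: ge0_le_integral => //.
  - by move=> s _; rewrite lee_fin mulr_ge0 ?kpow_ge0 ?expR_ge0.
  - apply/measurable_EFinP; apply: measurable_funM; first exact: measurable_kpow.
    by apply: continuous_measurable_fun => s; apply: continuous_comp;
      [exact: opp_continuous|exact: continuous_expR].
  - by apply: emeasurable_funD; exact/measurable_EFinP.
  - move=> s _; rewrite -EFinD lee_fin /kpow.
    case: ltP => s0; last by rewrite mul0r addr_ge0.
    rewrite /f1 patchE /f2 (exponential_pdfE _ (ltW s0)).
    case: (leP s 1) => s1.
      rewrite mem_set/= ?in_itv/= ?s0 ?s1//.
      rewrite -[leLHS]addr0 lerD// ?mulr_ge0 ?expR_ge0 ?powR_ge0//.
      by rewrite ler_piMr ?powR_ge0// expR_le1 oppr_le0 ltW.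
    rewrite memNset/= ?in_itv/= ?s0/= ?(lt_geF s1)// add0r.
    rewrite [2 * C]mulrC -mulrA (mulrA 2) divff// mul1r.
    apply: (le_trans (ler_wpM2r (expR_ge0 _) (powR_le_expR a0 (ltW s1)))).
    by rewrite -mulrA -expRD ler_wpM2l ?powR_ge0// ler_expR; lra.
rewrite ge0_integralD//; last 4 first.
- by move=> s _; rewrite lee_fin.
- exact/measurable_EFinP.
- by move=> s _; rewrite lee_fin.
- exact/measurable_EFinP.
rewrite lte_add_pinfty//.
  apply: (@le_lt_trans _ _ (a^-1%:E)); last exact: ltry.
  apply: le_trans (integral_kpow01 a0).
  rewrite [leRHS]integral_mkcond/= le_eqVlt; apply/orP; left; apply/eqP.
  by apply: eq_integral => s _; rewrite /f1 !patchE; case: ifP.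
under eq_integral do rewrite EFinM.
rewrite ge0_integralZl//; last 2 first.
- by apply/measurable_EFinP; exact: measurable_exponential_pdf.
- by move=> s _; rewrite lee_fin exponential_pdf_ge0.
by rewrite integral_exponential_pdf ?invr_gt0// mule1 ltry.
Qed.

Lemma measurable_kpow_expR a : measurable_fun setT (fun s => kpow a s * expR (- s)).
Proof.
apply: measurable_funM; first exact: measurable_kpow.
by apply: continuous_measurable_fun => s; apply: continuous_comp;
  [exact: opp_continuous|exact: continuous_expR].
Qed.

Lemma kpow_expR_ge0 a s : 0 <= kpow a s * expR (- s).
Proof. by rewrite mulr_ge0 ?kpow_ge0 ?expR_ge0. Qed.

Lemma GammaE a : 0 < a -> ((Gamma a)%:E = \int[mu]_s (kpow a s * expR (- s))%:E)%E.
Proof.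
move=> a0; rewrite -[RHS]fineK; last first.
  rewrite ge0_fin_numE ?integral_kpow_expR_lty//.
  by apply: integral_ge0 => s _; rewrite lee_fin kpow_expR_ge0.
rewrite /Gamma Rintegral_mkcond /Rintegral; congr (fine _)%:E.
apply: eq_integral => s _; rewrite patchE /kpow; congr EFin.
case: ltP => s0; first by rewrite mem_set//= in_itv/= s0.
by rewrite memNset/= ?in_itv/= ?ltNge ?s0//= mul0r.
Qed.

Local Opaque Gamma.

Lemma ge0_integral_combination (f g h : R -> \bar R) (c d : R) :
  measurable_fun setT f -> measurable_fun setT g -> measurable_fun setT h ->
  (forall x, 0 <= f x)%E -> (forall x, 0 <= g x)%E -> (forall x, 0 <= h x)%E ->
  0 <= c -> 0 <= d ->
  (c%:E * \int[mu]_x f x + d%:E * (\int[mu]_x g x + \int[mu]_x h x) =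
   \int[mu]_x (c%:E * f x + d%:E * (g x + h x)))%E.
Proof.
move=> mf mg mh f0 g0 h0 c0 d0.
have mgh : measurable_fun setT (fun x => g x + h x)%E by exact: emeasurable_funD.
have gh0 x : (0 <= g x + h x)%E by exact: adde_ge0.
rewrite -ge0_integralD// -ge0_integralZl ?lee_fin// -ge0_integralZl ?lee_fin//.
rewrite -ge0_integralD//.
- by move=> x _; apply: mule_ge0.
- by apply: measurable_funeM.
- by move=> x _; apply: mule_ge0.
- by apply: measurable_funeM.
Qed.

(** Integrating a pointwise comparison of powers against [exp (- s)]. All upper estimates of Gamma
    below are read off from elementary inequalities in this way. *)
Lemma Gamma_le_combination a b a1 a2 (c0 c : R) :
  0 < a -> 0 < b -> 0 < a1 -> 0 < a2 -> 0 <= c0 -> 0 <= c ->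
  (forall s, 0 < s -> s `^ (a - 1) <=
     c0 * s `^ (b - 1) + c * (s `^ (a1 - 1) + s `^ (a2 - 1))) ->
  Gamma a <= c0 * Gamma b + c * (Gamma a1 + Gamma a2).
Proof.
move=> apos bpos a1pos a2pos c00 c0' H.
move: (GammaE apos) (GammaE bpos) (GammaE a1pos) (GammaE a2pos).
move: (Gamma a) (Gamma b) (Gamma a1) (Gamma a2) => Ga Gb Ga1 Ga2 Ea Eb Ea1 Ea2.
rewrite -lee_fin !(EFinD, EFinM) Ea Eb Ea1 Ea2.
pose g x s := (kpow x s * expR (- s))%:E.
have k0 x s : (0 <= g x s)%E by rewrite lee_fin kpow_expR_ge0.
have mk x : measurable_fun setT (g x).
  by apply/measurable_EFinP; exact: measurable_kpow_expR.
rewrite [X in (_ <= X)%E](_ : _ = \int[mu]_s (c0%:E * g b s + c%:E * (g a1 s + g a2 s)))%E; last first.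
  exact: (ge0_integral_combination (mk b) (mk a1) (mk a2)).
apply: ge0_le_integral => //.
- by move=> s _; exact: k0.
- exact: mk.
- apply: emeasurable_funD; apply: measurable_funeM; first exact: mk.
  by apply: emeasurable_funD; exact: mk.
move=> s _; rewrite [X in (_ <= X)%E](_ : _ = (c0 * (kpow b s * expR (- s)) +
  c * (kpow a1 s * expR (- s) + kpow a2 s * expR (- s)))%:E)// lee_fin -mulrDl !mulrA -mulrDl.
rewrite ler_wpM2r ?expR_ge0// /kpow; case: ltP => s0; last by rewrite !(addr0,mulr0).
exact: H.
Qed.

Lemma Gamma_lower_bound a (K c : R) : 0 < a -> 0 < K -> 0 <= c ->
  (forall s, K <= s <= K + 1 -> c <= s `^ (a - 1)) ->
  c * expR (- (K + 1)) <= Gamma a.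
Proof.
move=> a0 K0 c0 H; rewrite -lee_fin GammaE//.
have -> : (c * expR (- (K + 1)))%:E = (\int[mu]_(s in `[K, (K + 1)%R]) (cst (c * expR (- (K + 1)))%:E s))%E.
  rewrite integral_cst//= lebesgue_measure_itv/= lte_fin ltrDl ltr01.
  by rewrite -EFinB addrAC subrr add0r mule1.
rewrite integral_mkcond; apply: ge0_le_integral => //.
- move=> s _; rewrite patchE; case: ifP => // _; rewrite lee_fin.
  by rewrite mulr_ge0 ?expR_ge0.
- by apply/(measurable_restrictT _ _).1 => //.
- by apply/measurable_EFinP; exact: measurable_kpow_expR.
move=> s _; rewrite patchE; case: ifPn => [|_]; last by rewrite lee_fin kpow_expR_ge0.
rewrite inE/= in_itv/= => /andP[Ks sK]; rewrite lee_fin.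
have s0 := lt_le_trans K0 Ks.
apply: ler_pM; rewrite ?expR_ge0//; last by rewrite ler_expR lerN2.
by rewrite /kpow s0; apply: H; rewrite Ks.
Qed.

(** Only the interval [[1, 2]] is used, where the power is at least 1/2. The bound does not depend
    on [a], so the normalising factors of the kernels are bounded uniformly in the order. *)
Lemma Gamma_ge a : 0 < a -> 2^-1 * expR (- (1 + 1)) <= Gamma a.
Proof.
move=> a0; apply: Gamma_lower_bound => // s /andP[s1 s2].
have s0 := lt_le_trans ltr01 s1.
apply: (@le_trans _ _ (s `^ (- 1))).
  by rewrite powR_inv1 ?lef_pV2 ?posrE// ltW.
by apply: ler_powR => //; rewrite lerDr ltW.
Qed.

Lemma Gamma_gt0 a : 0 < a -> 0 < Gamma a.
Proof.
move=> a0; apply: lt_le_trans (Gamma_ge a0).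
by rewrite mulr_gt0 ?expR_gt0 ?invr_gt0.
Qed.

(** Here [K] is free: Gamma outgrows every exponential, which is what makes the Mittag-Leffler
    series converge everywhere. *)
Lemma Gamma_growth a (K : R) : 1 <= a -> 0 < K ->
  K `^ (a - 1) * expR (- (K + 1)) <= Gamma a.
Proof.
move=> a1 K0; apply: Gamma_lower_bound => //; first exact: lt_le_trans a1.
  exact: powR_ge0.
move=> s /andP[Ks _]; apply: ge0_ler_powR; rewrite ?nnegrE ?subr_ge0//.
  exact: ltW.
by rewrite ltW// (lt_le_trans K0).
Qed.

Lemma Gamma1 : Gamma 1 = 1 :> R.
Proof.
apply: EFin_inj; rewrite GammaE//.
rewrite -(@integral_exponential_pdf R 1)//.
transitivity (\int[mu]_(s in `[0%R, +oo[) (1 * expR (- 1 * s))%:E)%E; last first.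
  rewrite integral_mkcond; apply: eq_integral => s _.
  by rewrite /exponential_pdf !patchE; case: ifP.
rewrite -integral_itv_obnd_cbnd; last first.
  apply/measurable_EFinP; apply: measurable_funM => //.
  apply: measurable_funTS; apply: continuous_measurable_fun => s; apply: continuous_comp;
    [by apply: cvgMr; exact: cvg_id|exact: continuous_expR].
rewrite [RHS]integral_mkcond; apply: eq_integral => s _; rewrite patchE /kpow.
case: ltP => s0; last by rewrite memNset/= ?in_itv/= ?ltNge ?s0// mul0r.
rewrite mem_set/= ?in_itv/= ?s0//.
by rewrite subrr powRr0 !mul1r mulN1r.
Qed.


(** The Beta function, kept in the extended reals because its finiteness is a consequence of the
    product formula and not known beforehand. *)
Let beta a b := (\int[mu]_x (kpow a (1 - x) * kpow b x)%:E)%E.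

Lemma measurable_kpow_shift a t : measurable_fun setT (fun x => kpow a (t - x)).
Proof.
by apply: (measurableT_comp (measurable_kpow a)); exact: measurable_funB.
Qed.

Let convolution_kpow_scaling a b t : 0 < a -> 0 < b ->
  (\int[mu]_x (kpow a (t - x) * kpow b x)%:E = (kpow (a + b) t)%:E * beta a b)%E.
Proof.
move=> a0 b0; rewrite [X in (X%:E * _)%E]/kpow; case: (ltP 0 t) => t0; last first.
  rewrite mul0e integral0_eq// => x _; rewrite /kpow subr_gt0.
  case: ifP => [xt|]; last by rewrite mul0r.
  by rewrite ltNge (le_trans (ltW xt) t0) mulr0.
have mk (c x : R) : measurable_fun [set: R] (fun y : R => (kpow a (x - c * y) * kpow b (c * y))%:E).
  apply/measurable_EFinP; apply: measurable_funM.
    by apply: (measurableT_comp (measurable_kpow a)); apply: measurable_funB => //; apply: measurable_funM.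
  by apply: (measurableT_comp (measurable_kpow b)); apply: measurable_funM.
have k0 (c x y : R) : (0 <= (kpow a (x - c * y) * kpow b (c * y))%:E)%E.
  by rewrite lee_fin mulr_ge0 ?kpow_ge0.
rewrite (@ge0_integral_affine _ t 0 t0)/=; last 2 first.
- by have := mk 1 t; under eq_fun do rewrite mul1r.
- by move=> x; have := k0 1 t x; rewrite mul1r.
rewrite -ge0_integralZl; last 4 first.
- by [].
- have := mk t t; under [X in _ -> measurable_fun _ X]eq_fun do rewrite addr0.
  by [].
- by move=> x _; rewrite addr0.
- by rewrite lee_fin ltW.
rewrite /beta -ge0_integralZl; last 4 first.
- by [].
- by have := mk 1 1; under eq_fun do rewrite mul1r.
- by move=> x _; rewrite lee_fin mulr_ge0 ?kpow_ge0.
- by rewrite lee_fin powR_ge0.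
apply: eq_integral => x _; rewrite addr0 -!EFinM; congr EFin.
rewrite -{2}(mulr1 t) -mulrBr !kpowZ//.
have tn0 : t != 0 by rewrite gt_eqF.
have -> : t `^ (a + b - 1) = t * (t `^ (a - 1) * t `^ (b - 1)).
  rewrite -{2}(powRr1 (ltW t0)) -!powRD ?tn0 ?implybT//.
  by congr (_ `^ _); ring.
ring.
Qed.

(** By scaling, the convolution is [beta a b] times the kernel of order [a + b]. Multiplying by
    [exp (- t)], which factors through the convolution, and integrating in [t] gives [beta a b *
    Gamma (a + b) = Gamma a * Gamma b]; an infinite [beta a b] would contradict this. *)
Lemma convolution_kpow a b t : 0 < a -> 0 < b ->
  (\int[mu]_x (kpow a (t - x) * kpow b x)%:E =
   (Gamma a * Gamma b / Gamma (a + b) * kpow (a + b) t)%:E)%E.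
Proof.
move=> a0 b0; have ab0 : 0 < a + b := addr_gt0 a0 b0.
rewrite convolution_kpow_scaling// muleC EFinM; congr (_ * _)%E.
have b_ge0 : (0 <= beta a b)%E.
  by apply: integral_ge0 => x _; rewrite lee_fin mulr_ge0 ?kpow_ge0.
have E : (beta a b * (Gamma (a + b))%:E = (Gamma a)%:E * (Gamma b)%:E)%E.
  move: (GammaE ab0) (GammaE a0) (GammaE b0).
  move: (Gamma (a + b)) (Gamma a) (Gamma b) => G1 G2 G3 -> -> ->.
  rewrite -(integral_convolution (f := fun s => kpow a s * expR (- s))); last 4 first.
  - exact: measurable_kpow_expR.
  - exact: measurable_kpow_expR.
  - exact: kpow_expR_ge0.
  - exact: kpow_expR_ge0.
  rewrite -ge0_integralZl//; last 2 first.
  - by apply/measurable_EFinP; exact: measurable_kpow_expR.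
  - by move=> x _; rewrite lee_fin kpow_expR_ge0.
  apply: eq_integral => t' _.
  rewrite EFinM muleA [(beta a b * _)%E]muleC -convolution_kpow_scaling//.
  rewrite -ge0_integralZr//.
  - apply: eq_integral => x _; rewrite -EFinM; congr EFin.
    by rewrite mulrACA -expRD; congr (_ * expR _); ring.
  - apply/measurable_EFinP; apply: measurable_funM; last exact: measurable_kpow.
    exact: measurable_kpow_shift.
  - by move=> x _; rewrite lee_fin mulr_ge0 ?kpow_ge0.
move: E b_ge0; case: (beta a b) => [r| |] //=; last first.
  by rewrite gt0_mulye ?lte_fin ?Gamma_gt0.
move=> /(congr1 fine)/= E _; congr EFin.
by rewrite -E mulfK// gt_eqF// Gamma_gt0.
Qed.

End GammaFunction.

(** * Fractional integrals *)

Section FractionalIntegral.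
Context {R : realType}.
Local Notation mu := (@lebesgue_measure R).
Implicit Types (a b s t x : R) (y z : R -> R).
Local Opaque Gamma.

Let frac_int_def a y t : R :=
  (Gamma a)^-1 * \int[mu]_(r in `]0, t[) ((t - r) `^ (a - 1) * y r).
Fact frac_int_key : unit. Proof. by []. Qed.
Definition frac_int := locked_with frac_int_key frac_int_def.

Lemma frac_intE a y t : frac_int a y t =
  (Gamma a)^-1 * \int[mu]_(r in `]0, t[) ((t - r) `^ (a - 1) * y r).
Proof. by rewrite /frac_int unlock. Qed.

Lemma measurable_frac_integrand a y t : continuous y ->
  measurable_fun [set: R] (fun r : R => (t - r) `^ (a - 1) * y r).
Proof.
move=> cy; apply: measurable_funM; last exact: continuous_measurable_fun.
apply: (measurableT_comp (measurable_powR _)).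
exact: measurable_funB.
Qed.

Lemma integral_frac_integrandE a y t : (forall r, 0 <= y r) ->
  (\int[mu]_(r in `]0%R, t[) ((t - r) `^ (a - 1) * y r)%:E =
   \int[mu]_r (kpow a (t - r) * (kpow 1 r * y r))%:E)%E.
Proof.
move=> y0; rewrite integral_mkcond; apply: eq_integral => r _; rewrite patchE /kpow.
rewrite subr_gt0 subrr powRr0 mem_setE in_itv/=.
by case: (ltP 0 r) => //= _; case: ifP => // _; rewrite ?(mul1r,mul0r,mulr0).
Qed.

Lemma integral_frac_kernel_lty a t : 0 < a ->
  (\int[mu]_(r in `]0%R, t[) ((t - r) `^ (a - 1))%:E < +oo)%E.
Proof.
move=> a0; have := @integral_frac_integrandE a (cst 1) t (fun=> ler01).
under eq_integral do rewrite mulr1.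
move=> ->; under eq_integral do rewrite mulr1.
by rewrite convolution_kpow// ltry.
Qed.

Lemma frac_kernel_integrable a t : 0 < a ->
  mu.-integrable `]0, t[ (fun r => ((t - r) `^ (a - 1))%:E).
Proof.
move=> a0; apply/integrableP; split.
  apply/measurable_EFinP; apply: measurable_funTS.
  by apply: (measurableT_comp (measurable_powR _)); exact: measurable_funB.
under eq_integral do rewrite gee0_abs ?lee_fin ?powR_ge0//.
exact: integral_frac_kernel_lty.
Qed.

Lemma continuous_bounded y (T : R) : continuous y ->
  exists2 M, 0 <= M & forall r, `|r| <= T -> `|y r| <= M.
Proof.
move=> cy; have [T0|T0] := ltP T 0.
  by exists 0 => // r rT; have := le_lt_trans (le_trans (normr_ge0 r) rT) T0; rewrite ltxx.
have cy' : {within `[- T, T], continuous (fun r => `|y r|)}.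
  apply: continuous_subspaceT => r; apply: continuous_comp; first exact: cy.
  exact: norm_continuous.
have TT : - T <= T by rewrite (le_trans _ T0)// oppr_le0.
have [c _ H] := EVT_max TT cy'.
by exists `|y c| => // r rT; apply: H; rewrite in_itv/= -ler_norml.
Qed.

Lemma frac_integrable a y t : 0 < a -> continuous y ->
  mu.-integrable `]0, t[ (EFin \o (fun r => (t - r) `^ (a - 1) * y r)).
Proof.
move=> a0 cy; have [M M0 HM] := continuous_bounded t cy.
apply: (le_integrable _ _ _ (integrableZl _ M (frac_kernel_integrable t a0))) => //.
  by apply/measurable_EFinP; apply: measurable_funTS; exact: measurable_frac_integrand.
move=> r; rewrite /= in_itv/= => /andP[r0 rt]; rewrite lee_fin.
rewrite normrM mulrC [leRHS]normrM ler_wpM2r// (ger0_norm M0).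
by apply: HM; rewrite ger0_norm ltW.
Qed.

Lemma eq_frac_int a y z t : (forall r, 0 < r < t -> y r = z r) ->
  frac_int a y t = frac_int a z t.
Proof.
move=> yz; rewrite !frac_intE; congr (_ * _); apply: eq_Rintegral => r; rewrite inE/= in_itv/= => rt.
by rewrite yz.
Qed.

Lemma frac_int_le0 a y t : t <= 0 -> frac_int a y t = 0.
Proof.
by move=> t0; rewrite frac_intE set_itv_ge ?bnd_simp -?leNgt// Rintegral_set0 mulr0.
Qed.

Lemma frac_intD a y z t : 0 < a -> continuous y -> continuous z ->
  frac_int a (fun r => y r + z r) t = frac_int a y t + frac_int a z t.
Proof.
move=> a0 cy cz; rewrite !frac_intE -mulrDr -RintegralD//; try exact: frac_integrable.
by congr (_ * _); apply: eq_Rintegral => r _; rewrite mulrDr.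
Qed.

Lemma frac_intZ a y (c : R) t : 0 < a -> continuous y ->
  frac_int a (fun r => c * y r) t = c * frac_int a y t.
Proof.
move=> a0 cy; rewrite !frac_intE mulrCA; congr (_ * _).
rewrite -RintegralZl//; last exact: frac_integrable.
by apply: eq_Rintegral => r _; rewrite mulrCA.
Qed.

Lemma frac_intN a y t : 0 < a -> continuous y ->
  frac_int a (fun r => - y r) t = - frac_int a y t.
Proof.
move=> a0 cy; rewrite -mulN1r -frac_intZ//.
by apply: eq_frac_int => r _; rewrite mulN1r.
Qed.

Lemma frac_intB a y z t : 0 < a -> continuous y -> continuous z ->
  frac_int a (fun r => y r - z r) t = frac_int a y t - frac_int a z t.
Proof.
move=> a0 cy cz; rewrite -frac_intN// -frac_intD//.
by move=> r; apply: cvgN; exact: cz.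
Qed.

Lemma le_frac_int a y z t : 0 < a -> continuous y -> continuous z ->
  (forall r, 0 < r < t -> y r <= z r) -> frac_int a y t <= frac_int a z t.
Proof.
move=> a0 cy cz yz; rewrite !frac_intE ler_wpM2l ?invr_ge0 ?(ltW (Gamma_gt0 _))//.
apply: le_Rintegral => //; try exact: frac_integrable.
by move=> r/=; rewrite in_itv/= => rt; rewrite ler_wpM2l ?powR_ge0 ?yz.
Qed.

Lemma frac_int_ge0 a y t : 0 < a -> (forall r, 0 < r < t -> 0 <= y r) ->
  0 <= frac_int a y t.
Proof.
move=> a0 y0; rewrite frac_intE mulr_ge0 ?invr_ge0 ?(ltW (Gamma_gt0 _))//.
apply: Rintegral_ge0 => r/=; rewrite in_itv/= => rt.
by rewrite mulr_ge0 ?powR_ge0 ?y0.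
Qed.

(** The passage to a convolution over the whole line, where Tonelli and affine substitutions apply;
    both require nonnegative functions. *)
Lemma frac_int_ge0E a y t : 0 < a -> continuous y -> (forall r, 0 <= y r) ->
  ((Gamma a * frac_int a y t)%:E =
   \int[mu]_r (kpow a (t - r) * (kpow 1 r * y r))%:E)%E.
Proof.
move=> a0 cy y0; rewrite !frac_intE mulrA divff ?gt_eqF ?Gamma_gt0// mul1r.
rewrite -integral_frac_integrandE// fineK//.
by apply: integrable_fin_num => //; exact: frac_integrable.
Qed.

Lemma frac_int_kpow a b y t : 0 < a -> 0 < b ->
  (forall r, 0 < r < t -> y r = r `^ (b - 1)) ->
  frac_int a y t = Gamma b / Gamma (a + b) * kpow (a + b) t.
Proof.
move=> a0 b0 yr; rewrite !frac_intE /Rintegral.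
have -> : (\int[mu]_(r in `]0%R, t[) ((t - r) `^ (a - 1) * y r)%:E =
   \int[mu]_r (kpow a (t - r) * kpow b r)%:E)%E.
  rewrite integral_mkcond; apply: eq_integral => r _; rewrite patchE /kpow.
  rewrite subr_gt0 mem_setE in_itv/=.
  case: (ltP 0 r) => [r0|]//=; last by rewrite mulr0.
  by case: ifPn => [rt|]; rewrite ?mul0r// yr// r0 rt.
rewrite convolution_kpow//= !mulrA mulVf ?mul1r// gt_eqF// Gamma_gt0//.
Qed.

(** A power frozen at its value in 0 on the negative axis, hence continuous on the whole line for
    [0 <= b]; for [b = 0] it is the constant 1. *)
Definition ppow b t : R := Num.max 0 t `^ b.
Arguments ppow : simpl never.

Lemma ppow_ge0 b t : 0 <= ppow b t. Proof. exact: powR_ge0. Qed.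

Lemma ppowE b t : 0 <= t -> ppow b t = t `^ b.
Proof. by move=> t0; rewrite /ppow max_r. Qed.

Lemma ppow_le0 b t : b != 0 -> t <= 0 -> ppow b t = 0.
Proof. by move=> b0 t0; rewrite /ppow max_l// powR0. Qed.

Lemma le_ppow b s t : 0 <= b -> s <= t -> ppow b s <= ppow b t.
Proof.
move=> b0 st; rewrite /ppow; apply: ge0_ler_powR => //.
- by rewrite nnegrE le_max lexx.
- by rewrite nnegrE le_max lexx.
- by rewrite ge_max !le_max lexx st orbT.
Qed.

Lemma continuous_ppow b : 0 <= b -> continuous (ppow b).
Proof.
rewrite le_eqVlt => /predU1P[<- t|b0 t].
  rewrite (_ : ppow 0 = cst 1); first exact: cvg_cst.
  by apply/funext => s; rewrite /ppow powRr0.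
have [t0|t0] := ltP 0 t.
  apply: (@continuous_comp _ _ _ (fun x => Num.max 0 x) (fun x => x `^ b)); last first.
    by apply: powR_continuous_pos; rewrite lt_max t0 orbT.
  by apply: continuous_max; [exact: cvg_cst|exact: cvg_id].
apply/cvgrPdist_lt => e e0; rewrite (ppow_le0 _ t0) ?gt_eqF//.
have d0 : 0 < (e / 2) `^ b^-1 by rewrite powR_gt0// divr_gt0.
near=> s; rewrite sub0r normrN ger0_norm ?ppow_ge0//.
have sd : s < (e / 2) `^ b^-1.
  by near: s; apply: lt_nbhsl; exact: le_lt_trans t0 d0.
apply: (@le_lt_trans _ _ (((e / 2) `^ b^-1) `^ b)).
  apply: ge0_ler_powR; rewrite ?nnegrE ?le_max ?lexx ?(ltW b0) ?(ltW d0)//.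
  by rewrite ge_max (ltW sd) ltW.
rewrite -powRrM mulVf ?gt_eqF// powRr1 ?divr_ge0 ?ltW//.
by rewrite ltr_pdivrMr// ltr_pMr// ltr1n.
Unshelve. all: by end_near. Qed.

Lemma frac_int_ppow a b t : 0 < a -> 0 <= b ->
  frac_int a (ppow b) t = Gamma (b + 1) / Gamma (a + b + 1) * ppow (a + b) t.
Proof.
move=> a0 b0; rewrite (@frac_int_kpow a (b + 1))//; last 2 first.
- by rewrite ltr_wpDl.
- by move=> r /andP[r0 _]; rewrite addrK ppowE// ltW.
rewrite addrA; congr (_ * _); rewrite /kpow addrK; case: ltP => t0.
  by rewrite ppowE// ltW.
by rewrite ppow_le0// gt_eqF// ltr_pwDl.
Qed.

Lemma frac_int_cst a (c : R) t : 0 < a -> frac_int a (cst c) t = c / Gamma (a + 1) * ppow a t.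
Proof.
move=> a0; have c1 : continuous (cst 1 : R -> R) by move=> r; exact: cvg_cst.
have -> : frac_int a (cst c) t = c * frac_int a (cst 1) t.
  by rewrite -frac_intZ//; apply: eq_frac_int => r _; rewrite mulr1.
have -> : frac_int a (cst 1) t = frac_int a (ppow 0) t.
  by apply: eq_frac_int => r _; rewrite /ppow powRr0.
by rewrite frac_int_ppow// add0r Gamma1 addr0 div1r mulrA.
Qed.

(** Integral identities are proved for nonnegative functions first and extended to signed ones by
    linearity through this decomposition. *)
Definition pos_part y r := Num.max (y r) 0.

Lemma pos_partE y : y = (fun r => pos_part y r - pos_part (fun r => - y r) r).
Proof.
apply/funext => r; rewrite /pos_part; have [y0|y0] := leP (y r) 0.
  by rewrite max_l ?oppr_ge0// sub0r opprK.
by rewrite max_r ?oppr_le0 ?ltW// subr0.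
Qed.

Lemma continuous_pos_part y : continuous y -> continuous (pos_part y).
Proof. by move=> cy r; apply: continuous_max; [exact: cy|exact: cvg_cst]. Qed.

Lemma pos_part_ge0 y r : 0 <= pos_part y r. Proof. by rewrite le_max lexx orbT. Qed.

Let continuousN y : continuous y -> continuous (fun r => - y r).
Proof. by move=> cy r; apply: cvgN; exact: cy. Qed.

Let continuous_scale y t : continuous y -> continuous (fun r => y (t * r)).
Proof.
move=> cy r; apply: (@continuous_comp _ _ _ (fun r => t * r) y); last exact: cy.
by apply: cvgMr; exact: cvg_id.
Qed.

(** The substitution [r = t * u] removes [t] from the domain and from the singular kernel, so
    continuity in [t] becomes dominated convergence with one fixed integrable kernel. *)
Lemma frac_int_scaled a y t : 0 < a -> continuous y ->
  frac_int a y t = ppow a t * frac_int a (fun u => y (t * u)) 1.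
Proof.
move=> a0; have [t0 _|t0] := leP t 0.
  by rewrite ppow_le0 ?gt_eqF// mul0r frac_int_le0.
suff pos z : continuous z -> (forall r, 0 <= z r) ->
    frac_int a z t = ppow a t * frac_int a (fun u => z (t * u)) 1.
  move=> cy; have cN := continuousN cy; have p0 := pos_part_ge0.
  have cp := continuous_pos_part cy; have cn := continuous_pos_part cN.
  rewrite (pos_partE y) frac_intB//.
  rewrite (pos _ cp)// (pos _ cn)// -mulrBr.
  by rewrite -frac_intB//; exact: continuous_scale.
move=> cz z0; have cz' := continuous_scale (t := t) cz.
apply: (mulfI (lt0r_neq0 (Gamma_gt0 a0))); apply: EFin_inj.
rewrite frac_int_ge0E// mulrCA EFinM (frac_int_ge0E 1 a0 cz')//.
rewrite (@ge0_integral_affine _ t 0 t0)//=; last 2 first.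
- apply/measurable_EFinP; apply: measurable_funM; first exact: measurable_kpow_shift.
  apply: measurable_funM; first exact: measurable_kpow.
  exact: continuous_measurable_fun.
- by move=> x; rewrite lee_fin !mulr_ge0 ?kpow_ge0.
have mk : measurable_fun [set: R] (fun u : R => (kpow a (1 - u) * (kpow 1 u * z (t * u)))%:E).
  apply/measurable_EFinP; apply: measurable_funM; first exact: measurable_kpow_shift.
  apply: measurable_funM; first exact: measurable_kpow.
  exact: continuous_measurable_fun.
have -> : (\int[mu]_x (kpow a (t - (t * x + 0)) * (kpow 1 (t * x + 0) * z (t * x + 0)))%:E =
  (t `^ (a - 1))%:E * \int[mu]_x (kpow a (1 - x) * (kpow 1 x * z (t * x)))%:E)%E.
  rewrite -ge0_integralZl//.
  - apply: eq_integral => x _; rewrite addr0 -EFinM; congr EFin.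
    have -> : t - t * x = t * (1 - x) by rewrite mulrBr mulr1.
    by rewrite (kpowZ a _ t0) (kpowZ 1 _ t0) subrr powRr0 mul1r -!mulrA.
  - by move=> x _; rewrite lee_fin !mulr_ge0 ?kpow_ge0.
  - by rewrite lee_fin powR_ge0.
rewrite muleA -EFinM ppowE ?(ltW t0)//; congr (_%:E * _)%E.
by rewrite mulr_powRB1// ltW.
Qed.

Lemma continuous_frac_int a y : 0 < a -> continuous y -> continuous (frac_int a y).
Proof.
move=> a0 cy.
have -> : frac_int a y = (fun t => ppow a t * frac_int a (fun u => y (t * u)) 1).
  by apply/funext => t; exact: frac_int_scaled.
move=> t; apply: cvgM; first by apply: continuous_ppow; exact: ltW.
under eq_fun do rewrite frac_intE; rewrite frac_intE.
apply: cvgMr.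
(* This radius covers [l * u] for all [l] within distance 1 of [t] and all [u] in [(0, 1)]. *)
have [M M0 HM] := continuous_bounded (`|t : R| + 1) cy.
have tI : (t : R) \in (`](t : R) - 1, (t : R) + 1[%classic : set R).
  by rewrite inE/= in_itv/= ltrBlDr ltrDl ltr01.
apply: (@continuity_under_integral R _ _ mu
  (fun l u => (1 - u) `^ (a - 1) * y (l * u)) `]0%R, 1%R[%classic _ (t - 1) (t + 1) _ _
  (fun u => M * (1 - u) `^ (a - 1)) _ _ t tI).
- exact: measurable_itv.
- by move=> l _; apply: frac_integrable => //; exact: continuous_scale.
- apply: aeW => u _ l _; apply: cvgMr.
  have := continuous_scale (t := u) cy.
  by under eq_fun do rewrite mulrC; apply.
- exact: (integrableZl _ M (frac_kernel_integrable 1 a0)).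
- move=> l; rewrite /= in_itv/= => /andP[l1 l2]; apply: aeW => u.
  rewrite /= in_itv/= => /andP[u0 u1].
  rewrite normrM (ger0_norm (powR_ge0 _ _)) mulrC ler_wpM2r ?powR_ge0//.
  apply: HM; rewrite normrM (ger0_norm (ltW u0)).
  apply: (@le_trans _ _ `|l|); first by rewrite ler_piMr// ltW.
  have -> : l = t + (l - t) by rewrite addrC subrK.
  rewrite (le_trans (ler_normD _ _))// lerD2l ler_norml.
  by apply/andP; split; [rewrite lerBrDl; exact: ltW l1|rewrite lerBlDl; exact: ltW l2].
Qed.

(** Associativity of convolution combined with the Beta integral: the two kernels convolve to the
    kernel of order [a + b], and the Gamma factors cancel. *)
Lemma frac_int_semigroup a b y t : 0 < a -> 0 < b -> continuous y ->
  frac_int a (frac_int b y) t = frac_int (a + b) y t.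
Proof.
move=> a0 b0; have ab0 : 0 < a + b := addr_gt0 a0 b0.
suff pos z : continuous z -> (forall r, 0 <= z r) ->
    frac_int a (frac_int b z) t = frac_int (a + b) z t.
  move=> cy; have cN := continuousN cy; have p0 := pos_part_ge0.
  have cp := continuous_pos_part cy; have cn := continuous_pos_part cN.
  rewrite (pos_partE y) (frac_intB _ ab0)// -(pos _ cp)// -(pos _ cn)//.
  rewrite -frac_intB//; try exact: continuous_frac_int.
  by congr frac_int; apply/funext => r; rewrite frac_intB.
move=> cz z0.
have Jz0 r : 0 <= frac_int b z r by apply: frac_int_ge0.
have cJ := continuous_frac_int b0 cz.
have GaGb : Gamma a * Gamma b != 0 by rewrite mulf_neq0// gt_eqF// Gamma_gt0.
apply: (mulfI GaGb); apply: EFin_inj.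
rewrite mulrAC EFinM (frac_int_ge0E t a0 cJ)//.
have mz : measurable_fun [set: R] (fun r : R => kpow 1 r * z r).
  apply: measurable_funM; first exact: measurable_kpow.
  exact: continuous_measurable_fun.
have z10 r : 0 <= kpow 1 r * z r by rewrite mulr_ge0// kpow_ge0.
rewrite muleC -ge0_integralZl//; last 3 first.
- apply/measurable_EFinP; apply: measurable_funM; first exact: measurable_kpow_shift.
  apply: measurable_funM; first exact: measurable_kpow.
  exact: continuous_measurable_fun.
- by move=> x _; rewrite lee_fin mulr_ge0 ?kpow_ge0// mulr_ge0 ?kpow_ge0.
- by rewrite lee_fin ltW// Gamma_gt0.
transitivity (\int[mu]_r ((kpow a (t - r))%:E * \int[mu]_x (kpow b (r - x) * (kpow 1 x * z x))%:E))%E.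
  apply: eq_integral => r _; rewrite -frac_int_ge0E// -!EFinM; congr EFin.
  rewrite mulrCA; congr (_ * _); congr (_ * _).
  rewrite /kpow; case: ltP => r0; last by rewrite mul0r frac_int_le0.
  by rewrite subrr powRr0 mul1r.
rewrite (convolution_assoc (measurable_kpow b) mz (kpow_ge0 b) z10 t (measurable_kpow a) (kpow_ge0 a)).
under eq_integral do rewrite convolution_kpow// EFinM -muleA.
rewrite ge0_integralZl//; last 3 first.
- apply: emeasurable_funM; apply/measurable_EFinP; last exact: mz.
  exact: measurable_kpow_shift.
- by move=> x _; rewrite -EFinM lee_fin mulr_ge0// kpow_ge0.
- by rewrite lee_fin divr_ge0 ?mulr_ge0// ltW// Gamma_gt0.
under eq_integral do rewrite -EFinM.
rewrite -frac_int_ge0E// -EFinM; congr EFin.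
by rewrite !mulrA divfK// gt_eqF// Gamma_gt0.
Qed.

End FractionalIntegral.

(** * The Mittag-Leffler function *)

Section MittagLefflerFunction.
Context {R : realType}.
Local Notation mu := (@lebesgue_measure R).
Implicit Types (a h m s t x : R) (y : R -> R).
Local Opaque Gamma.

Lemma dist3_le (x1 x2 y1 y2 : R) :
  `|x1 - x2| <= `|x1 - y1| + `|y1 - y2| + `|x2 - y2|.
Proof.
have -> : x1 - x2 = (x1 - y1) + (y1 - y2) - (x2 - y2) by ring.
by rewrite (le_trans (ler_normB _ _))// lerD2r ler_normD.
Qed.

(** The explicit tail makes the convergence uniform: [C] will depend only on a bound for the
    argument of the series. *)
Lemma geometric_domination (u : nat -> R) (C : R) :
  (forall n, `|u n| <= C * 2^-1 ^+ n) ->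
  cvgn (series u) /\
  forall N, `|limn (series u) - series u N| <= C * 2 * 2^-1 ^+ N.
Proof.
move=> uC.
have q1 : `|2^-1 : R| < 1 by rewrite ger0_norm ?invr_ge0// invf_lt1// ltr1n.
have C0 : 0 <= C by have := le_trans (normr_ge0 _) (uC 0%N); rewrite expr0 mulr1.
have cu : cvgn (series u).
  apply: normed_cvg; apply: (@series_le_cvg _ _ (geometric C 2^-1)) => //.
  - by move=> n /=.
  - by move=> n; rewrite /geometric/= mulr_ge0// exprn_ge0// invr_ge0.
  - exact: is_cvg_geometric_series.
split => // N.
have step (m : nat) : `|series u (N + m)%N - series u N| <= C * 2 * (2^-1 ^+ N - 2^-1 ^+ (N + m)).
  elim: m => [|m IH]; first by rewrite addn0 !subrr normr0 mulr0.
  rewrite addnS seriesSr [_ + u _]addrC -addrA (le_trans (ler_normD _ _))//.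
  apply: (le_trans (lerD (uC _) IH)).
  by rewrite exprSr le_eqVlt; apply/orP; left; apply/eqP; field.
apply/ler_addgt0Pr => e e0.
have /cvgrPdist_lt /(_ _ e0) [M _ HM] := cu.
have := HM (N + M)%N (leq_addl _ _); have := step M => h1 h2.
have -> : limn (series u) - series u N =
  (series u (N + M)%N - series u N) + (limn (series u) - series u (N + M)%N) by ring.
rewrite (le_trans (ler_normD _ _))// lerD ?(ltW h2)// (le_trans h1)//.
by rewrite ler_wpM2l ?mulr_ge0// gerBl exprn_ge0// invr_ge0.
Qed.

Lemma ml_term_le a (X : R) : 0 < a -> 0 <= X ->
  exists C : R, forall x (n : nat), `|x| <= X ->
    `|x ^+ n / Gamma (n%:R * a + 1)| <= C * 2^-1 ^+ n.
Proof.
(* With this [K] the growth bound for [Gamma (n * a + 1)] contains exactly [(2 * (X + 1))^n], which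
   beats [X^n] by the factor [2^n]. *)
move=> a0 X0; pose K := (2 * (X + 1)) `^ a^-1.
have X10 : 0 < 2 * (X + 1) by rewrite mulr_gt0// ltr_wpDl.
have K0 : 0 < K by rewrite powR_gt0.
exists (expR (K + 1)) => x n xX.
have na : 0 <= n%:R * a by rewrite mulr_ge0// ltW.
have G0 : 0 < Gamma (n%:R * a + 1) by apply: Gamma_gt0; rewrite ltr_wpDl.
rewrite normrM normrX [`|_^-1|]ger0_norm ?invr_ge0 ?(ltW G0)// ler_pdivrMr//.
have := @Gamma_growth _ (n%:R * a + 1) K; rewrite lerDr => /(_ na K0).
rewrite addrK -powRrM [a^-1 * _]mulrCA mulVf ?gt_eqF// mulr1 powR_mulrn ?(ltW X10)//.
move=> Gg.
apply: (@le_trans _ _ (expR (K + 1) * 2^-1 ^+ n * ((2 * (X + 1)) ^+ n * expR (- (K + 1))))).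
  have -> : expR (K + 1) * 2^-1 ^+ n * ((2 * (X + 1)) ^+ n * expR (- (K + 1))) =
     (expR (K + 1) * expR (- (K + 1))) * ((2^-1 ^+ n * 2 ^+ n) * (X + 1) ^+ n).
    by rewrite exprMn; ring.
  rewrite expRxMexpNx_1 mul1r -exprMn mulVf// expr1n mul1r.
  by rewrite lerXn2r ?nnegrE ?addr_ge0// (le_trans xX)// lerDl.
by rewrite ler_wpM2l// mulr_ge0 ?expR_ge0// exprn_ge0// invr_ge0.
Qed.

Let mlterm a m t (n : nat) : R := (- (m * ppow a t)) ^+ n / Gamma (n%:R * a + 1).

Let mlf_def a m t : R := mittag_leffler a (- (m * ppow a t)).
Fact mlf_key : unit. Proof. by []. Qed.
(** [t |-> E_{a,1}(- m t^a)] extended by [1] to the negative axis, which makes it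
    continuous on the whole line. *)
Definition mlf := locked_with mlf_key mlf_def.

Lemma mlfE a m t : mlf a m t = mittag_leffler a (- (m * ppow a t)).
Proof. by rewrite /mlf unlock. Qed.

Let ml_tail a m (T : R) : 0 < a -> exists C : R, forall t (N : nat), t <= T ->
  `|mlf a m t - series (mlterm a m t) N| <= C * 2^-1 ^+ N.
Proof.
move=> a0; have [C HC] := @ml_term_le a (`|m| * ppow a T) a0 (mulr_ge0 (normr_ge0 _) (ppow_ge0 _ _)).
exists (C * 2) => t N tT; rewrite mlfE.
apply: (geometric_domination _).2 => n; apply: HC.
rewrite normrN normrM ler_wpM2l// ger0_norm ?ppow_ge0//.
by apply: le_ppow => //; exact: ltW.
Qed.

Let continuous_ml_partial a m N : 0 < a -> continuous (fun t => series (mlterm a m t) N).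
Proof.
move=> a0; elim: N => [|N IH] t.
  by under eq_fun do rewrite /series/= big_geq//; exact: cvg_cst.
under eq_fun do rewrite seriesSr.
apply: cvgD; first exact: IH.
apply: cvgMl.
apply: (@continuous_comp _ _ _ (fun t => - (m * ppow a t)) (fun x => x ^+ N)); last exact: exprn_continuous.
by apply: cvgN; apply: cvgMr; apply: continuous_ppow; exact: ltW.
Qed.

Let pow2_small (C e : R) : 0 < e -> exists N : nat, C * 2^-1 ^+ N < e.
Proof.
move=> e0; have q1 : `|2^-1 : R| < 1 by rewrite ger0_norm ?invr_ge0// invf_lt1// ltr1n.
have /cvgrPdist_lt /(_ _ e0) [M _ HM] := cvg_geometric C q1.
exists M; have := HM M (leqnn _); rewrite /geometric/= sub0r normrN.
exact: le_lt_trans (ler_norm _).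
Qed.

Lemma continuous_mlf a m : 0 < a -> continuous (mlf a m).
Proof.
move=> a0 t; apply/cvgrPdist_lt => e e0.
have [C HC] := @ml_tail a m (t + 1) a0.
have [N HN] := pow2_small C (divr_gt0 e0 (ltr0n _ 4)).
have /cvgrPdist_lt /(_ _ (divr_gt0 e0 (ltr0n _ 4))) := @continuous_ml_partial a m N a0 t.
move=> HS; near=> s.
have st : s <= t + 1 by near: s; apply: lt_le_nbhsl; rewrite ltrDl.
have H : `|series (mlterm a m t) N - series (mlterm a m s) N| < e / 4.
  by near: s; exact: HS.
have h1 := le_lt_trans (HC _ N st) HN.
have tt1 : t <= t + 1 by rewrite lerDl.
have h2 := le_lt_trans (HC _ N tt1) HN.
apply: le_lt_trans (dist3_le _ _ (series (mlterm a m t) N) (series (mlterm a m s) N)) _.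
have -> : e = e / 4 + e / 4 + e / 4 + e / 4 by field.
apply: (@lt_trans _ _ (e / 4 + e / 4 + e / 4)); last by rewrite ltrDl divr_gt0.
by apply: (ltrD _ h1); exact: (ltrD h2 H).
Unshelve. all: by end_near. Qed.

Lemma frac_int_dist a y z (c : R) t : 0 < a -> continuous y -> continuous z ->
  (forall r, 0 < r < t -> `|y r - z r| <= c) ->
  `|frac_int a y t - frac_int a z t| <= c / Gamma (a + 1) * ppow a t.
Proof.
move=> a0 cy cz yz; rewrite -frac_intB//.
have cyz : continuous (fun r => y r - z r) by move=> r; apply: cvgB; [exact: cy|exact: cz].
have cc d : continuous (cst d : R -> R) by move=> r; exact: cvg_cst.
rewrite ler_norml; apply/andP; split.
  rewrite -!mulNr -frac_int_cst//; apply: le_frac_int => // r /yz.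
  by rewrite ler_norml => /andP[].
rewrite -frac_int_cst//; apply: le_frac_int => // r /yz.
by rewrite ler_norml => /andP[].
Qed.

(** Applying [- m J^a] to a term of the series yields the next term, because [J^a] sends [t^(n a)]
    to [Gamma (n a + 1) / Gamma (n a + a + 1)] times [t^(n a + a)]. Hence the shift from [N] to
    [N.+1]. *)
Let ml_partial_volterra a m N t : 0 < a ->
  series (mlterm a m t) N.+1 = 1 - m * frac_int a (fun s => series (mlterm a m s) N) t.
Proof.
move=> a0; elim: N => [|N IH].
  have -> : frac_int a (fun s => series (mlterm a m s) 0) t = frac_int a (cst 0) t.
    by apply: eq_frac_int => r _; rewrite /series/= big_geq.
  rewrite frac_int_cst// mul0r mul0r mulr0 subr0 seriesSr /series/= big_geq// add0r.
  by rewrite /mlterm expr0 mul0r add0r Gamma1 divr1.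
rewrite seriesSr IH.
have -> : frac_int a (fun s => series (mlterm a m s) N.+1) t =
   frac_int a (fun s => series (mlterm a m s) N) t +
   (- m) ^+ N / Gamma (N%:R * a + 1) * frac_int a (ppow (N%:R * a)) t.
  have Na : 0 <= N%:R * a by rewrite mulr_ge0// ltW.
  rewrite -frac_intZ//; last exact: continuous_ppow.
  rewrite -frac_intD//; last 2 first.
  - exact: continuous_ml_partial.
  - by move=> r; apply: cvgMr; exact: continuous_ppow.
  apply: eq_frac_int => r _; rewrite seriesSr; congr (_ + _).
  rewrite /mlterm -mulNr exprMn mulrAC; congr (_ * _).
  by rewrite /ppow [N%:R * a]mulrC powRrM powR_mulrn// powR_ge0.
rewrite frac_int_ppow ?mulr_ge0 ?(ltW a0)//.
have -> : mlterm a m t N.+1 = (- m) ^+ N.+1 * ppow a t ^+ N.+1 / Gamma (N.+1%:R * a + 1).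
  by rewrite /mlterm -mulNr exprMn.
have -> : ppow a t ^+ N.+1 = ppow (N.+1%:R * a) t.
  by rewrite /ppow [_%:R * a]mulrC powRrM powR_mulrn// powR_ge0.
have -> : N.+1%:R * a = a + N%:R * a by rewrite -natr1 mulrDl mul1r addrC.
have G1 : Gamma (N%:R * a + 1) != 0.
  by rewrite gt_eqF// Gamma_gt0// ltr_wpDl// mulr_ge0// ltW.
have G2 : Gamma (a + N%:R * a + 1) != 0.
  by rewrite gt_eqF// Gamma_gt0// ltr_wpDl// addr_ge0// ?mulr_ge0// ltW.
rewrite exprS; field.
by rewrite G1 G2.
Qed.

(** The partial sums converge uniformly up to time [t], so the limit may be taken inside [J^a] in
    [ml_partial_volterra]. *)
Lemma mlf_volterra a m t : 0 < a -> mlf a m t + m * frac_int a (mlf a m) t = 1.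
Proof.
move=> a0; apply/eqP; rewrite -subr_eq0 -normr_le0; apply/ler_addgt0Pr => e e0.
rewrite add0r.
have [C HC] := @ml_tail a m t a0.
pose D := `|C| + `|m| * (`|C| / Gamma (a + 1) * ppow a t).
have [N HN] := pow2_small D e0.
have h1 := HC t N.+1 (lexx _).
have h2 : `|frac_int a (mlf a m) t - frac_int a (fun s => series (mlterm a m s) N) t|
    <= `|C| * 2^-1 ^+ N / Gamma (a + 1) * ppow a t.
  apply: frac_int_dist => //; [exact: continuous_mlf|exact: continuous_ml_partial|].
  move=> r /andP[_ rt]; apply: (le_trans (HC r N (ltW rt))).
  by rewrite ler_wpM2r ?exprn_ge0 ?invr_ge0// ler_norm.
have -> : mlf a m t + m * frac_int a (mlf a m) t - 1 =
   (mlf a m t - series (mlterm a m t) N.+1) +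
   m * (frac_int a (mlf a m) t - frac_int a (fun s => series (mlterm a m s) N) t).
  by rewrite ml_partial_volterra//; ring.
apply: (le_trans (ler_normD _ _)); apply: le_trans (ltW HN).
rewrite /D mulrDl lerD//.
  apply: (le_trans h1); rewrite exprS mulrA ler_wpM2r ?exprn_ge0 ?invr_ge0//.
  apply: (@le_trans _ _ (`|C| * 2^-1)).
    by rewrite ler_wpM2r ?invr_ge0// ler_norm.
  by rewrite ler_piMr// invf_le1// ler1n.
rewrite normrM -[leRHS]mulrA; apply: ler_wpM2l => //; apply: (le_trans h2).
by rewrite le_eqVlt; apply/orP; left; apply/eqP; ring.
Qed.

Lemma mlf_le0 a m t : 0 < a -> t <= 0 -> mlf a m t = 1.
Proof.
by move=> a0 t0; have := mlf_volterra m t a0; rewrite frac_int_le0// mulr0 addr0.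
Qed.

(** Apply [J^(1-a)] to [e - 1 = - m J^a e] and use the semigroup law. This is the Caputo equation
    integrated once, so no differentiability of [e] enters. *)
Lemma mlf_caputo a m t : 0 < a < 1 ->
  frac_int (1 - a) (fun s => mlf a m s - 1) t = - m * frac_int 1 (mlf a m) t.
Proof.
move=> /andP[a0 a1]; have a1' : 0 < 1 - a by rewrite subr_gt0.
have cm := @continuous_mlf a m a0.
have -> : (fun s => mlf a m s - 1) = (fun s => - m * frac_int a (mlf a m) s).
  by apply/funext => s; rewrite -[in X in _ - X](mlf_volterra m s a0); ring.
rewrite frac_intZ//; last exact: continuous_frac_int.
by rewrite (frac_int_semigroup t a1' a0 cm) subrK.
Qed.

(** The share of [J^a y (t + h)] that comes from times in [(0, h)], that is, the memory of the
    equation restarted at time [h]. *)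
Let frac_past_def a y h t : R :=
  (Gamma a)^-1 * \int[mu]_(r in `]0, h[) ((t + h - r) `^ (a - 1) * y r).
Fact frac_past_key : unit. Proof. by []. Qed.
Definition frac_past := locked_with frac_past_key frac_past_def.

Lemma frac_pastE a y h t : frac_past a y h t =
  (Gamma a)^-1 * \int[mu]_(r in `]0, h[) ((t + h - r) `^ (a - 1) * y r).
Proof. by rewrite /frac_past unlock. Qed.

Lemma frac_past0 a y h : frac_past a y h 0 = frac_int a y h.
Proof. by rewrite frac_pastE frac_intE add0r. Qed.

Lemma frac_integrand_past a y h t : 0 < a -> continuous y -> 0 <= h -> 0 <= t ->
  mu.-integrable `]0, h[ (EFin \o (fun r => (t + h - r) `^ (a - 1) * y r)).
Proof.
move=> a0 cy h0 t0; apply: (@integrableS _ _ _ mu `]0, (t + h)[) => //.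
  by apply: subset_itvl; rewrite bnd_simp lerDr.
exact: frac_integrable.
Qed.

Lemma continuous_shift y h : continuous y -> continuous (fun r => y (r + h)).
Proof.
move=> cy r; apply: (@continuous_comp _ _ _ (fun r => r + h) y); last exact: cy.
by apply: cvgD; [exact: cvg_id|exact: cvg_cst].
Qed.

(** Cut the integral at [h] and translate the later piece back to the origin. It is the substitute
    for translation invariance, which the Volterra equation does not have. *)
Lemma frac_int_split a y h t : 0 < a -> continuous y -> 0 <= h -> 0 <= t ->
  frac_int a y (t + h) = frac_past a y h t +
  frac_int a (fun r => y (r + h)) t.
Proof.
move=> a0 + h0 t0; have [-> _|tn0] := eqVneq t 0.
  by rewrite add0r (frac_int_le0 _ _ (lexx 0)) addr0 frac_past0.
suff pos (z : R -> R) : continuous z -> (forall r, 0 <= z r) ->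
    frac_int a z (t + h) = frac_past a z h t +
    frac_int a (fun r => z (r + h)) t.
  move=> cy; have cN : continuous (fun r => - y r) by move=> r; apply: cvgN; exact: cy.
  have cp := continuous_pos_part cy; have cn := continuous_pos_part cN.
  have E1 := pos _ cp (pos_part_ge0 y); have E2 := pos _ cn (pos_part_ge0 _).
  have Ey := pos_partE y.
  transitivity (frac_int a (pos_part y) (t + h) - frac_int a (pos_part (fun r => - y r)) (t + h)).
    by rewrite -frac_intB// -Ey.
  rewrite E1 E2 !frac_pastE.
  have -> : frac_int a (fun r => y (r + h)) t = frac_int a (fun r => pos_part y (r + h)) t -
      frac_int a (fun r => pos_part (fun r => - y r) (r + h)) t.
    rewrite -frac_intB//; try exact: continuous_shift.
    by apply: eq_frac_int => r _; rewrite {1}Ey.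
  have -> : \int[mu]_(r in `]0, h[) ((t + h - r) `^ (a - 1) * y r) =
     \int[mu]_(r in `]0, h[) ((t + h - r) `^ (a - 1) * pos_part y r) -
     \int[mu]_(r in `]0, h[) ((t + h - r) `^ (a - 1) * pos_part (fun r => - y r) r).
    rewrite -RintegralB//; try exact: frac_integrand_past.
    by apply: eq_Rintegral => r _; rewrite -mulrBr {1}Ey.
  by ring.
move=> cz z0; apply: (mulfI (lt0r_neq0 (Gamma_gt0 a0))); apply: EFin_inj.
have cz' := @continuous_shift z h cz.
rewrite frac_pastE mulrDr EFinD (frac_int_ge0E t a0 cz')// frac_intE.
rewrite !mulrA divff ?gt_eqF ?Gamma_gt0// !mul1r fineK; last first.
  by apply: integrable_fin_num => //; exact: frac_integrable.
rewrite fineK; last first.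
  by apply: integrable_fin_num => //; exact: frac_integrand_past.
have mG (D : set R) : measurable_fun D (fun r : R => ((t + h - r) `^ (a - 1) * z r)%:E).
  by apply/measurable_EFinP; apply: measurable_funTS; exact: measurable_frac_integrand.
have [h00|h00] := eqVneq h 0.
  rewrite h00 [X in (X + _)%E](_ : _ = 0)%E; last by rewrite set_itv_ge ?bnd_simp// integral_set0.
  rewrite add0e addr0 integral_frac_integrandE//.
  by apply: eq_integral => r _; rewrite addr0.
have hpos : 0 < h by rewrite lt_neqAle eq_sym h00.
have th : h <= t + h by rewrite lerDr.
have -> : (`]0%R, (t + h)%R[ = `]0%R, h] `|` `]h, (t + h)%R[)%classic.
  apply: itv_bndbnd_setU; rewrite bnd_simp; first exact: ltW.
  by rewrite ltrDr lt_neqAle eq_sym tn0.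
rewrite ge0_integral_setU//=; last 3 first.
- exact: mG.
- by move=> r _; rewrite lee_fin mulr_ge0// powR_ge0.
- apply/disj_setPS => r [/=]; rewrite !in_itv/= => /andP[_ rh] /andP[hr _].
  by have := lt_le_trans hr rh; rewrite ltxx.
rewrite -(@integral_itv_bndo_bndc _ (BRight 0) h)//; congr (_ + _)%E.
rewrite integral_mkcond (@ge0_integral_affine _ 1 h ltr01); last 2 first.
- by apply/(measurable_restrictT _ _).1 => //.
- by move=> r; rewrite patchE; case: ifP => // _; rewrite lee_fin mulr_ge0// powR_ge0.
rewrite mul1e; apply: eq_integral => r _; rewrite mul1r patchE mem_setE in_itv/= ltrDr ltrD2r.
rewrite /kpow subr_gt0 subrr powRr0; case: (ltP 0 r) => r0 /=; last by rewrite mul0r mulr0.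
case: ifP => _; last by rewrite mul0r.
by rewrite mul1r; congr (_ `^ _ * _)%:E; ring.
Qed.

(** The kernel is decreasing and homogeneous of degree [a - 1]; this and the reversed form below
    compare its values at two times in terms of the ratio of the times. *)
Let kernel_ratio a (c x z : R) : 0 < a < 1 -> 0 < x -> 0 < z -> 0 <= c -> x <= c * z ->
  z `^ (a - 1) <= c `^ (1 - a) * x `^ (a - 1).
Proof.
move=> /andP[a0 a1] x0 z0 c0 xz.
rewrite -(opprB 1 a) !powRN ler_pdivlMr ?powR_gt0// mulrC ler_pdivrMr ?powR_gt0//.
rewrite -powRM ?(ltW z0)//; apply: ge0_ler_powR => //; first by rewrite subr_ge0 ltW.
- by rewrite nnegrE ltW.
- by rewrite nnegrE mulr_ge0// ltW.
Qed.

Let kernel_ratio' a (c x z : R) : 0 < a < 1 -> 0 < x -> 0 < z -> 0 <= c -> c * z <= x ->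
  c `^ (1 - a) * x `^ (a - 1) <= z `^ (a - 1).
Proof.
move=> /andP[a0 a1] x0 z0 c0 xz.
rewrite -(opprB 1 a) !powRN ler_pdivrMr ?powR_gt0// mulrC ler_pdivlMr ?powR_gt0//.
rewrite -powRM ?(ltW z0)//; apply: ge0_ler_powR => //; first by rewrite subr_ge0 ltW.
- by rewrite nnegrE mulr_ge0// ltW.
- by rewrite nnegrE ltW.
Qed.

(* At the first zero [s0] of [y], compare [J^a y(s0)] with [J^a y(t1)], where [t1]
   maximizes [y] on a short interval ending at [s0]: the kernel ratio on [(0, t1)] is the
   factor [(t1 / s0)^(1-a)] lost by [f], and the rest is too small to compensate [y(t1)]. *)
Lemma volterra_pos a m (T : R) y (f : R -> R) : 0 < a < 1 -> 0 <= m -> continuous y ->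
  (forall t, 0 <= t <= T -> y t + m * frac_int a y t = f t) ->
  0 < f 0 ->
  (forall t1 t2, 0 < t1 -> t1 < t2 -> t2 <= T ->
     (t1 / t2) `^ (1 - a) * f t1 <= f t2) ->
  forall t, 0 <= t <= T -> 0 < y t.
Proof.
move=> /andP[a0 a1] m0 cy yf f0 fr t /andP[t0 tT].
rewrite ltNge; apply/negP => yt.
pose Z : set R := [set s | 0 <= s <= T /\ y s <= 0].
have Zt : Z t by rewrite /Z/= t0 tT.
have Zlb : lbound Z 0 by move=> s [/andP[]].
have Zinf : has_inf Z by split; [exists t|exists 0].
pose s0 := inf Z.
have T0 : 0 <= T := le_trans t0 tT.
have y0 : 0 < y 0.
  by have := yf 0; rewrite lexx T0 => /(_ isT); rewrite frac_int_le0// mulr0 addr0 => ->.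
have s00 : 0 <= s0 by apply: lb_le_inf Zlb; exists t.
have s0T : s0 <= T by apply: le_trans tT; apply: ge_inf; [exists 0|].
have ys0 : y s0 <= 0.
  rewrite leNgt; apply/negP => ys0.
  have /cvgrPdist_lt /(_ _ ys0) [d /= d0 Hd] := cy s0.
  have [s Zs sd] := inf_adherent d0 Zinf.
  have s0s : s0 <= s by apply: ge_inf => //; exists 0.
  have := Hd s; rewrite /ball_/= => /(_ _)/[!ltr_norml] H.
  have /andP[_] : - y s0 < y s0 - y s < y s0.
    by apply: H; rewrite -ltr_norml distrC ger0_norm ?subr_ge0// ltrBlDl.
  by rewrite ltrBlDr ltrDl ltNge; case: Zs => _ ->.
have s0pos : 0 < s0.
  rewrite lt_neqAle eq_sym s00 andbT; apply: contraTneq y0 => e.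
  by rewrite e in ys0; rewrite -leNgt.
have ypos_lt s : 0 <= s < s0 -> 0 < y s.
  move=> /andP[sp ss0]; rewrite ltNge; apply/negP => ysn.
  have : s0 <= s.
    apply: ge_inf; first by exists 0.
    by rewrite /Z/= sp (le_trans (ltW ss0) s0T).
  by rewrite leNgt ss0.
have G0 : 0 < Gamma (a + 1) by apply: Gamma_gt0; rewrite ltr_wpDl ?ltW.
(* The bound [s0 / 2] keeps [t1] in the upper half of [(0, s0)], so that [rho >= 1/2]; the other
   bound makes [m d^a / Gamma (a + 1) <= 1/4]. The summand 1 in [m + 1] covers [m = 0]. *)
pose d := Num.min (s0 / 2) ((Gamma (a + 1) / (4 * (m + 1))) `^ a^-1).
have m41 : 0 < 4 * (m + 1) by rewrite mulr_gt0// ltr_wpDl.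
have d0 : 0 < d by rewrite lt_min divr_gt0//= powR_gt0// divr_gt0.
have ds0 : d <= s0 / 2 by rewrite ge_min lexx.
have da : m * (d `^ a / Gamma (a + 1)) <= 4^-1.
  have : d `^ a <= Gamma (a + 1) / (4 * (m + 1)).
    have -> : Gamma (a + 1) / (4 * (m + 1)) = ((Gamma (a + 1) / (4 * (m + 1))) `^ a^-1) `^ a.
      rewrite -powRrM mulVf ?gt_eqF// powRr1// divr_ge0// ltW//.
    apply: ge0_ler_powR; first exact: ltW.
    - by rewrite nnegrE ltW.
    - by rewrite nnegrE powR_ge0.
    - by rewrite ge_min lexx orbT.
  move=> h; apply: (@le_trans _ _ (m * ((Gamma (a + 1) / (4 * (m + 1))) / Gamma (a + 1)))).
    by rewrite ler_wpM2l// ler_wpM2r// invr_ge0 ltW.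
  have -> : m * (Gamma (a + 1) / (4 * (m + 1)) / Gamma (a + 1)) = m / (m + 1) * 4^-1.
    have G0' := lt0r_neq0 G0; have m10 : m + 1 != 0 by rewrite gt_eqF// ltr_wpDl.
    by field; rewrite ?G0' ?m10.
  by rewrite ler_piMl// ler_pdivrMr ?ltr_wpDl// mul1r lerDl.
have sd : s0 - d <= s0 by rewrite gerBl ltW.
have [t1 t1in t1max] := EVT_max sd (continuous_subspaceT cy).
move: t1in; rewrite in_itv/= => /andP[t1l t1r].
have sd0 : 0 < s0 - d by lra.
have yt1 : 0 < y t1.
  apply: (@lt_le_trans _ _ (y (s0 - d))).
    by apply: ypos_lt; rewrite ltW//= ltrBlDr ltrDl.
  by apply: t1max; rewrite in_itv/= lexx sd.
have t1s0 : t1 < s0.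
  by rewrite lt_neqAle t1r andbT; apply: contraTneq yt1 => ->; rewrite -leNgt.
have t10 : 0 < t1 := lt_le_trans sd0 t1l.
pose rho := (t1 / s0) `^ (1 - a).
have rho0 : 0 <= rho by exact: powR_ge0.
have rho_half : 2^-1 <= rho.
  apply: (@le_trans _ _ (t1 / s0)); first by rewrite ler_pdivlMr//; lra.
  apply: ger1_powR; last by rewrite gerBl ltW.
  by rewrite divr_gt0//= ler_pdivrMr// mul1r ltW.
have h0 : 0 <= s0 - t1 by rewrite subr_ge0 ltW.
have E1 : frac_int a y s0 <= rho * frac_int a y t1 + y t1 * ((s0 - t1) `^ a / Gamma (a + 1)).
  have -> : frac_int a y s0 = frac_int a y ((s0 - t1) + t1) by rewrite subrK.
  rewrite frac_int_split ?(ltW t10)//; apply: lerD.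
    rewrite frac_pastE frac_intE mulrCA ler_wpM2l ?invr_ge0 ?(ltW (Gamma_gt0 a0))//.
    rewrite -RintegralZl//; last exact: frac_integrable.
    apply: le_Rintegral => //.
    - by apply: frac_integrand_past => //; exact: ltW.
    - exact: (integrableZl _ rho (frac_integrable t1 a0 cy)).
    move=> r /=; rewrite in_itv/= => /andP[r0 rt1].
    rewrite mulrA ler_wpM2r//; first by apply/ltW/ypos_lt; rewrite (ltW r0) (lt_trans rt1).
    rewrite subrK; apply: kernel_ratio; rewrite ?a0 ?a1 ?subr_gt0//.
    - exact: lt_trans rt1 t1s0.
    - by rewrite divr_ge0// ltW.
    rewrite mulrBr divfK ?gt_eqF// lerD2l lerN2 ler_piMl ?(ltW r0)//.
    by rewrite ler_pdivrMr// mul1r ltW.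
  have -> : y t1 * ((s0 - t1) `^ a / Gamma (a + 1)) = frac_int a (cst (y t1)) (s0 - t1).
    by rewrite frac_int_cst// ppowE//; ring.
  apply: le_frac_int => //; [exact: continuous_shift|by move=> r; exact: cvg_cst|].
  move=> r /andP[r0 rs]; apply: t1max; rewrite in_itv/=; apply/andP; split; lra.
have F1 := yf s0; have F2 := yf t1.
have {}F1 : y s0 + m * frac_int a y s0 = f s0 by apply: F1; rewrite ltW.
have {}F2 : y t1 + m * frac_int a y t1 = f t1 by apply: F2; rewrite ltW//= (le_trans (ltW t1s0)).
have F3 : rho * f t1 <= f s0 by apply: fr.
have E2 : m * ((s0 - t1) `^ a / Gamma (a + 1)) <= 4^-1.
  apply: le_trans da; rewrite ler_wpM2l// ler_wpM2r ?invr_ge0 ?(ltW G0)//.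
  apply: ge0_ler_powR => //; rewrite ?nnegrE ?(ltW a0) ?(ltW d0)//.
  by rewrite lerBlDr -lerBlDl.
have E3 : m * frac_int a y s0 <= rho * (m * frac_int a y t1) + y t1 * 4^-1.
  apply: (le_trans (ler_wpM2l m0 E1)); rewrite mulrDr mulrCA lerD2l mulrCA.
  by rewrite ler_wpM2l// ltW.
have E4 : m * frac_int a y t1 = f t1 - y t1 by rewrite -F2; ring.
rewrite E4 in E3.
(* Combining the estimates, [y s0 >= (rho - 1/4) y t1 >= y t1 / 4 > 0], against the choice of
   [s0]. *)
have E5 : 2^-1 * y t1 <= rho * y t1 by rewrite ler_wpM2r// ltW.
rewrite mulrBr in E3; lra.
Qed.

(** Adding [c * mlf a m] adds the constant [c] to the source and makes it strictly positive at 0, so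
    the strict criterion applies; then [c] is sent to 0. *)
Lemma volterra_ge0 a m (T : R) y (f : R -> R) : 0 < a < 1 -> 0 <= m -> continuous y ->
  (forall t, 0 <= t <= T -> y t + m * frac_int a y t = f t) ->
  0 <= f 0 ->
  (forall t1 t2, 0 < t1 -> t1 < t2 -> t2 <= T ->
     (t1 / t2) `^ (1 - a) * f t1 <= f t2) ->
  forall t, 0 <= t <= T -> 0 <= y t.
Proof.
move=> a01 m0 cy yf f0 fr t tT; have /andP[a0 a1] := a01.
have cm := @continuous_mlf a m a0.
apply/ler_addgt0Pr => e e0.
pose c := e / (`|mlf a m t| + 1).
have c0 : 0 < c by rewrite divr_gt0// ltr_wpDl.
have ccm : continuous (fun s => c * mlf a m s) by move=> s; apply: cvgMr; exact: cm.
have : 0 < y t + c * mlf a m t.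
  apply: (@volterra_pos a m T (fun s => y s + c * mlf a m s) (fun s => f s + c)) => //.
  - by move=> s; apply: cvgD; [exact: cy|exact: ccm].
  - move=> s sT; rewrite frac_intD// frac_intZ// -(yf s sT).
    by rewrite -[X in _ = _ + X]mulr1 -(mlf_volterra m s a0); ring.
  - by rewrite ltr_wpDl.
  - move=> t1 t2 h1 h2 h3; rewrite mulrDr lerD ?fr// ler_piMl ?(ltW c0)//.
    have t20 := lt_trans h1 h2.
    rewrite -[leRHS](powRr0 (t1 / t2)); apply: ger_powR; last by rewrite subr_ge0 ltW.
    by rewrite divr_gt0//= ler_pdivrMr// mul1r ltW.
move=> /ltW h; apply: (le_trans h); rewrite lerD2l /c -mulrA ler_piMr ?(ltW e0)//.
rewrite mulrC ler_pdivrMr ?ltr_wpDl// mul1r.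
by rewrite (le_trans (ler_norm _))// lerDl.
Qed.

(** The weight [(t1 / t2)^(1-a)] is at most 1, so it only helps a nonnegative nondecreasing
    source. *)
Lemma volterra_ge0_nondecreasing a m (T : R) y (f : R -> R) :
  0 < a < 1 -> 0 <= m -> continuous y ->
  (forall t, 0 <= t <= T -> y t + m * frac_int a y t = f t) ->
  (forall t, 0 <= t <= T -> 0 <= f t) ->
  (forall t1 t2, 0 <= t1 -> t1 <= t2 -> t2 <= T -> f t1 <= f t2) ->
  forall t, 0 <= t <= T -> 0 <= y t.
Proof.
move=> a01 m0 cy yf f0 fnd t /andP[t0 tT]; have /andP[a0 a1] := a01.
apply: (volterra_ge0 a01 m0 cy yf); last by rewrite t0.
  by apply: f0; rewrite lexx (le_trans t0).
move=> t1 t2 h1 h2 h3; have t20 := lt_trans h1 h2.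
apply: (@le_trans _ _ (f t1)); last by apply: fnd => //; exact: ltW.
rewrite ler_piMl//; first by apply: f0; rewrite (ltW h1) (le_trans (ltW h2)).
rewrite -[leRHS](powRr0 (t1 / t2)); apply: ger_powR; last by rewrite subr_ge0 ltW.
by rewrite divr_gt0//= ler_pdivrMr// mul1r ltW.
Qed.

Lemma mlf_gt0 a m t : 0 < a < 1 -> 0 <= m -> 0 < mlf a m t.
Proof.
move=> a01 m0; have /andP[a0 a1] := a01.
have [t0|t0] := leP t 0; first by rewrite mlf_le0.
apply: (@volterra_pos a m t _ (cst 1) a01 m0); last by rewrite ltW/=.
- exact: continuous_mlf.
- by move=> s _; exact: mlf_volterra.
- by [].
move=> t1 t2 h1 h2 _; rewrite /= mulr1; have t20 := lt_trans h1 h2.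
rewrite -[leRHS](powRr0 (t1 / t2)); apply: ger_powR; last by rewrite subr_ge0 ltW.
by rewrite divr_gt0//= ler_pdivrMr// mul1r ltW.
Qed.

Lemma mlf_le1 a m t : 0 < a < 1 -> 0 <= m -> mlf a m t <= 1.
Proof.
move=> a01 m0; have /andP[a0 a1] := a01.
rewrite -(mlf_volterra m t a0) lerDl mulr_ge0// frac_int_ge0// => r _.
by rewrite ltW// mlf_gt0.
Qed.

(** The difference [e(r) - e(r + h)] solves the Volterra equation whose source is [m] times the
    memory term. Its kernel decays no faster than [r^(a-1)], which is exactly what the weighted
    criterion tolerates. *)
Lemma mlf_nonincreasing a m s t : 0 < a < 1 -> 0 <= m -> s <= t ->
  mlf a m t <= mlf a m s.
Proof.
move=> a01 m0; have /andP[a0 a1] := a01.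
have [s0 _|s0] := ltP s 0; first by rewrite (mlf_le0 _ _ (ltW s0))// mlf_le1.
move=> st; have [h [h0 ->]] : exists h, 0 <= h /\ t = s + h.
  by exists (t - s); rewrite subr_ge0 addrC subrK.
have cm := @continuous_mlf a m a0; have cmh := continuous_shift (h := h) cm.
rewrite -subr_ge0.
apply: (@volterra_ge0 a m s (fun r => mlf a m r - mlf a m (r + h))
  (fun r => m * frac_past a (mlf a m) h r) a01 m0); last by rewrite s0 lexx.
- by move=> r; apply: cvgB; [exact: cm|exact: cmh].
- move=> r /andP[r0 _]; rewrite frac_intB//.
  have := mlf_volterra m (r + h) a0; rewrite frac_int_split// -(mlf_volterra m r a0).
  move: (mlf a m r) (mlf a m (r + h)) (frac_past _ _ _ _) (frac_int _ _ _) (frac_int _ _ _).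
  move=> A B P J1 J2 E; transitivity (A + m * J1 - B - m * J2); first by ring.
  by rewrite -E; ring.
- by rewrite frac_past0 mulr_ge0// frac_int_ge0// => r _; rewrite ltW// mlf_gt0.
move=> t1 t2 h1 h2 h3; have t20 := lt_trans h1 h2.
rewrite mulrCA ler_wpM2l// !frac_pastE mulrCA ler_wpM2l ?invr_ge0 ?(ltW (Gamma_gt0 a0))//.
have i1 := frac_integrand_past a0 cm h0 (ltW h1).
rewrite -RintegralZl//; apply: le_Rintegral => //.
- exact: (integrableZl _ ((t1 / t2) `^ (1 - a)) i1).
- by apply: frac_integrand_past => //; exact: ltW.
move=> r /=; rewrite in_itv/= => /andP[r0 rh]; rewrite mulrA ler_wpM2r//.
  by rewrite ltW// mlf_gt0.
have c0 : 0 <= t1 / t2 by rewrite divr_ge0// ltW.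
apply: kernel_ratio' => //.
- by rewrite -addrA ltr_pwDl// subr_ge0 ltW.
- by rewrite -addrA ltr_pwDl// subr_ge0 ltW.
rewrite -!addrA mulrDr divfK ?gt_eqF// lerD2l ler_piMl ?subr_ge0 ?(ltW rh)//.
by rewrite ler_pdivrMr// mul1r ltW.
Qed.

(** Read off from [J^1] of the constant 1 at time 1, computed once by the power rule and once as a
    plain integral. *)
Lemma Gamma2 : Gamma 2 = 1 :> R.
Proof.
have := @frac_int_cst R 1 1 1 ltr01.
rewrite ppowE// powR1 mulr1 div1r -frac_past0 frac_pastE Gamma1 invr1 mul1r subrr.
under eq_Rintegral do rewrite powRr0 mulr1.
rewrite Rintegral_cst//= lebesgue_measure_itv/= lte_fin ltr01 oppr0 addr0/= mulr1.
by move=> /(congr1 GRing.inv); rewrite invr1 invrK.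
Qed.

(** By monotonicity [e] is at least [e(t)] on [(0, t)], so [m e(t) t^a / Gamma (a + 1) <= m J^a e
    (t) <= 1]. *)
Lemma mlf_decay a m t : 0 < a < 1 -> 0 <= m -> 0 <= t ->
  m * t `^ a * mlf a m t <= 2.
Proof.
move=> a01 m0 t0; have /andP[a0 a1] := a01.
have cm := @continuous_mlf a m a0.
have a10 : 0 < a + 1 by rewrite ltr_wpDl// ltW.
(* From [s^a <= 1 + s] integrated against [exp (- s)]; this is the origin of the constant 2 in the
   decay. *)
have G2 : Gamma (a + 1) <= 2.
  have -> : 2 = 0 * Gamma 1 + 1 * (Gamma 1 + Gamma 2) :> R.
    by rewrite Gamma1 Gamma2; ring.
  apply: Gamma_le_combination => // s s0.
  rewrite addrK mul0r add0r mul1r subrr powRr0 (_ : 2 - 1 = 1); last by ring.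
  rewrite powRr1 ?(ltW s0)//.
  have [s1|s1] := leP s 1.
    apply: (@le_trans _ _ 1); last by rewrite lerDl ltW.
    by rewrite -[leRHS](powRr0 s); apply: ger_powR; rewrite ?s0 ?(ltW a0).
  apply: (@le_trans _ _ s); last by rewrite lerDr.
  by rewrite -[leRHS](powRr1 (ltW s0)); apply: ler_powR; exact: ltW.
have : m * frac_int a (cst (mlf a m t)) t <= 1.
  rewrite -(mlf_volterra m t a0) ler_wpDl//; first by rewrite ltW// mlf_gt0.
  rewrite ler_wpM2l//; apply: le_frac_int => //; first by move=> r; exact: cvg_cst.
  by move=> r /andP[_ rt]; apply: mlf_nonincreasing => //; exact: ltW.
have Gp := Gamma_gt0 a10.
rewrite frac_int_cst// ppowE// mulrA mulrAC mulrA ler_pdivrMr// mul1r => h.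
by apply: le_trans G2; apply: le_trans h; rewrite mulrAC.
Qed.

(** Changing [m] rescales time, so monotonicity in [t] gives monotonicity in [m]. Then
    [J^a e2 <= J^a e1] bounds the difference [m2 J^a e2 - m1 J^a e1] by [(m2 - m1) J^a e2], and
    [m2 J^a e2 <= 1]. The relative form of the bound later turns a change of exponent into a mere
    logarithm. *)
Lemma mlf_lipschitz_rate a m1 m2 t : 0 < a < 1 -> 0 < m1 -> m1 <= m2 -> 0 <= t ->
  0 <= mlf a m1 t - mlf a m2 t <= (m2 - m1) / m2.
Proof.
move=> a01 m10 m12; have /andP[a0 a1] := a01.
have m20 := lt_le_trans m10 m12.
have cm m := @continuous_mlf a m a0.
have nonneg s : 0 <= s -> mlf a m2 s <= mlf a m1 s.
  move=> s0; pose c := (m2 / m1) `^ a^-1.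
  have c1 : 1 <= c.
    rewrite -[leLHS](powRr0 (m2 / m1)); apply: ler_powR; last by rewrite invr_ge0 ltW.
    by rewrite ler_pdivlMr// mul1r.
  have -> : mlf a m2 s = mlf a m1 (c * s).
    rewrite !mlfE; congr (mittag_leffler _ (- _)).
    rewrite !ppowE ?mulr_ge0 ?(le_trans ler01 c1)// powRM// ?(le_trans ler01 c1)//.
    rewrite /c -powRrM mulVf ?gt_eqF// powRr1 ?divr_ge0 ?(ltW m10) ?(ltW m20)// mulrA.
    by rewrite [m1 * _]mulrC divfK// gt_eqF.
  by apply: mlf_nonincreasing => //; [exact: ltW|rewrite ler_peMl].
move=> t0; rewrite subr_ge0 nonneg//=.
have J21 : frac_int a (mlf a m2) t <= frac_int a (mlf a m1) t.
  by apply: le_frac_int => // r /andP[r0 _]; apply: nonneg; exact: ltW.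
have J2 : m2 * frac_int a (mlf a m2) t <= 1.
  by rewrite -(mlf_volterra m2 t a0) lerDr ltW// mlf_gt0// ltW.
have E1 := mlf_volterra m1 t a0; have E2 := mlf_volterra m2 t a0.
have -> : mlf a m1 t - mlf a m2 t = m2 * frac_int a (mlf a m2) t - m1 * frac_int a (mlf a m1) t.
  have -> : mlf a m1 t = 1 - m1 * frac_int a (mlf a m1) t by rewrite -E1 addrK.
  have -> : mlf a m2 t = 1 - m2 * frac_int a (mlf a m2) t by rewrite -E2 addrK.
  by ring.
rewrite ler_pdivlMr//.
apply: (@le_trans _ _ ((m2 - m1) * (m2 * frac_int a (mlf a m2) t))); last first.
  by rewrite ler_piMr// subr_ge0.
rewrite [leRHS]mulrCA [leLHS]mulrC ler_wpM2l ?(ltW m20)// mulrBl lerD2l lerN2.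
by rewrite ler_wpM2l// ltW.
Qed.

(** For every [N] the function [e + N y] has source 1 and is therefore positive; if [y t] were
    nonzero, a suitable [N] would make it vanish at [t]. *)
Lemma volterra_eq0 a m (T : R) y : 0 < a < 1 -> 0 <= m -> continuous y ->
  (forall t, 0 <= t <= T -> y t + m * frac_int a y t = 0) ->
  forall t, 0 <= t <= T -> y t = 0.
Proof.
move=> a01 m0 cy yE t tT; have /andP[a0 a1] := a01.
have cm := @continuous_mlf a m a0.
apply/eqP; apply/negPn/negP => yt0.
pose N := - mlf a m t / y t.
have : 0 < mlf a m t + N * y t.
  apply: (@volterra_pos a m T (fun s => mlf a m s + N * y s) (cst 1)) => //.
  - by move=> s; apply: cvgD; [exact: cm|apply: cvgMr; exact: cy].
  - move=> s sT; have cNy : continuous (fun s => N * y s) by move=> r; apply: cvgMr; exact: cy.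
    rewrite frac_intD// frac_intZ// -[X in _ = X](mlf_volterra m s a0).
    transitivity (mlf a m s + m * frac_int a (mlf a m) s + N * (y s + m * frac_int a y s)).
      by ring.
    by rewrite yE// mulr0 addr0.
  - move=> t1 t2 h1 h2 _; rewrite /= mulr1; have t20 := lt_trans h1 h2.
    rewrite -[leRHS](powRr0 (t1 / t2)); apply: ger_powR; last by rewrite subr_ge0 ltW.
    by rewrite divr_gt0//= ler_pdivrMr// mul1r ltW.
by rewrite /N divfK// subrr ltxx.
Qed.

(** The kernel of order 1 is constant, so the memory term is just [J^1 y t] and cancels. This
    quantitative form of the fundamental theorem serves one-sided increments as well, as needed at
    the ends of [[0, T]]. *)
Lemma frac_int1_increment y t s (v c : R) : continuous y -> 0 <= t -> t < s ->
  (forall r, t <= r <= s -> `|y r - v| <= c) ->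
  `|frac_int 1 y s - frac_int 1 y t - (s - t) * v| <= c * (s - t).
Proof.
move=> cy t0 ts yv; have st0 : 0 <= s - t by rewrite subr_ge0 ltW.
have {1}-> : s = (s - t) + t by rewrite subrK.
have cy' := continuous_shift (h := t) cy.
have cv : continuous (cst v : R -> R) by move=> r; exact: cvg_cst.
rewrite frac_int_split//.
have -> : frac_past 1 y t (s - t) = frac_int 1 y t.
  rewrite -frac_past0 !frac_pastE; congr (_ * _).
  by apply: eq_Rintegral => r _; rewrite subrr !powRr0.
rewrite [frac_int 1 y t + _]addrC addrK.
have -> : (s - t) * v = frac_int 1 (cst v) (s - t).
  rewrite frac_int_cst// ppowE// powRr1// (_ : 1 + 1 = 2)//.
  by rewrite Gamma2 divr1 mulrC.
have := @frac_int_dist 1 (fun r => y (r + t)) (cst v) c (s - t) ltr01 cy' cv.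
rewrite ppowE// powRr1// (_ : 1 + 1 = 2)//.
rewrite Gamma2 divr1; apply => r /andP[r0 rs]; apply: yv.
by rewrite lerDr (ltW r0)/= -lerBrDr ltW.
Qed.

(* [J^1 y] solves the homogeneous Volterra equation; [y] is its derivative. *)
Lemma caputo_unique a m (T : R) y : 0 < a < 1 -> 0 <= m -> 0 < T -> continuous y ->
  (forall t, 0 <= t <= T -> frac_int (1 - a) y t = - m * frac_int 1 y t) ->
  forall t, 0 <= t <= T -> y t = 0.
Proof.
move=> a01 m0 T0 cy yE; have /andP[a0 a1] := a01.
have a1' : 0 < 1 - a by rewrite subr_gt0.
have cJ : continuous (frac_int 1 y) by exact: continuous_frac_int.
have J0 : forall t, 0 <= t <= T -> frac_int 1 y t = 0.
  apply: (volterra_eq0 a01 m0 cJ) => t /andP[t0 tT].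
  have <- : frac_int a (frac_int (1 - a) y) t = frac_int 1 y t.
    by rewrite (frac_int_semigroup t a0 a1' cy) addrC subrK.
  have -> : frac_int a (frac_int (1 - a) y) t = frac_int a (fun s => - m * frac_int 1 y s) t.
    by apply: eq_frac_int => r /andP[r0 rt]; apply: yE; rewrite (ltW r0) (le_trans (ltW rt)).
  by rewrite (frac_intZ (- m) t a0 cJ) mulNr addNr.
move=> t /andP[t0 tT]; apply/eqP; rewrite -normr_le0; apply/ler_addgt0Pr => e e0.
rewrite add0r.
have /cvgrPdist_lt /(_ _ e0) [d /= d0 Hd] := cy t.
(* The increment is taken to the right of [t], and to the left only at [t = T], where the vanishing
   of [J^1 y] is known on one side. *)
have [tlt|tge] := ltP t T.
  pose s := Num.min T (t + d / 2).
  have ts : t < s by rewrite lt_min tlt ltrDl divr_gt0.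
  have sT : s <= T by rewrite ge_min lexx.
  have sd : s <= t + d / 2 by rewrite ge_min lexx orbT.
  have := @frac_int1_increment y t s (y t) e cy t0 ts.
  rewrite !J0 ?t0 ?(le_trans t0 (ltW ts))// subrr sub0r normrN normrM.
  rewrite gtr0_norm ?subr_gt0// mulrC ler_pM2r ?subr_gt0//; apply => r /andP[tr rs].
  rewrite distrC; apply/ltW/Hd; rewrite /ball_/= distrC ger0_norm ?subr_ge0//.
  by have : r <= t + d / 2 := le_trans rs sd; lra.
have tT' : t = T by apply/eqP; rewrite eq_le tT tge.
pose s := Num.max 0 (t - d / 2).
have st : s < t by rewrite gt_max tT' T0/= ltrBlDr ltrDl divr_gt0.
have s0 : 0 <= s by rewrite le_max lexx.
have sd : t - d / 2 <= s by rewrite le_max lexx orbT.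
have := @frac_int1_increment y s t (y t) e cy s0 st.
rewrite !J0 ?s0 ?t0 ?(le_trans (ltW st) tT)// subrr sub0r normrN normrM.
rewrite gtr0_norm ?subr_gt0// mulrC ler_pM2r ?subr_gt0//; apply => r /andP[sr rt].
rewrite distrC; apply/ltW/Hd; rewrite /ball_/= ger0_norm ?subr_ge0//.
by have : t - d / 2 <= r := le_trans sd sr; lra.
Qed.

End MittagLefflerFunction.

(** * Lipschitz dependence of the Mittag-Leffler function on its order *)

Section OrderPerturbation.
Context {R : realType}.
Local Notation mu := (@lebesgue_measure R).
Implicit Types (a b h m s t x : R) (y : R -> R).
Local Opaque Gamma.

Lemma expR_dist (u v : R) : `|expR u - expR v| <= `|u - v| * Num.max (expR u) (expR v).
Proof.
wlog vu : u v / v <= u.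
  move=> W; have [/W//|/ltW/W] := leP v u.
  by rewrite distrC (distrC v) maxC.
rewrite max_l ?ler_expR// !ger0_norm ?subr_ge0 ?ler_expR//.
have -> : expR v = expR u * expR (v - u) by rewrite -expRD addrC subrK.
rewrite -{1}(mulr1 (expR u)) -mulrBr mulrC ler_wpM2r ?expR_ge0//.
by have := expR_ge1Dx (v - u); lra.
Qed.

Lemma norm_ln_le (c s : R) : 0 < c -> 0 < s <= 1 -> `|ln s| <= c^-1 * s `^ (- c).
Proof.
move=> c0 /andP[s0 s1]; rewrite ler0_norm ?ln_le0// mulrC ler_pdivlMr//.
rewrite (mulNr (ln s)) (mulrC (ln s)) -(mulNr c).
by have := ln_sublinear (powR_gt0 (- c) s0); rewrite ln_powR => /ltW.
Qed.

(** The change of exponent costs a factor [ln s]. Near 0 it is absorbed by giving up half of the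
    exponent [al0]; for [s >= 1] it is at most [s]. Writing the latter as [s^(2-1)] makes both
    weights Gamma integrands. *)
Lemma powR_exponent_dist (al0 a a' s : R) : 0 < al0 -> al0 <= a <= 1 -> al0 <= a' <= 1 -> 0 < s ->
  `|s `^ (a' - 1) - s `^ (a - 1)| <=
  ((al0 / 2)^-1 + 1) * `|a' - a| * (s `^ (al0 / 2 - 1) + s `^ (2 - 1)).
Proof.
move=> al00 /andP[a_l a_r] /andP[a'_l a'_r] s0.
have b0 : 0 < al0 / 2 by rewrite divr_gt0.
have E x : s `^ x = expR (x * ln s) by rewrite /powR gt_eqF.
have D : `|s `^ (a' - 1) - s `^ (a - 1)| <=
    `|a' - a| * (`|ln s| * Num.max (s `^ (a' - 1)) (s `^ (a - 1))).
  rewrite !E mulrA -normrM; apply: le_trans (expR_dist _ _) _.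
  by rewrite -mulrBl (_ : a' - 1 - (a - 1) = a' - a)//; ring.
apply: (le_trans D); rewrite mulrAC mulrC ler_wpM2r//.
have p0 x : 0 <= s `^ x := powR_ge0 _ _.
have i0 : 0 <= (al0 / 2)^-1 by rewrite invr_ge0 ltW.
have [s1|s1] := leP s 1.
  apply: (@le_trans _ _ ((al0 / 2)^-1 * s `^ (al0 / 2 - 1))); last first.
    by rewrite ler_pM ?lerDl.
  apply: (@le_trans _ _ ((al0 / 2)^-1 * s `^ (- (al0 / 2)) * s `^ (al0 - 1))).
    apply: ler_pM => //; first by rewrite le_max p0.
      by apply: norm_ln_le; rewrite ?s0.
    by rewrite ge_max; apply/andP; split; apply: ger_powR; rewrite ?s0// lerD2r.
  rewrite -mulrA -powRD; last by rewrite (gt_eqF s0) implybT.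
  by rewrite (_ : - (al0 / 2) + (al0 - 1) = al0 / 2 - 1)//; field.
apply: (@le_trans _ _ (1 * s `^ (2 - 1))); last by rewrite ler_pM ?lerDr.
rewrite mul1r (_ : 2 - 1 = 1); last by ring.
rewrite powRr1 ?(ltW s0)//.
apply: (@le_trans _ _ (s * 1)); last by rewrite mulr1.
apply: ler_pM => //; first by rewrite le_max p0.
  by rewrite ger0_norm ?ln_ge0 ?(ltW s1)// ltW// ln_sublinear.
rewrite ge_max; apply/andP; split; rewrite -[leRHS](powRr0 s);
  by apply: ler_powR; rewrite ?(ltW s1)// subr_le0.
Qed.

(** The two weights of [powR_exponent_dist] integrate to [Gamma (al0 / 2)] and [Gamma 2 = 1];
    exchanging [a] and [a'] gives the other sign. *)
Lemma Gamma_dist (al0 a a' : R) : 0 < al0 -> al0 <= a <= 1 -> al0 <= a' <= 1 ->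
  `|Gamma a' - Gamma a| <= ((al0 / 2)^-1 + 1) * `|a' - a| * (Gamma (al0 / 2) + 1).
Proof.
move=> al00 aI a'I.
have b0 : 0 < al0 / 2 by rewrite divr_gt0.
have c0 x : 0 <= ((al0 / 2)^-1 + 1) * `|x| by rewrite mulr_ge0 ?addr_ge0// invr_ge0 ltW.
have pos x : al0 <= x <= 1 -> 0 < x by move=> /andP[xl _]; exact: lt_le_trans al00 xl.
have half x x' : al0 <= x <= 1 -> al0 <= x' <= 1 ->
    Gamma x' <= Gamma x + ((al0 / 2)^-1 + 1) * `|x' - x| * (Gamma (al0 / 2) + 1).
  move=> xI x'I; rewrite -[Gamma x]mul1r.
  have -> : Gamma (al0 / 2) + 1 = Gamma (al0 / 2) + Gamma 2 by rewrite Gamma2.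
  apply: Gamma_le_combination => //; try exact: pos.
  move=> s s0; rewrite mul1r -lerBlDl.
  by apply: le_trans (ler_norm _) _; exact: powR_exponent_dist.
rewrite ler_norml lerBlDl half// andbT.
rewrite lerNl opprB lerBlDl distrC; exact: half.
Qed.

(** On a bounded time interval every power above [al0 / 2 - 1] is dominated by that one, so a single
    kernel of order [al0 / 2] controls the difference for all admissible orders. *)
Lemma frac_kernel_dist (al0 T : R) : 0 < al0 -> exists2 C : R, 0 <= C &
  forall a a' s, al0 <= a <= 1 -> al0 <= a' <= 1 -> 0 < s <= T ->
  `|s `^ (a' - 1) / Gamma a' - s `^ (a - 1) / Gamma a| <=
  C * `|a' - a| * s `^ (al0 / 2 - 1).
Proof.
move=> al00; have b0 : 0 < al0 / 2 by rewrite divr_gt0.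
pose g : R := 2^-1 * expR (- (1 + 1)).
have g0 : 0 < g by rewrite mulr_gt0 ?expR_gt0.
pose c : R := (al0 / 2)^-1 + 1.
have c0 : 0 <= c by rewrite addr_ge0// invr_ge0 ltW.
pose L : R := `|T| + 1.
have L1 : 1 <= L by rewrite lerDr.
pose G1 : R := Gamma (al0 / 2) + 1.
have G10 : 0 <= G1 by rewrite addr_ge0// ltW// Gamma_gt0.
exists (c * (1 + L ^+ 2) * g^-1 + L * (c * G1) * (g^-1 * g^-1)).
  by rewrite addr_ge0// !mulr_ge0// ?addr_ge0 ?exprn_ge0 ?invr_ge0 ?(ltW g0) ?(le_trans ler01 L1).
move=> a a' s aI a'I /andP[s0 sT].
have pos x : al0 <= x <= 1 -> 0 < x by move=> /andP[xl _]; exact: lt_le_trans al00 xl.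
have Ga := Gamma_gt0 (pos _ aI); have Ga' := Gamma_gt0 (pos _ a'I).
have ga : (Gamma a)^-1 <= g^-1 by rewrite lef_pV2 ?posrE// Gamma_ge// pos.
have ga' : (Gamma a')^-1 <= g^-1 by rewrite lef_pV2 ?posrE// Gamma_ge// pos.
have sL : s <= L by rewrite (le_trans sT)// (le_trans (ler_norm _))// lerDl.
have p0 x : 0 <= s `^ x := powR_ge0 _ _.
have pb x : 0 <= x -> s `^ (al0 / 2 - 1 + x) <= L `^ x * s `^ (al0 / 2 - 1).
  move=> x0; rewrite powRD ?(gt_eqF s0) ?implybT// mulrC ler_wpM2r//.
  by apply: ge0_ler_powR => //; rewrite nnegrE ?(ltW s0)// (le_trans ler01 L1).
have A : `|s `^ (a' - 1) - s `^ (a - 1)| <= c * (1 + L ^+ 2) * `|a' - a| * s `^ (al0 / 2 - 1).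
  apply: (le_trans (powR_exponent_dist al00 aI a'I s0)).
  rewrite -/c [c * _ * `|_|]mulrAC -!mulrA; do 2 apply: ler_wpM2l => //.
  rewrite mulrDl mul1r lerD2l.
  have := pb (2 - al0 / 2); rewrite (_ : al0 / 2 - 1 + (2 - al0 / 2) = 2 - 1); last by ring.
  have al1 : al0 <= 1 by case/andP: aI => /le_trans h /h.
  move=> /(_ _); move=> H; apply: (le_trans (H _)); first by lra.
  rewrite ler_wpM2r// -powR_mulrn ?(le_trans ler01 L1)//; apply: ler_powR => //.
  by rewrite gerBl ltW.
have B : s `^ (a - 1) <= L * s `^ (al0 / 2 - 1).
  have := pb (a - al0 / 2); rewrite (_ : al0 / 2 - 1 + (a - al0 / 2) = a - 1); last by ring.
  have /andP[al a1] := aI.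
  move=> H; apply: (le_trans (H _)); first by lra.
  rewrite ler_wpM2r// -[leRHS](powRr1 (le_trans ler01 L1)); apply: ler_powR => //; lra.
(* The change of the power is separated from the change of the normalisation. *)
have -> : s `^ (a' - 1) / Gamma a' - s `^ (a - 1) / Gamma a =
  (s `^ (a' - 1) - s `^ (a - 1)) / Gamma a' -
  s `^ (a - 1) * (Gamma a' - Gamma a) * ((Gamma a')^-1 * (Gamma a)^-1).
  by field; rewrite !gt_eqF.
apply: (le_trans (ler_normB _ _)); rewrite [in leRHS]mulrDl [in leRHS]mulrDl; apply: lerD.
  rewrite normrM [`|_^-1|]gtr0_norm ?invr_gt0//.
  rewrite (_ : _ * _ = c * (1 + L ^+ 2) * `|a' - a| * s `^ (al0 / 2 - 1) * g^-1); last by ring.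
  by apply: ler_pM => //; rewrite invr_ge0 ltW.
rewrite !normrM (ger0_norm (p0 _)) [`|_^-1|]gtr0_norm ?invr_gt0//.
rewrite [`|_^-1|]gtr0_norm ?invr_gt0//.
rewrite (_ : L * _ * _ * _ * _ = L * s `^ (al0 / 2 - 1) * (c * `|a' - a| * G1) * (g^-1 * g^-1)); last by ring.
apply: ler_pM; rewrite ?mulr_ge0 ?invr_ge0 ?(ltW Ga) ?(ltW Ga')//.
  by apply: ler_pM => //; exact: Gamma_dist.
by apply: ler_pM => //; rewrite invr_ge0 ltW.
Qed.

(** Stated for the memory term because taking [t = 0] recovers the full fractional integral up to
    [h]. *)
Lemma frac_past_dist (al0 T : R) : 0 < al0 -> exists2 C : R, 0 <= C &
  forall a a' y h t, al0 <= a <= 1 -> al0 <= a' <= 1 -> continuous y ->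
  0 <= h -> 0 <= t -> t + h <= T -> (forall r : R, 0 < r < h -> 0 <= y r) ->
  `|frac_past a' y h t - frac_past a y h t| <=
  C * `|a' - a| * frac_past (al0 / 2) y h t.
Proof.
move=> al00; have b0 : 0 < al0 / 2 by rewrite divr_gt0.
have [C C0 HC] := frac_kernel_dist T al00.
have Gb := Gamma_gt0 b0.
exists (C * Gamma (al0 / 2)); first by rewrite mulr_ge0// ltW.
move=> a a' y h t aI a'I cy h0 t0 thT y0.
have pos x : al0 <= x <= 1 -> 0 < x by move=> /andP[xl _]; exact: lt_le_trans al00 xl.
have ia := frac_integrand_past (pos _ aI) cy h0 t0.
have ia' := frac_integrand_past (pos _ a'I) cy h0 t0.
have ib := frac_integrand_past b0 cy h0 t0.
have -> : C * Gamma (al0 / 2) * `|a' - a| * frac_past (al0 / 2) y h t =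
    \int[mu]_(r in `]0, h[) ((C * `|a' - a|) * ((t + h - r) `^ (al0 / 2 - 1) * y r)).
  rewrite frac_pastE RintegralZl//.
  move: (Rintegral _ _ _) => I; field.
  by rewrite gt_eqF.
rewrite !frac_pastE -!RintegralZl// -RintegralB//; last 2 first.
- exact: (integrableZl _ (Gamma a')^-1 ia').
- exact: (integrableZl _ (Gamma a)^-1 ia).
have iD : mu.-integrable `]0, h[ (EFin \o (fun r =>
    (Gamma a')^-1 * ((t + h - r) `^ (a' - 1) * y r) -
    (Gamma a)^-1 * ((t + h - r) `^ (a - 1) * y r))).
  apply: (integrableB _ (integrableZl _ (Gamma a')^-1 ia') (integrableZl _ (Gamma a)^-1 ia)) => //.
apply: (le_trans (le_normr_Rintegral _ iD)) => //.
apply: le_Rintegral => //.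
- exact: integrable_norm.
- exact: (integrableZl _ (C * `|a' - a|) ib).
move=> r /=; rewrite in_itv/= => /andP[r0 rh].
have yr : 0 <= y r by apply: y0; rewrite r0.
rewrite !mulrA -mulrBl normrM (ger0_norm yr) ler_wpM2r//.
rewrite ![(Gamma _)^-1 * _]mulrC; apply: HC => //.
apply/andP; split; first by rewrite -addrA ltr_wpDl// subr_gt0.
by apply: le_trans thT; rewrite gerBl ltW.
Qed.

(** Comparison requires a source that is nonnegative and also nondecreasing. The increment of [F]
    over a time [d] splits into a memory term and the fractional integral of [y (r + d) - y r], and
    the kernel estimate applies to each since both inputs are nonnegative. The factor [sg] treats
    the two signs at once. *)
Lemma frac_int_dist_order (al0 T : R) : 0 < al0 -> exists2 C : R, 0 <= C &
  forall a a' y (sg : R) t1 t2, al0 <= a <= 1 -> al0 <= a' <= 1 -> continuous y -> `|sg| = 1 ->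
  0 <= t1 -> t1 <= t2 -> t2 <= T -> (forall r : R, 0 <= r -> 0 <= y r) ->
  (forall r s : R, 0 <= r -> r <= s -> y r <= y s) ->
  let F t := C * `|a' - a| * frac_int (al0 / 2) y t + sg * (frac_int a' y t - frac_int a y t) in
  0 <= F t1 /\ F t1 <= F t2.
Proof.
move=> al00; have b0 : 0 < al0 / 2 by rewrite divr_gt0.
have [C C0 HC] := frac_past_dist T al00.
exists C => // a a' y sg t1 t2 aI a'I cy sg1 t10 t12 t2T y0 ynd F.
have pos x : al0 <= x <= 1 -> 0 < x by move=> /andP[xl _]; exact: lt_le_trans al00 xl.
have signed (x z : R) : `|x| <= z -> 0 <= z + sg * x.
  move=> xz; rewrite -lerBlDr sub0r; apply: le_trans xz.
  by rewrite -[leRHS]mul1r -sg1 -normrM -normrN ler_norm.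
have Fpos (z : R -> R) t : continuous z -> 0 <= t <= T -> (forall r, 0 < r < t -> 0 <= z r) ->
    0 <= C * `|a' - a| * frac_int (al0 / 2) z t + sg * (frac_int a' z t - frac_int a z t).
  move=> cz /andP[tp tT] z0; apply: signed; rewrite -!frac_past0; apply: HC => //.
  by rewrite add0r.
split.
  by apply: Fpos => //; [rewrite t10 (le_trans t12)|move=> r /andP[r0 _]; rewrite y0// ltW].
have [d [d0 t2E]] : exists d, 0 <= d /\ t2 = t1 + d.
  by exists (t2 - t1); rewrite subr_ge0 addrC subrK.
have cyd := continuous_shift (h := d) cy.
have cD : continuous (fun r => y (r + d) - y r).
  by move=> r; apply: cvgB; [exact: cyd|exact: cy].
have H1 : 0 <= C * `|a' - a| * frac_past (al0 / 2) y d t1 +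
    sg * (frac_past a' y d t1 - frac_past a y d t1).
  apply: signed; apply: HC => //; first by rewrite -t2E.
  by move=> r /andP[r0 _]; rewrite y0// ltW.
have H2 := Fpos (fun r => y (r + d) - y r) t1 cD.
have {}H2 : 0 <= C * `|a' - a| * frac_int (al0 / 2) (fun r => y (r + d) - y r) t1 +
  sg * (frac_int a' (fun r => y (r + d) - y r) t1 - frac_int a (fun r => y (r + d) - y r) t1).
  apply: H2; first by rewrite t10 (le_trans t12).
  by move=> r /andP[r0 _]; rewrite subr_ge0 ynd ?(ltW r0)// lerDl.
have pa := pos _ aI; have pa' := pos _ a'I.
move: H2; rewrite !frac_intB// => H2.
rewrite /F t2E !frac_int_split// -subr_ge0.
apply: le_trans (addr_ge0 H1 H2) _.
rewrite le_eqVlt; apply/orP; left; apply/eqP; ring.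
Qed.

Lemma frac_int_nondecreasing a y t1 t2 : 0 < a -> continuous y -> 0 <= t1 -> t1 <= t2 ->
  (forall r, 0 <= r -> 0 <= y r) -> (forall r s, 0 <= r -> r <= s -> y r <= y s) ->
  frac_int a y t1 <= frac_int a y t2.
Proof.
move=> a0 cy t10 t12 y0 ynd.
have [d [d0 ->]] : exists d, 0 <= d /\ t2 = t1 + d.
  by exists (t2 - t1); rewrite subr_ge0 addrC subrK.
rewrite frac_int_split// ler_wpDl//.
  rewrite frac_pastE mulr_ge0 ?invr_ge0 ?(ltW (Gamma_gt0 a0))//.
  apply: Rintegral_ge0 => r/=; rewrite in_itv/= => /andP[r0 _].
  by rewrite mulr_ge0 ?powR_ge0// y0// ltW.
apply: le_frac_int => //; first exact: continuous_shift.
by move=> r /andP[r0 _]; rewrite ynd ?(ltW r0)// lerDl.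
Qed.

(** With [w = mlf a' m], the difference [z] satisfies [z + m J^a z = - m (J^a' w - J^a w)]. Its
    right-hand side has no fixed sign, so [z] is enclosed between a barrier and its negative; the
    factor [m] of the source survives in the bound. *)
Lemma mlf_dist_order (al0 al1 T : R) : 0 < al0 -> al1 < 1 -> exists2 C : R, 0 <= C &
  forall a a' m t, al0 <= a <= al1 -> al0 <= a' <= al1 -> 0 <= m -> 0 <= t <= T ->
  `|mlf a' m t - mlf a m t| <= C * m * `|a' - a|.
Proof.
move=> al00 al11; have b0 : 0 < al0 / 2 by rewrite divr_gt0.
have [C C0 HC] := frac_int_dist_order T al00.
have G0 : 0 < Gamma (al0 / 2 + 1) by apply: Gamma_gt0; rewrite addr_gt0.
exists (C * 2 / Gamma (al0 / 2 + 1) * ppow (al0 / 2) T).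
  by rewrite !mulr_ge0 ?ppow_ge0// invr_ge0 ltW.
move=> a a' m t aI a'I m0 /andP[t0 tT].
have I1 x : al0 <= x <= al1 -> al0 <= x <= 1.
  by move=> /andP[-> h]; rewrite (le_trans h)// ltW.
have I2 x : al0 <= x <= al1 -> 0 < x < 1.
  by move=> /andP[l h]; rewrite (lt_le_trans al00 l) (le_lt_trans h al11).
have /andP[a0 a1] := I2 _ aI; have /andP[a'0 a'1] := I2 _ a'I.
pose w := mlf a' m; have cw : continuous w by exact: continuous_mlf.
have c1 (c : R) : continuous (cst c : R -> R) by move=> r; exact: cvg_cst.
have c2w : continuous (fun r => 2 - w r) by move=> r; apply: cvgB; [exact: c1|exact: cw].
have c1w : continuous (fun r => 1 - w r) by move=> r; apply: cvgB; [exact: c1|exact: cw].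
pose K := C * `|a' - a|; have K0 : 0 <= K by rewrite mulr_ge0.
(* The barrier [h] dominates [z]: writing [w = 1 - (1 - w)], the sources of [h + z] and
   [h - z] are nonnegative and nondecreasing, because [1] and [1 - w] are. *)
pose h t := m * K * frac_int (al0 / 2) (fun r => 2 - w r) t.
have ch : continuous h by move=> r; apply: cvgMr; exact: continuous_frac_int.
have w1 r : w r <= 1 by apply: mlf_le1; rewrite ?a'0.
have wnd r s : r <= s -> w s <= w r by apply: mlf_nonincreasing; rewrite ?a'0.
have h0 r : 0 <= r -> 0 <= h r.
  move=> r0; rewrite mulr_ge0 ?mulr_ge0// frac_int_ge0// => s _.
  by have := w1 s; rewrite subr_ge0; lra.
have hnd r s : 0 <= r -> r <= s -> h r <= h s.
  move=> r0 rs; rewrite ler_wpM2l ?mulr_ge0//; apply: frac_int_nondecreasing => //.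
    by move=> x _; have := w1 x; lra.
  by move=> x x' _ xx'; rewrite lerD2l lerN2 wnd.
pose z s := mlf a' m s - mlf a m s.
have cz : continuous z by move=> r; apply: cvgB; exact: continuous_mlf.
have zE s : z s + m * frac_int a z s = - (m * (frac_int a' w s - frac_int a w s)).
  rewrite /z frac_intB//; try exact: continuous_mlf.
  have := mlf_volterra m s a0; have := mlf_volterra m s a'0.
  rewrite -/w; move: (mlf a m s) (frac_int a (mlf a m) s) (w s) => x1 x2 x3 E1 E2.
  have -> : x3 = 1 - m * frac_int a' w s by rewrite -E1; ring.
  have -> : x1 = 1 - m * x2 by rewrite -E2; ring.
  ring.
have key (sg : R) : `|sg| = 1 -> forall s, 0 <= s <= T -> 0 <= h s + sg * z s.
  move=> sg1.
  have csz : continuous (fun s => h s + sg * z s).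
    by move=> r; apply: cvgD; [exact: ch|apply: cvgMr; exact: cz].
  have csz' : continuous (fun s => sg * z s) by move=> r; apply: cvgMr; exact: cz.
  pose P1 (e : R) (y : R -> R) s := K * frac_int (al0 / 2) y s + e * (frac_int a' y s - frac_int a y s).
  have FE s : h s + sg * z s + m * frac_int a (fun s => h s + sg * z s) s =
      m * (P1 (- sg) (cst 1) s + P1 sg (fun r => 1 - w r) s) + m * frac_int a h s.
    rewrite frac_intD// frac_intZ//.
    transitivity (h s + sg * (z s + m * frac_int a z s) + m * frac_int a h s); first ring.
    rewrite zE /P1 /h.
    have E2 : frac_int (al0 / 2) (fun r => 2 - w r) s =
        2 * frac_int (al0 / 2) (cst 1) s - frac_int (al0 / 2) w s.
      rewrite -frac_intZ// -frac_intB//; last by move=> r; apply: cvgMr; exact: c1.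
      by apply: eq_frac_int => r _; rewrite mulr1.
    rewrite E2 !(frac_intB (y := cst 1))//.
    ring.
  apply: (@volterra_ge0_nondecreasing R a m T _ _ (I2 _ aI) m0 csz (fun s _ => FE s)).
    move=> s /andP[s0 sT].
    apply: addr_ge0; apply: mulr_ge0 => //; last first.
      by apply: frac_int_ge0 => // r /andP[r0 _]; rewrite h0// ltW.
    apply: addr_ge0.
      by have [] := HC a a' (cst 1) (- sg) s s (I1 _ aI) (I1 _ a'I) (c1 1); rewrite ?normrN.
    have [] := HC a a' (fun r => 1 - w r) sg s s (I1 _ aI) (I1 _ a'I) c1w => //.
      by move=> r _; rewrite subr_ge0.
    by move=> r r' _ rr'; rewrite lerD2l lerN2 wnd.
  move=> t1 t2 t10 t12 t2T.
  apply: lerD; apply: ler_wpM2l => //; last exact: frac_int_nondecreasing.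
  apply: lerD.
    by have [] := HC a a' (cst 1) (- sg) t1 t2 (I1 _ aI) (I1 _ a'I) (c1 1); rewrite ?normrN.
  have [] := HC a a' (fun r => 1 - w r) sg t1 t2 (I1 _ aI) (I1 _ a'I) c1w => //.
    by move=> r _; rewrite subr_ge0.
  by move=> r r' _ rr'; rewrite lerD2l lerN2 wnd.
have tI : 0 <= t <= T by rewrite t0.
have zh : `|z t| <= h t.
  rewrite ler_norml; apply/andP; split.
    by have := key 1 (normr1 _) t tI; rewrite mul1r -lerBlDl sub0r.
  by have := key (- 1) (normrN1 _) t tI; rewrite mulN1r subr_ge0.
apply: (le_trans zh).
apply: (@le_trans _ _ (m * K * frac_int (al0 / 2) (cst 2) t)).
  rewrite /h ler_wpM2l ?mulr_ge0//; apply: le_frac_int => // r _.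
  by rewrite gerBl ltW// mlf_gt0// I2.
rewrite frac_int_cst// /K.
rewrite (_ : _ * m * _ = m * (C * `|a' - a|) * (2 / Gamma (al0 / 2 + 1) * ppow (al0 / 2) T)); last by ring.
rewrite ler_wpM2l ?mulr_ge0// ler_wpM2l ?divr_ge0 ?(ltW G0)//.
by apply: le_ppow => //; exact: ltW.
Qed.

End OrderPerturbation.

(** * Hilbert space and Bochner integral *)

Section Scalars.
Context {R : realType} {k : scalar_kind}.
Local Notation K := (scalar_field R k).
Local Notation sc := (@scalar_of R k).
Local Notation conj := (@scalar_conj R k).
Implicit Types (x y : R) (z w : K).

Lemma scalar_ofD x y : sc (x + y) = sc x + sc y.
Proof. by case: k => //=; rewrite rmorphD. Qed.

Lemma scalar_ofM x y : sc (x * y) = sc x * sc y.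
Proof. by case: k => //=; rewrite rmorphM. Qed.

Lemma scalar_of0 : sc 0 = 0.
Proof. by case: k => //=; rewrite rmorph0. Qed.

Lemma scalar_of1 : sc 1 = 1.
Proof. by case: k => //=; rewrite rmorph1. Qed.

Lemma scalar_ofN x : sc (- x) = - sc x.
Proof. by case: k => //=; rewrite rmorphN. Qed.

Lemma scalar_ofB x y : sc (x - y) = sc x - sc y.
Proof. by rewrite scalar_ofD scalar_ofN. Qed.

Lemma ler_scalar_of x y : (sc x <= sc y) = (x <= y).
Proof. by case: k => //=; rewrite lecR. Qed.

Lemma ltr_scalar_of x y : (sc x < sc y) = (x < y).
Proof. by case: k => //=; rewrite ltcR. Qed.

Lemma scalar_of_ge0 z : 0 <= z -> z = sc (scalar_re z).
Proof. by move: z; case: k => //= -[a b]; rewrite lecE/= => /andP[/eqP -> _]. Qed.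

Lemma scalar_reK x : scalar_re (sc x) = x.
Proof. by case: k. Qed.

Lemma scalar_reD z w : scalar_re (z + w) = scalar_re z + scalar_re w.
Proof. by move: z w; case: k => //= -[a b] [c d]. Qed.

Lemma scalar_reN z : scalar_re (- z) = - scalar_re z.
Proof. by move: z; case: k => //= -[a b]. Qed.

Lemma scalar_reZ x z : scalar_re (sc x * z) = x * scalar_re z.
Proof. by move: z; case: k => //= -[a b] /=; rewrite mul0r subr0. Qed.

Lemma scalar_re_conj z : scalar_re (conj z) = scalar_re z.
Proof. by move: z; case: k => //= -[a b]. Qed.

Lemma scalar_conjM z w : conj (z * w) = conj z * conj w.
Proof. by move: z w; case: k => //= z w; rewrite rmorphM. Qed.

Lemma scalar_conj_of x : conj (sc x) = sc x.
Proof. by case: k => //=; apply/eqP; rewrite eq_complex/= oppr0 !eqxx. Qed.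

Lemma scalar_absE z : sc (scalar_abs z) = `|z|.
Proof. by rewrite /scalar_abs -scalar_of_ge0. Qed.

Lemma scalar_abs_ge0 z : 0 <= scalar_abs z.
Proof. by rewrite -ler_scalar_of scalar_absE scalar_of0. Qed.

Lemma scalar_of_inj x y : sc x = sc y -> x = y.
Proof. by move=> /(congr1 (@scalar_re R k)); rewrite !scalar_reK. Qed.

Lemma scalar_absM z w : scalar_abs (z * w) = scalar_abs z * scalar_abs w.
Proof. by apply: scalar_of_inj; rewrite scalar_ofM !scalar_absE normrM. Qed.

Lemma norm_scalar_of x : `|sc x| = sc `|x|.
Proof. by case: k => //=; rewrite normc_def/= expr0n addr0 sqrtr_sqr. Qed.

Lemma scalar_abs_of x : scalar_abs (sc x) = `|x|.
Proof. by apply: scalar_of_inj; rewrite scalar_absE norm_scalar_of. Qed.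

Lemma scalar_abs_triangle z w : scalar_abs (z + w) <= scalar_abs z + scalar_abs w.
Proof. by rewrite -ler_scalar_of scalar_ofD !scalar_absE ler_normD. Qed.

Lemma scalar_abs_sqr z : scalar_re (z * conj z) = scalar_abs z ^+ 2.
Proof.
apply: scalar_of_inj; rewrite expr2 scalar_ofM !scalar_absE -expr2.
move: z; case: k => [z|z] /=; first by rewrite -expr2 real_normK// num_real.
rewrite -add_Re2_Im2; case: z => a b /=.
by congr (_%:C)%C; ring.
Qed.

Lemma scalar_pos z : 0 < z -> exists2 r, 0 < r & z = sc r.
Proof.
move=> z0; exists (scalar_re z); last by rewrite -scalar_of_ge0// ltW.
by rewrite -ltr_scalar_of scalar_of0 -scalar_of_ge0// ltW.
Qed.

End Scalars.

Section RealNorm.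
Context {R : realType} {k : scalar_kind}.
Variable H : completeNormedModType (scalar_field R k).
Local Notation sc := (@scalar_of R k).
Implicit Types (u v : H).

Lemma rnormE v : sc (rnorm v) = `|v|.
Proof. by rewrite /rnorm -scalar_of_ge0. Qed.

Lemma rnorm_ge0 v : 0 <= rnorm v.
Proof. by rewrite -(ler_scalar_of (k := k)) rnormE scalar_of0. Qed.

Lemma rnormD u v : rnorm (u + v) <= rnorm u + rnorm v.
Proof. by rewrite -(ler_scalar_of (k := k)) scalar_ofD !rnormE ler_normD. Qed.

Lemma rnormN v : rnorm (- v) = rnorm v.
Proof. by rewrite /rnorm normrN. Qed.

Lemma rnormZ (x : R) v : rnorm (sc x *: v) = `|x| * rnorm v.
Proof.
apply: (@scalar_of_inj _ k).
by rewrite scalar_ofM !rnormE normrZ norm_scalar_of.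
Qed.

Lemma rnorm_distC u v : rnorm (u - v) = rnorm (v - u).
Proof. by rewrite -opprB rnormN. Qed.

Lemma rnorm0 : rnorm (0 : H) = 0.
Proof. by apply: (@scalar_of_inj _ k); rewrite rnormE normr0 scalar_of0. Qed.

Lemma rnorm_eq0 v : rnorm v = 0 -> v = 0.
Proof.
by move=> v0; apply/eqP; rewrite -normr_eq0 -rnormE v0 scalar_of0.
Qed.

Lemma rnorm_le_lip u v : `|rnorm u - rnorm v| <= rnorm (u - v).
Proof.
rewrite ler_norml; apply/andP; split.
  by rewrite lerNl opprB lerBlDr rnorm_distC; have := rnormD (v - u) u; rewrite subrK.
by rewrite lerBlDr; have := rnormD (u - v) v; rewrite subrK.
Qed.

Lemma cvg_rnormP {T : Type} (F : set_system T) {FF : Filter F} (f : T -> H) (l : H) :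
  f @ F --> l <-> (rnorm (f x - l) @[x --> F] --> (0 : R)).
Proof.
split=> [/cvgrPdist_lt fl|fl].
  apply/cvgrPdist_lt => e e0.
  have e0' : 0 < sc e by rewrite -(scalar_of0 (R := R)) ltr_scalar_of.
  have := fl _ e0'; apply: filterS => x.
  rewrite -rnormE ltr_scalar_of rnorm_distC sub0r normrN.
  by rewrite ger0_norm// rnorm_ge0.
apply/cvgrPdist_lt => e /scalar_pos[r r0 ->].
have /cvgrPdist_lt/(_ _ r0) := fl; apply: filterS => x.
rewrite sub0r normrN ger0_norm ?rnorm_ge0// => h.
by rewrite -rnormE ltr_scalar_of rnorm_distC.
Qed.

Lemma cvg_rnorm {T : Type} (F : set_system T) {FF : Filter F} (f : T -> H) (l : H) :
  f @ F --> l -> rnorm (f x) @[x --> F] --> rnorm l.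
Proof.
move=> /cvg_rnormP /cvgrPdist_lt fl; apply/cvgrPdist_lt => e e0.
have := fl _ e0; apply: filterS => x.
rewrite sub0r normrN ger0_norm ?rnorm_ge0//; apply: le_lt_trans.
by rewrite distrC rnorm_le_lip.
Qed.

End RealNorm.

(** * The real part of the inner product *)

Section RealInnerProduct.
Context {R : realType} {k : scalar_kind}.
Variable H : completeNormedModType (scalar_field R k).
Variable ip : {dot H for @scalar_conj R k}.
Hypothesis ip_norm : inner_product_norm ip.
Local Notation sc := (@scalar_of R k).
Implicit Types (u v w : H).

Lemma ipDl u v w : ip (u + v) w = ip u w + ip v w.
Proof. exact: linearDl. Qed.

Lemma ipZl c u w : ip (c *: u) w = c * ip u w.
Proof. exact: linearZl_LR. Qed.

Lemma ip_conj u v : ip u v = scalar_conj (ip v u).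
Proof. by rewrite (hermitian_subproof u v) expr0 mul1r. Qed.

Lemma ipNl u w : ip (- u) w = - ip u w.
Proof. exact: linearNl. Qed.

Lemma ip0l w : ip 0 w = 0.
Proof. exact: linear0l. Qed.

Lemma ipZr c u w : ip u (c *: w) = scalar_conj c * ip u w.
Proof. by rewrite ip_conj ipZl scalar_conjM -ip_conj. Qed.

(** A symmetric real bilinear form over either scalar field, so that testing a vector-valued
    integral leads to integrals of real functions. *)
Definition rip u v : R := scalar_re (ip u v).

Lemma ripC u v : rip u v = rip v u.
Proof. by rewrite /rip ip_conj scalar_re_conj. Qed.

Lemma ripDl u v w : rip (u + v) w = rip u w + rip v w.
Proof. by rewrite /rip ipDl scalar_reD. Qed.

Lemma ripNl u w : rip (- u) w = - rip u w.
Proof. by rewrite /rip ipNl scalar_reN. Qed.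

Lemma ripBl u v w : rip (u - v) w = rip u w - rip v w.
Proof. by rewrite ripDl ripNl. Qed.

Lemma ripZl (x : R) u w : rip (sc x *: u) w = x * rip u w.
Proof. by rewrite /rip ipZl scalar_reZ. Qed.

Lemma rip0l w : rip 0 w = 0.
Proof. by rewrite -(subrr 0) ripBl subrr. Qed.

Lemma rip_suml (I : Type) (r : seq I) (P : pred I) (F : I -> H) w :
  rip (\sum_(i <- r | P i) F i) w = \sum_(i <- r | P i) rip (F i) w.
Proof.
by apply: (big_morph (fun v => rip v w)) => [u v|]; rewrite ?ripDl ?rip0l.
Qed.

Lemma rip_sqr v : rip v v = rnorm v ^+ 2.
Proof.
apply: (@scalar_of_inj _ k); rewrite expr2 scalar_ofM !rnormE -expr2 ip_norm.
by rewrite -scalar_of_ge0// -ip_norm exprn_ge0.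
Qed.

Lemma rip_le u v : `|rip u v| <= rnorm u * rnorm v.
Proof.
have [v0|v0] := eqVneq (rnorm v) 0.
  by rewrite (rnorm_eq0 v0) ripC rip0l normr0 rnorm0 mulr0.
have vp : 0 < rnorm v by rewrite lt_neqAle eq_sym v0 rnorm_ge0.
pose c := rip u v / rnorm v ^+ 2.
have := sqr_ge0 (rnorm (u - sc c *: v)).
rewrite -rip_sqr ripBl ripC ripBl [X in _ - X]ripC ripBl !ripZl.
rewrite (ripC u (sc c *: v)) !ripZl !rip_sqr (ripC v u) (ripC v (sc c *: v)) ripZl rip_sqr => h.
have h2 : rip u v ^+ 2 <= (rnorm u * rnorm v) ^+ 2.
  have : 0 <= (rnorm u ^+ 2 - c * rip u v - (c * rip u v - c * (c * rnorm v ^+ 2))) * rnorm v ^+ 2.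
    by rewrite mulr_ge0// exprn_ge0// rnorm_ge0.
  have -> : (rnorm u ^+ 2 - c * rip u v - (c * rip u v - c * (c * rnorm v ^+ 2))) * rnorm v ^+ 2
     = (rnorm u * rnorm v) ^+ 2 - rip u v ^+ 2.
    by rewrite /c; field.
  by rewrite subr_ge0.
by rewrite -ler_sqr ?nnegrE ?mulr_ge0 ?rnorm_ge0// real_normK ?num_real.
Qed.

End RealInnerProduct.

(** * Fourier coefficients and spectral multipliers *)

Section Spectral.
Context {R : realType} {k : scalar_kind}.
Variable H : completeNormedModType (scalar_field R k).
Variable ip : {dot H for @scalar_conj R k}.
Hypothesis ip_norm : inner_product_norm ip.
Variable phi : nat -> H.
Hypothesis phi_basis : orthonormal_basis ip phi.
Local Notation sc := (@scalar_of R k).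
Local Notation K := (scalar_field R k).
Implicit Types (u v : H) (c : nat -> K) (p q n m : nat) (w g : nat -> R).

Let phi_orth p q : ip (phi p) (phi q) = (p == q)%:R := phi_basis.1 p q.

Definition acoef p v : R := scalar_abs (ip v (phi p)).

Lemma acoef_ge0 p v : 0 <= acoef p v. Proof. exact: scalar_abs_ge0. Qed.

Lemma ip_suml (I : Type) (r : seq I) (P : pred I) (F : I -> H) (w' : H) :
  ip (\sum_(i <- r | P i) F i) w' = \sum_(i <- r | P i) ip (F i) w'.
Proof.
by apply: (big_morph (fun v => ip v w')) => [u v|]; rewrite ?ipDl ?ip0l.
Qed.

Lemma coef_sum c m n q : ip (\sum_(m <= p < n) c p *: phi p) (phi q) =
  if (m <= q < n)%N then c q else 0.
Proof.
rewrite ip_suml; under eq_bigr do rewrite ipZl phi_orth.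
case: ifPn => [mqn|mqn].
  rewrite (bigD1_seq q)/= ?mem_index_iota ?iota_uniq// eqxx mulr1.
  by rewrite big1 ?addr0// => p /negPf ->; rewrite mulr0.
rewrite big_nat big1// => p mpn; case: eqP => [pq|_]; last by rewrite mulr0.
by move: mqn; rewrite -pq mpn.
Qed.

Lemma rnorm_sum c m n :
  rnorm (\sum_(m <= p < n) c p *: phi p) ^+ 2 = \sum_(m <= p < n) scalar_abs (c p) ^+ 2.
Proof.
rewrite -(rip_sqr ip_norm) rip_suml; apply: eq_big_nat => q mqn.
by rewrite ripC /rip ipZr coef_sum mqn mulrC scalar_abs_sqr.
Qed.

Lemma rnorm_phiZ (z : K) p : rnorm (z *: phi p) = scalar_abs z.
Proof.
have := rnorm_sum (fun=> z) p p.+1; rewrite !big_nat1 => /eqP.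
by rewrite eqrXn2 ?rnorm_ge0 ?scalar_abs_ge0// => /eqP.
Qed.

Lemma acoef_le p v : acoef p v <= rnorm v.
Proof.
have [a0|a0] := eqVneq (acoef p v) 0; first by rewrite a0 rnorm_ge0.
have ap : 0 < acoef p v by rewrite lt_neqAle eq_sym a0 acoef_ge0.
rewrite -(ler_pM2r ap).
have := rip_le ip_norm v (ip v (phi p) *: phi p); rewrite rnorm_phiZ; apply: le_trans.
rewrite /rip ipZr; apply: le_trans (ler_norm _).
by rewrite [X in scalar_re X]mulrC scalar_abs_sqr expr2.
Qed.

Lemma coef_lim c v q : series (fun p => c p *: phi p) @ \oo --> v -> ip v (phi q) = c q.
Proof.
move=> /cvg_rnormP /cvgrPdist_lt cv.
apply/eqP; rewrite -subr_eq0 -normr_le0 -scalar_absE -(scalar_of0 (R := R)) ler_scalar_of.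
apply/ler_addgt0Pr => e e0; rewrite add0r.
have [N _ HN] := cv _ e0.
have /= := HN (maxn N q.+1) (leq_maxl _ _).
rewrite sub0r normrN ger0_norm ?rnorm_ge0// => /ltW; apply: le_trans.
apply: le_trans (acoef_le q _); rewrite /acoef ipDl ipNl /series/= coef_sum.
rewrite leq0n leq_maxr /=.
by rewrite -(ler_scalar_of (k := k)) !scalar_absE distrC.
Qed.

Lemma coef_ext u v : (forall p, ip u (phi p) = ip v (phi p)) -> u = v.
Proof.
move=> uv; have hu := phi_basis.2 u; have hv := phi_basis.2 v.
rewrite -(cvg_lim (@norm_hausdorff _ H) hu) -(cvg_lim (@norm_hausdorff _ H) hv).
by congr (limn (series _)); apply/funext => p; rewrite uv.
Qed.

Lemma parseval v : \sum_(0 <= p < n) acoef p v ^+ 2 @[n --> \oo] --> rnorm v ^+ 2.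
Proof.
have -> : (fun n => \sum_(0 <= p < n) acoef p v ^+ 2) =
    (fun n => rnorm (series (fun p => ip v (phi p) *: phi p) n) ^+ 2).
  by apply/funext => n; rewrite -rnorm_sum.
have h : rnorm (series (fun p => ip v (phi p) *: phi p) n) @[n --> \oo] --> rnorm v.
  by apply: cvg_rnorm; exact: phi_basis.2.
by rewrite expr2; under eq_fun do rewrite expr2; exact: cvgM.
Qed.

Lemma riesz_fischer c : cvgn (series (fun p => scalar_abs (c p) ^+ 2)) ->
  cvgn (series (fun p => c p *: phi p)).
Proof.
move=> /cvg_cauchy /cauchy_seriesP cc; apply/cauchy_cvgP/cauchy_seriesP.
move=> e /scalar_pos[r r0 ->].
have r20 : 0 < r ^+ 2 by rewrite exprn_gt0.
have := cc _ r20; apply: filterS => -[m n] /=.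
rewrite -rnorm_sum ger0_norm ?exprn_ge0 ?rnorm_ge0// => h.
by rewrite -rnormE ltr_scalar_of; move: h; rewrite ltr_pXn2r ?nnegrE ?rnorm_ge0// ltW.
Qed.

(** The squared [H^s] norm of any spectral multiplier applied to [v] has this form, with weight
    [lam^(2 s)] times the squared symbol. *)
Definition wsum w v : \bar R := (\sum_(0 <= p <oo) (w p * acoef p v ^+ 2)%:E)%E.

Let wterm_ge0 w v p : (forall q, 0 <= w q) -> (0 <= (w p * acoef p v ^+ 2)%:E)%E.
Proof. by move=> w0; rewrite lee_fin mulr_ge0// exprn_ge0// acoef_ge0. Qed.

Lemma wsum_ge0 w v : (forall q, 0 <= w q) -> (0 <= wsum w v)%E.
Proof. by move=> w0; apply: nneseries_ge0 => p _ _; exact: wterm_ge0. Qed.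

Lemma wsum_le w w' (C : R) v : (forall p, 0 <= w p <= C * w' p) -> (forall p, 0 <= w' p) -> 0 <= C ->
  (wsum w v <= C%:E * wsum w' v)%E.
Proof.
move=> ww w'0 C0; rewrite /wsum -nneseriesZl; last by move=> p _; exact: wterm_ge0.
apply: lee_nneseries => [p _ _|p _].
  by apply: wterm_ge0 => q; case/andP: (ww q).
by rewrite -EFinM lee_fin [leRHS]mulrA ler_wpM2r ?exprn_ge0 ?acoef_ge0//; case/andP: (ww p).
Qed.

Lemma wsum_fin w w' (C : R) v : (forall p, 0 <= w p <= C * w' p) -> (forall p, 0 <= w' p) -> 0 <= C ->
  (wsum w' v < +oo)%E -> (wsum w v < +oo)%E.
Proof.
move=> ww w'0 C0 fin; apply: le_lt_trans (wsum_le v ww w'0 C0) _.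
have : (0 <= wsum w' v)%E by exact: wsum_ge0.
by move: fin; case: (wsum w' v) => // x _ _; rewrite -EFinM ltry.
Qed.

Lemma eq_wsum w g u v : (forall p, w p * acoef p u ^+ 2 = g p * acoef p v ^+ 2) -> wsum w u = wsum g v.
Proof. by move=> e; apply: eq_eseriesr => p _; rewrite e. Qed.

Lemma wsum_cvg w v : (forall q, 0 <= w q) -> (wsum w v < +oo)%E ->
  cvgn (series (fun p => w p * acoef p v ^+ 2)).
Proof.
move=> w0 fin; apply: nondecreasing_is_cvgn.
  apply/nondecreasing_seqP => n; rewrite seriesSr lerDl.
  by rewrite mulr_ge0// exprn_ge0// acoef_ge0.
exists (fine (wsum w v)) => _ [n _ <-].
rewrite -lee_fin fineK; last by rewrite ge0_fin_numE// wsum_ge0.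
rewrite /series/= -sumEFin; apply: nneseries_lim_ge => p _ _; exact: wterm_ge0.
Qed.

Lemma wsum_parseval v : wsum (fun=> 1) v = (rnorm v ^+ 2)%:E.
Proof.
apply/cvg_lim => //.
have -> : (fun n => \sum_(0 <= p < n) (1 * acoef p v ^+ 2)%:E)%E =
    (fun n => (\sum_(0 <= p < n) acoef p v ^+ 2)%:E).
  by apply/funext => n; rewrite -sumEFin; apply: eq_bigr => p _; rewrite mul1r.
by apply: cvg_EFin; [exact: nearW|exact: parseval].
Qed.

(** Total by the convention for limits; it is the intended vector only under the summability assumed
    in [multiplierP]. *)
Definition multiplier g v : H := limn (series (fun p => (sc (g p) * ip v (phi p)) *: phi p)).

Lemma multiplierP g v : (wsum (fun p => (g p ^+ 2)%R) v < +oo)%E ->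
  series (fun p => (sc (g p) * ip v (phi p)) *: phi p) @ \oo --> multiplier g v /\
  forall p, ip (multiplier g v) (phi p) = sc (g p) * ip v (phi p).
Proof.
move=> fin.
have cv : series (fun p => (sc (g p) * ip v (phi p)) *: phi p) @ \oo --> multiplier g v.
  apply: riesz_fischer.
  rewrite (_ : (fun p => _) = (fun p => g p ^+ 2 * acoef p v ^+ 2)); last first.
    by apply/funext => p; rewrite /acoef scalar_absM scalar_abs_of exprMn real_normK ?num_real.
  by apply: wsum_cvg => // p; exact: sqr_ge0.
by split=> // p; rewrite (coef_lim _ cv).
Qed.

Lemma acoefM p u v (x : R) : ip u (phi p) = sc x * ip v (phi p) ->
  acoef p u ^+ 2 = x ^+ 2 * acoef p v ^+ 2.
Proof.
by move=> e; rewrite /acoef e scalar_absM scalar_abs_of exprMn real_normK ?num_real.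
Qed.

(** The tail beyond a suitable [N] is small uniformly in [x], and the finitely many remaining terms
    tend to 0. The filter is arbitrary because limits in time, limits within [[0, T]] and limits in
    the pair of orders are all needed. *)
Lemma wsum_cvg0 {T : Type} (F : set_system T) {FF : Filter F} (G : T -> nat -> R) w v (M : R) :
  (forall q, 0 <= w q) -> (wsum w v < +oo)%E ->
  (\forall x \near F, forall p, `|G x p| <= M) ->
  (forall p, G x p @[x --> F] --> (0 : R)) ->
  fine (wsum (fun p => w p * G x p ^+ 2) v) @[x --> F] --> (0 : R).
Proof.
move=> w0 fin GM G0; apply/cvgrPdist_lt => e e0.
pose a p := (w p * acoef p v ^+ 2)%:E.
have a0 p : (0 <= a p)%E by exact: wterm_ge0.
have := nneseries_tail_cvg fin (fun p _ => a0 p).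
(* Chosen so that the tail, after multiplication by at most [M^2], stays below [e / 2]; the summand
   1 covers [M = 0]. *)
pose d := e / (2 * (M ^+ 2 + 1)).
have M1 : 0 < M ^+ 2 + 1 by rewrite ltr_wpDl// sqr_ge0.
have d0 : 0 < d by rewrite divr_gt0// mulr_gt0.
move=> /fine_cvgP[finN] /cvgrPdist_lt /(_ _ d0) tl.
have [N [fN tN]] : exists N, (\big[+%E/0]_(N <= p <oo) a p \is a fin_num)%E /\
    fine (\big[+%E/0]_(N <= p <oo) a p)%E < d.
  have [N _ HN] : \forall N \near \oo, (\big[+%E/0]_(N <= p <oo) a p \is a fin_num)%E /\
      `|0 - fine (\big[+%E/0]_(N <= p <oo) a p)%E| < d.
    by apply: filterI; [exact: finN|exact: tl].
  exists N; have [h1 h2] := HN N (leqnn _); split=> //.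
  by move: h2; rewrite sub0r normrN ger0_norm// fine_ge0// nneseries_ge0.
have fincv n : \sum_(0 <= p < n) (w p * acoef p v ^+ 2 * G x p ^+ 2) @[x --> F] --> (0 : R).
  elim: n => [|n IH].
    by under eq_fun do rewrite big_geq//; exact: cvg_cst.
  under eq_fun do rewrite big_nat_recr//=.
  have G2 : w n * acoef n v ^+ 2 * G x n ^+ 2 @[x --> F] --> w n * acoef n v ^+ 2 * (0 * 0).
    by under eq_fun do rewrite expr2; apply: cvgMr; apply: cvgM; exact: G0.
  by have := cvgD IH G2; rewrite !mulr0 addr0; exact.
have e20 : 0 < e / 2 by rewrite divr_gt0.
move/cvgrPdist_lt/(_ _ e20) : (fincv N) => {}fincv.
near=> x.
have Gx : forall p, `|G x p| <= M by near: x.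
have Gx2 p : G x p ^+ 2 <= M ^+ 2.
  rewrite -(real_normK (num_real (G x p))) lerXn2r ?nnegrE//.
  exact: le_trans (Gx p).
have g0 p : (0 <= (w p * G x p ^+ 2 * acoef p v ^+ 2)%:E)%E.
  by rewrite lee_fin mulr_ge0 ?sqr_ge0// mulr_ge0 ?sqr_ge0.
rewrite sub0r normrN ger0_norm; last by apply: fine_ge0; apply: nneseries_ge0.
rewrite -lte_fin fineK; last first.
  rewrite ge0_fin_numE; last by apply: nneseries_ge0.
  apply: (wsum_fin (w' := w) (C := M ^+ 2)) fin => //; last exact: sqr_ge0.
  by move=> p; rewrite mulr_ge0 ?sqr_ge0//= mulrC ler_wpM2r.
rewrite /wsum (nneseries_split 0 N)//= add0n.
have -> : e%:E = ((e / 2)%:E + (e / 2)%:E)%E by rewrite -EFinD -splitr.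
have tail : (\big[+%E/0]_(N <= p <oo) (w p * G x p ^+ 2 * acoef p v ^+ 2)%:E <= (e / 2)%:E)%E.
  apply: (@le_trans _ _ ((M ^+ 2)%:E * \big[+%E/0]_(N <= p <oo) a p)%E).
    rewrite -nneseriesZl//; apply: lee_nneseries => // p _.
    by rewrite /a -EFinM lee_fin mulrAC mulrC ler_wpM2r// mulr_ge0// exprn_ge0// acoef_ge0.
  rewrite -(fineK fN) -EFinM lee_fin.
  apply: (@le_trans _ _ ((M ^+ 2 + 1) * d)).
    apply: ler_pM; rewrite ?sqr_ge0 ?lerDl ?(ltW tN)//.
    by apply: fine_ge0; apply: nneseries_ge0.
  rewrite /d le_eqVlt; apply/orP; left; apply/eqP; field.
  by rewrite gt_eqF.
apply: lte_leD => //.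
  by rewrite ge0_fin_numE ?nneseries_ge0//; apply: le_lt_trans tail (ltry _).
have : `|0 - \sum_(0 <= p < N) (w p * acoef p v ^+ 2 * G x p ^+ 2)| < e / 2 by near: x.
rewrite sumEFin lte_fin sub0r normrN; apply: le_lt_trans; apply: le_trans (ler_norm _).
by apply: ler_sum => p _; rewrite mulrAC.
Unshelve. all: by end_near. Qed.

End Spectral.

(** * Testing and constructing Bochner integrals *)

Section BochnerIntegral.
Context {R : realType} {k : scalar_kind}.
Variable H : completeNormedModType (scalar_field R k).
Variable ip : {dot H for @scalar_conj R k}.
Hypothesis ip_norm : inner_product_norm ip.
Local Notation sc := (@scalar_of R k).
Local Notation mu := (@lebesgue_measure R).
Local Notation rip := (rip ip).
Implicit Types (D : set (measurableTypeR R)) (f : R -> H) (psi I : H).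

(** The integral of a nonnegative function is a supremum over simple functions below it, hence
    monotone without measurability; the integrand of a given Bochner integral is not known to have a
    measurable norm. *)
Lemma le_integral_nonneg D (g h : R -> \bar R) :
  (forall x, D x -> 0 <= g x <= h x)%E ->
  (\int[mu]_(x in D) g x <= \int[mu]_(x in D) h x)%E.
Proof.
move=> gh; rewrite [leLHS]integral_mkcond [leRHS]integral_mkcond !ge0_integralTE.
- apply: le_ereal_sup => _ /= [u ug <-]; exists u => // x; apply: le_trans (ug x) _.
  by rewrite !patchE; case: ifPn => // /set_mem/gh /andP[].
- by move=> x; rewrite patchE; case: ifPn => // /set_mem/gh /andP[/le_trans]; apply.
- by move=> x; rewrite patchE; case: ifPn => // /set_mem/gh /andP[].
Qed.

Lemma Rintegral_sum D (J : Type) (r : seq J) (F : J -> measurableTypeR R -> R) : measurable D ->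
  (forall j, mu.-integrable D (EFin \o F j)) ->
  mu.-integrable D (EFin \o (fun x => \sum_(j <- r) F j x)) /\
  \int[mu]_(x in D) (\sum_(j <- r) F j x) = \sum_(j <- r) \int[mu]_(x in D) F j x.
Proof.
move=> mD iF; elim: r => [|j r [IH1 IH2]].
  have e : (fun x => \sum_(j <- [::]) F j x) = cst 0 by apply/funext => x; rewrite big_nil.
  rewrite e big_nil; split; first exact: integrable0.
  by rewrite /Rintegral integral0.
have e : (fun x => \sum_(i <- j :: r) F i x) = (fun x => F j x + \sum_(i <- r) F i x).
  by apply/funext => x; rewrite big_cons.
rewrite e big_cons -IH2; split; last exact: RintegralD.
by have := integrableD mD (iF j) IH1.
Qed.

Lemma rip_sf_fun (g : simple_fun H) psi t :
  rip (sf_fun g t) psi = \sum_(i < sf_size g) \1_(sf_set i) t * rip (sf_val i) psi.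
Proof. by rewrite rip_suml; apply: eq_bigr => i _; rewrite ripZl. Qed.

Lemma rip_sf_integral D (g : simple_fun H) psi : measurable D ->
  mu.-integrable D (EFin \o (fun t => rip (sf_fun g t) psi)) /\
  \int[mu]_(t in D) rip (sf_fun g t) psi = rip (sf_integral D g) psi.
Proof.
move=> mD; under [X in EFin \o X]eq_fun do rewrite rip_sf_fun.
under eq_Rintegral do rewrite rip_sf_fun.
have iI (i : 'I_(sf_size g)) : mu.-integrable D (EFin \o \1_(sf_set i)).
  have mS := sf_measurable i; apply/integrableP; split.
    by apply/measurable_EFinP; exact: measurable_indic.
  under eq_integral do rewrite gee0_abs ?lee_fin//.
  rewrite integral_indic//; apply: le_lt_trans (sf_finite i).
  by apply: le_measure; rewrite ?inE//; exact: measurableI.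
have iF (i : 'I_(sf_size g)) :
    mu.-integrable D (EFin \o (fun t => \1_(sf_set i) t * rip (sf_val i) psi)).
  have := integrableZr mD (rip (sf_val i) psi) (iI i).
  by apply: eq_integrable => // t _.
have [i1 i2] := Rintegral_sum (index_enum 'I_(sf_size g)) mD iF.
split=> //; rewrite i2 rip_suml; apply: eq_bigr => i _; rewrite ripZl RintegralZr//.
by rewrite /Rintegral integral_indic//; [rewrite setIC|exact: sf_measurable].
Qed.

(** Expanding the square of the norm leaves finite sums of indicators with real coefficients, so
    only real functions have to be measured. *)
Lemma measurable_rnorm_sfB D (g h : simple_fun H) : measurable D ->
  measurable_fun D (fun t => rnorm (sf_fun g t - sf_fun h t)).
Proof.
move=> mD; pose q t := rip (sf_fun g t) (sf_fun g t) + rip (sf_fun h t) (sf_fun h t)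
  - 2 * rip (sf_fun g t) (sf_fun h t).
have mq (u w : simple_fun H) : measurable_fun D (fun t => rip (sf_fun u t) (sf_fun w t)).
  under eq_fun do rewrite rip_sf_fun.
  apply: measurable_sum => i; apply: measurable_funM.
    by apply: measurable_indic; exact: sf_measurable.
  under eq_fun do rewrite ripC rip_sf_fun.
  apply: measurable_sum => j; apply: measurable_funM => //.
  by apply: measurable_indic; exact: sf_measurable.
have -> : (fun t => rnorm (sf_fun g t - sf_fun h t)) = (fun t => q t `^ 2^-1).
  apply/funext => t.
  have -> : q t = rnorm (sf_fun g t - sf_fun h t) ^+ 2.
    rewrite -(rip_sqr ip_norm) ripBl (ripC _ _ (_ - _)) ripBl (ripC _ _ (_ - _)) ripBl /q.
    by rewrite (ripC _ (sf_fun h t) (sf_fun g t)); ring.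
  by rewrite powR12_sqrt ?sqr_ge0// sqrtr_sqr ger0_norm// rnorm_ge0.
apply: (measurableT_comp (measurable_powR _)).
by apply: measurable_funB; [exact: measurable_funD|exact: measurable_funM].
Qed.

(** For simple functions this is linearity. One approximant close both in mean and in its integral
    then leaves two errors of size [e / 2], since [psi] has norm at most 1. *)
Lemma bochner_rip D f I psi : measurable D -> is_bochner D f I -> rnorm psi <= 1 ->
  mu.-integrable D (EFin \o (fun t => rip (f t) psi)) ->
  \int[mu]_(t in D) rip (f t) psi = rip I psi.
Proof.
move=> mD [g [_ gf gI]] psi1 iF.
apply/eqP; rewrite -subr_eq0 -normr_le0; apply/ler_addgt0Pr => e e0; rewrite add0r.
have e2 : 0 < e / 2 by rewrite divr_gt0.
have {}gI : \forall n \near \oo, rnorm (I - sf_integral D (g n)) < e / 2.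
  move/cvg_rnormP/cvgrPdist_lt/(_ _ e2): gI; apply: filterS => n.
  by rewrite sub0r normrN ger0_norm ?rnorm_ge0// rnorm_distC.
have {}gf : \forall n \near \oo,
    (\int[mu]_(t in D) (rnorm (f t - sf_fun (g n) t))%:E < (e / 2)%:E)%E.
  have /fine_cvgP[fin /cvgrPdist_lt/(_ _ e2) cf] := gf.
  apply: filterS2 fin cf => n fin /=; rewrite sub0r normrN => cf.
  by rewrite -(fineK fin) lte_fin; apply: le_lt_trans cf; exact: ler_norm.
have [n [h1 h2]] : exists n, rnorm (I - sf_integral D (g n)) < e / 2 /\
    (\int[mu]_(t in D) (rnorm (f t - sf_fun (g n) t))%:E < (e / 2)%:E)%E.
  by have [n] := filter_ex (filterI gI gf); exists n.
have [i1 i2] := rip_sf_integral (g n) psi mD.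
have -> : \int[mu]_(t in D) rip (f t) psi - rip I psi =
    \int[mu]_(t in D) (rip (f t) psi - rip (sf_fun (g n) t) psi)
     - rip (I - sf_integral D (g n)) psi.
  by rewrite RintegralB// i2 ripBl; ring.
apply: le_trans (ler_normB _ _) _; rewrite (splitr e); apply: lerD; last first.
  apply: le_trans (rip_le ip_norm _ _) _.
  by apply: le_trans (ltW h1); rewrite -[leRHS]mulr1 ler_wpM2l// rnorm_ge0.
have iD : mu.-integrable D (EFin \o (fun t => rip (f t) psi - rip (sf_fun (g n) t) psi)).
  by have := integrableB mD iF i1.
rewrite -lee_fin EFin_normr_Rintegral//.
apply: le_trans (ltW h2).
apply: le_trans (le_abse_integral _ mD _) _; first by case/integrableP: iD.
apply: le_integral_nonneg => t _; rewrite abse_ge0/= lee_fin -ripBl.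
apply: le_trans (rip_le ip_norm _ _) _.
by rewrite -[leRHS]mulr1 ler_wpM2l// rnorm_ge0.
Qed.

(** Real dominated convergence makes the mean errors [eps n] tend to 0, and the integrals of the
    simple functions are Cauchy because they differ by at most [eps n + eps m]. *)
Lemma bochner_dominated D f (g : nat -> simple_fun H) (B : measurableTypeR R -> R) : measurable D ->
  (forall t, D t -> sf_fun (g n) t @[n --> \oo] --> f t) ->
  mu.-integrable D (EFin \o B) ->
  (forall n t, D t -> rnorm (sf_fun (g n) t) <= B t) ->
  exists I, is_bochner D f I.
Proof.
move=> mD gf iB gB.
pose h n (t : measurableTypeR R) := rnorm (f t - sf_fun (g n) t).
have fB t : D t -> rnorm (f t) <= B t.
  move=> Dt; apply: (cvgr_to_le (cvg_rnorm (gf t Dt))).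
  by apply: nearW => n; exact: gB.
have hB n t : D t -> h n t <= 2 * B t.
  move=> Dt; apply: le_trans (rnormD _ _) _; rewrite rnormN mulrDl mul1r.
  by apply: lerD; [exact: fB|exact: gB].
have mh n : measurable_fun D (h n).
  apply: (@measurable_fun_cvg _ _ _ D (fun m t => rnorm (sf_fun (g m) t - sf_fun (g n) t))).
    by move=> m; exact: measurable_rnorm_sfB.
  move=> t Dt; apply: cvg_rnorm; apply: cvgB; [exact: gf|exact: cvg_cst].
have i2B : mu.-integrable D (EFin \o (fun t => 2 * B t)).
  by have := integrableZl mD 2 iB; apply: eq_integrable.
have ih n : mu.-integrable D (EFin \o h n).
  apply: (le_integrable mD _ _ i2B); first exact/measurable_EFinP.
  move=> t Dt; rewrite /= lee_fin ger0_norm ?rnorm_ge0//.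
  by apply: le_trans (hB n t Dt) (ler_norm _).
have h0 : (\int[mu]_(t in D) (h n t)%:E)%E @[n --> \oo] --> 0%E.
  have := @dominated_convergence _ _ _ mu D mD (fun n => EFin \o h n) (cst 0%E)
    (EFin \o (fun t => 2 * B t)).
  case.
  - by move=> n; exact/measurable_EFinP.
  - exact: measurable_cst.
  - apply: aeW => t Dt; apply: cvg_EFin; first exact: nearW.
    rewrite /h; have /cvg_rnormP := gf t Dt.
    by under eq_fun do rewrite rnorm_distC.
  - exact: i2B.
  - apply: aeW => t n Dt; rewrite /= lee_fin ger0_norm ?rnorm_ge0//; exact: hB.
  - by move=> _ _; rewrite integral0.
pose S n := sf_integral D (g n).
pose eps n := \int[mu]_(t in D) h n t.
have eps0 : eps n @[n --> \oo] --> (0 : R).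
  by apply: fine_cvg h0.
have Snm n m : rnorm (S n - S m) <= eps n + eps m.
  (* Testing the difference against itself expresses its squared norm by a real integral. *)
  set x := S n - S m.
  have [x0|x0] := eqVneq (rnorm x) 0.
    by rewrite x0 addr_ge0// Rintegral_ge0// => t _; exact: rnorm_ge0.
  have xp : 0 < rnorm x by rewrite lt_neqAle eq_sym x0 rnorm_ge0.
  rewrite -(ler_pM2l xp) -expr2 -(rip_sqr ip_norm) {1}/x ripBl.
  have [in1 in2] := rip_sf_integral (g n) x mD.
  have [im1 im2] := rip_sf_integral (g m) x mD.
  rewrite -in2 -im2 -RintegralB// /eps -RintegralD// -RintegralZl//; last first.
    by have := integrableD mD (ih n) (ih m).
  apply: le_Rintegral => //.
  - by have := integrableB mD in1 im1.
  - by have := integrableZl mD (rnorm x) (integrableD mD (ih n) (ih m)).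
  move=> t _; rewrite -ripBl; apply: le_trans (ler_norm _) _.
  apply: le_trans (rip_le ip_norm _ _) _; rewrite mulrC ler_wpM2l ?rnorm_ge0//.
  have -> : sf_fun (g n) t - sf_fun (g m) t = (f t - sf_fun (g m) t) - (f t - sf_fun (g n) t).
    by rewrite opprB [RHS]addrC subrKA.
  by apply: le_trans (rnormD _ _) _; rewrite rnormN addrC.
have cS : cvgn S.
  apply/cauchy_cvgP; apply/cauchy_ballP => e /scalar_pos[r r0 ->].
  have r2 : 0 < r / 2 by rewrite divr_gt0.
  have /cvgrPdist_lt/(_ _ r2) E := eps0.
  pose Q := [set y : H | exists2 n, eps n < r / 2 & y = S n].
  exists (Q, Q) => /=.
    have E' : \forall n \near \oo, Q (S n).
      apply: filterS E => n; rewrite sub0r normrN => hn; exists n => //.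
      by apply: le_lt_trans (ler_norm _) hn.
    by split.
  move=> [y z] [/= [n hn ->] [m hm ->]]; rewrite -ball_normE /= -rnormE ltr_scalar_of.
  by apply: le_lt_trans (Snm n m) _; rewrite (splitr r) ltrD.
exists (limn S), g; split => //.
by apply: aeW => t; exact: gf.
Qed.

Lemma cvg_scalar_of (T : Type) (F : set_system T) {FF : Filter F} (y : T -> R) (l : R) :
  y x @[x --> F] --> l -> sc (y x) @[x --> F] --> sc l.
Proof.
move=> /cvgrPdist_lt yl; apply/cvgrPdist_lt => e /scalar_pos[r r0 ->].
apply: filterS (yl _ r0) => x.
by rewrite -scalar_ofB norm_scalar_of ltr_scalar_of.
Qed.

(* Left endpoints are used so that the increasing kernel dominates the step functions. *)
Lemma bochner_frac_exists a t (u : R -> H) : 0 < a -> a < 1 -> continuous u ->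
  exists I, is_bochner `]0, t[ (fun r => sc ((t - r) `^ (- a)) *: u r) I.
Proof.
move=> a0 a1 cu; have [t0|t0] := leP t 0.
  rewrite set_itv_ge ?bnd_simp -?leNgt//.
  apply: (@bochner_dominated _ _ (fun=> @SimpleFun R k H 0 (fun=> set0) (fun=> 0)
     (fun=> measurable0) (fun=> _)) (cst 0)) => //.
  by move=> _ /=; rewrite measure0 ltry.
  exact: integrable0.
pose f r := sc ((t - r) `^ (- a)) *: u r.
pose x n i : R := t * i%:R / n.+1%:R.
have n0 n : (0 : R) < n.+1%:R by rewrite ltr0n.
pose cell n (i : 'I_n.+1) : set (measurableTypeR R) := `[x n i, x n i.+1[%classic.
have mcell n i : measurable (cell n i) by exact: measurable_itv.
have fcell n i : (mu (cell n i) < +oo)%E.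
  rewrite /cell lebesgue_measure_itv/=; case: ifP => _; last by rewrite ltry.
  by rewrite -EFinB ltry.
pose g n := @SimpleFun R k H n.+1 (@cell n) (fun i => f (x n i)) (@mcell n) (@fcell n).
(* The left end of the cell that contains [r]; the [n.+1] cells cover [[0, t)]. *)
pose nd n r := x n (Num.truncn (r * n.+1%:R / t)).
have ndP n r : 0 < r < t -> nd n r <= r < nd n r + t / n.+1%:R.
  move=> /andP[r0 rt].
  have : 0 <= r * n.+1%:R / t by rewrite divr_ge0 ?mulr_ge0 ?(ltW r0) ?(ltW t0).
  move=> /truncn_itv; set i := Num.truncn _; rewrite ler_pdivlMr// ltr_pdivrMr// => /andP[h1 h2].
  rewrite /nd -/i /x ler_pdivrMr// mulrC h1/= -mulrDl ltr_pdivlMr//.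
  by move: h2; rewrite -[i.+1%:R]natr1 mulrDl mul1r.
have gE n r : 0 < r < t -> sf_fun (g n) r = f (nd n r).
  move=> rt; have /andP[r0 rt'] := rt.
  have h0 : 0 <= r * n.+1%:R / t by rewrite divr_ge0 ?mulr_ge0 ?(ltW r0) ?(ltW t0).
  have := truncn_itv h0; set i := Num.truncn _ => h.
  have cE (j : 'I_n.+1) : (r \in cell n j) = (val j == i).
    apply/idP/idP.
      rewrite inE /cell/= in_itv/= /x => /andP[h1 h2].
      rewrite -(@truncn_def _ (r * n.+1%:R / t) j)//.
      rewrite ler_pdivlMr// ltr_pdivrMr// [_ * t]mulrC [_.+1%:R * t]mulrC.
      by move: h1 h2; rewrite ler_pdivrMr// ltr_pdivlMr// => -> ->.
    move=> /eqP ji; rewrite inE /cell/= in_itv/= /x ji ler_pdivrMr// ltr_pdivlMr//.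
    by move: h; rewrite ler_pdivlMr// ltr_pdivrMr// ![_ * t]mulrC.
  have iN : (i < n.+1)%N.
    rewrite -(ltr_nat R); apply: le_lt_trans (_ : r * n.+1%:R / t < _); first by case/andP: h.
    by rewrite ltr_pdivrMr// mulrC ltr_pM2l.
  rewrite /sf_fun (bigD1 (Ordinal iN))//= big1 ?addr0.
    by rewrite indicE cE eqxx scalar_of1 scale1r.
  move=> j ji; rewrite indicE cE (_ : (val j == i) = false) ?scalar_of0 ?scale0r//.
  by apply/negbTE; apply: contra ji => /eqP ji; apply/eqP/val_inj.
have nd0 n r : 0 <= nd n r by rewrite /nd /x divr_ge0// mulr_ge0// ltW.
have cy : continuous (fun r => rnorm (u r)) by move=> r; apply: cvg_rnorm; exact: cu.
have [M M0 HM] := continuous_bounded t cy.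
(* The exponent [- a] is written [1 - a - 1] to exhibit the integrable kernel of order [1 - a]. *)
apply: (@bochner_dominated _ _ g (fun r => M * (t - r) `^ (1 - a - 1))) => //.
- move=> r; rewrite /= in_itv/= => rt; have /andP[r0 rt'] := rt.
  under eq_fun do rewrite gE//.
  have nr : nd n r @[n --> \oo] --> r.
    apply/cvgrPdist_lt => e e0.
    near=> n; have /andP[h1 h2] := ndP n r rt.
    rewrite ger0_norm ?subr_ge0// ltrBlDl; apply: lt_trans h2 _.
    rewrite ltrD2l ltr_pdivrMr// mulrC -ltr_pdivrMr//.
    apply: (@lt_trans _ _ n%:R); last by rewrite ltr_nat.
    by near: n; exact: nbhs_infty_gtr.
  have fr : f z @[z --> r] --> f r.
    apply: cvgZ; last exact: cu.
    apply: cvg_scalar_of; apply: (@continuous_comp _ _ _ (fun z => t - z) (fun z => z `^ (- a))).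
      by apply: cvgB; [exact: cvg_cst|exact: cvg_id].
    by apply: powR_continuous_pos; rewrite subr_gt0.
  exact: (cvg_comp _ _ nr fr).
- have b0 : 0 < 1 - a by rewrite subr_gt0.
  by have := integrableZl _ M (frac_kernel_integrable t b0); apply.
- move=> n r; rewrite /= in_itv/= => rt; have /andP[r0 rt'] := rt.
  have /andP[h1 h2] := ndP n r rt.
  rewrite gE// rnormZ ger0_norm ?powR_ge0// mulrC; apply: ler_pM => //; rewrite ?rnorm_ge0 ?powR_ge0//.
    apply: le_trans (ler_norm _) _; apply: HM.
    by rewrite ger0_norm//; apply: le_trans h1 (ltW rt').
  have -> : 1 - a - 1 = - a by ring.
  rewrite !powRN lef_pV2 ?posrE ?powR_gt0 ?subr_gt0//; last exact: le_lt_trans h1 _.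
  by rewrite ge0_ler_powR ?nnegrE ?(ltW a0)// ?subr_ge0 ?(ltW rt') ?(le_trans h1 (ltW rt'))// lerD2l lerN2.
Unshelve. all: by end_near. Qed.

End BochnerIntegral.

(** * Difference quotients of the primitive *)

Section FractionalAverage.
Context {R : realType}.
Implicit Types (y : R -> R) (t r v c : R).

(** For distinct nonnegative [t] and [r] this is the mean of [y] between them, so bounds on [y] pass
    to the difference quotient. *)
Definition average y t r : R := (r - t)^-1 * (frac_int 1 y r - frac_int 1 y t).

Lemma average_dist y t r v c : continuous y -> 0 <= t -> 0 <= r -> r != t ->
  (forall x, Num.min t r <= x <= Num.max t r -> `|y x - v| <= c) ->
  `|average y t r - v| <= c.
Proof.
move=> cy t0 r0 rt yv.
have aux (t' s : R) : 0 <= t' -> t' < s -> (forall x, t' <= x <= s -> `|y x - v| <= c) ->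
    `|average y t' s - v| <= c.
  move=> t'0 ts yv'; have st : 0 < s - t' by rewrite subr_gt0.
  rewrite -(ler_pM2r st); apply: le_trans (frac_int1_increment cy t'0 ts yv').
  rewrite -[X in _ * X <= _](gtr0_norm st) -normrM /average le_eqVlt; apply/orP; left; apply/eqP.
  by congr `| _ |; field; rewrite subr_eq0 gt_eqF.
have avC : average y t r = average y r t.
  rewrite /average -[in LHS](opprB t r) -[in LHS](opprB (frac_int 1 y t)).
  by rewrite invrN mulrNN.
have [ltr|ltr|e] := ltgtP t r.
- by apply: aux => // x tx; apply: yv; rewrite (min_idPl _) ?(ltW ltr)// (max_idPr _) ?(ltW ltr).
- by rewrite avC; apply: aux => // x tx; apply: yv; rewrite (min_idPr _) ?(ltW ltr)// (max_idPl _) ?(ltW ltr).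
- by rewrite e eqxx in rt.
Qed.

(** Restricting [r] to [[0, T]] matters at [t = 0]: the primitive vanishes on the negative axis, so
    quotients taken there are not means of [y]. *)
Lemma average_cvg y t T : continuous y -> 0 <= t ->
  average y t r @[r --> within `[0, T] (dnbhs t)] --> y t.
Proof.
move=> cy t0; apply/cvgrPdist_le => e e0.
have /cvgrPdist_le/(_ _ e0)/nbhs_ballP[d /= d0 hd] := cy t.
rewrite near_withinE near_withinE; near=> r; move=> rt.
rewrite /= in_itv/= => /andP[r0 rT]; rewrite distrC.
apply: average_dist => // x /andP[x1 x2]; rewrite distrC; apply: hd.
have : `|t - r| < d by near: r; exact: (nbhsx_ballx t d d0).
rewrite /ball/= ltr_norml => /andP[h1 h2].
rewrite ltr_norml; apply/andP; split.
  by move: x2; have [_|_] := leP t r => x2; lra.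
by move: x1; have [_|_] := leP t r => x1; lra.
Unshelve. all: by end_near. Qed.

End FractionalAverage.

(** * Coefficients of vector-valued fractional integrals *)

Section FractionalCoefficients.
Context {R : realType} {k : scalar_kind}.
Variable H : completeNormedModType (scalar_field R k).
Variable ip : {dot H for @scalar_conj R k}.
Hypothesis ip_norm : inner_product_norm ip.
Local Notation sc := (@scalar_of R k).
Local Notation rip := (rip ip).

Lemma frac_int_exists a (u : R -> H) t : 0 < a < 1 -> continuous u ->
  exists J, is_frac_int a u t J.
Proof.
move=> /andP[a0 a1] cu; have [I HI] := bochner_frac_exists ip_norm t a0 a1 cu.
by exists (sc (Gamma (1 - a))^-1 *: I), I.
Qed.

(** Agreement with a continuous [y] is asked only on [(0, t)], because a solution is controlled only
    on [[0, T]] while the scalar theory uses functions continuous on the line. *)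
Lemma frac_int_rip a (u : R -> H) t J psi (y : R -> R) : 0 < a < 1 -> continuous y ->
  (forall r, 0 < r < t -> rip (u r) psi = y r) -> rnorm psi <= 1 ->
  is_frac_int a u t J -> rip J psi = frac_int (1 - a) y t.
Proof.
move=> /andP[a0 a1] cy uy psi1 [I HI ->]; rewrite ripZl frac_intE; congr (_ * _).
have a1' : 0 < 1 - a by rewrite subr_gt0.
have e : {in `]0, t[%classic, (fun r => rip (sc ((t - r) `^ (- a)) *: u r) psi) =1
    (fun r => (t - r) `^ (1 - a - 1) * y r)}.
  move=> r; rewrite inE/= in_itv/= => rt; rewrite ripZl uy//.
  by have -> : 1 - a - 1 = - a by ring.
rewrite -(bochner_rip ip_norm (measurable_itv _) HI psi1).
  exact: eq_Rintegral.
have := frac_integrable t a1' cy; apply: eq_integrable => //.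
by move=> r rt; rewrite /= e.
Qed.

(* Testing against all [c *: x] recovers a complex coefficient from its real parts. *)
Lemma ip_from_rip (u v x : H) (m : R) :
  (forall c, scalar_abs c <= 1 -> rip u (c *: x) = m * rip v (c *: x)) ->
  ip u x = sc m * ip v x.
Proof.
move=> h; apply/eqP; rewrite -subr_eq0 -ipZl -ipNl -ipDl.
set w := u - sc m *: v.
pose n := scalar_abs (ip w x); have n0 : 0 <= n := scalar_abs_ge0 _.
have n1 : 0 < 1 + n by rewrite ltr_wpDr.
(* Testing with this multiple of the coefficient itself yields [n^2 / (1 + n) = 0]; dividing by
   [1 + n] keeps the test factor in the unit ball even when [n = 0]. *)
have c1 : scalar_abs (sc (1 + n)^-1 * ip w x) <= 1.
  rewrite scalar_absM scalar_abs_of ger0_norm ?invr_ge0 ?(ltW n1)//.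
  by rewrite mulrC ler_pdivrMr// mul1r lerDr.
have := h _ c1; move/eqP; rewrite -subr_eq0 -ripZl -ripBl -/w /rip ipZr scalar_conjM.
rewrite scalar_conj_of -mulrA scalar_reZ [X in scalar_re X]mulrC scalar_abs_sqr mulf_eq0.
rewrite invr_eq0 gt_eqF//= expf_eq0/= => /eqP n00.
by rewrite -normr_eq0 -scalar_absE n00 scalar_of0.
Qed.

End FractionalCoefficients.

(** * The solution *)

Section SobolevScale.
Context {R : realType} {k : scalar_kind}.
Variable H : completeNormedModType (scalar_field R k).
Variable ip : {dot H for @scalar_conj R k}.
Hypothesis ip_norm : inner_product_norm ip.
Variables (lam : nat -> R) (phi : nat -> H).
Hypothesis phi_basis : orthonormal_basis ip phi.
Hypothesis lam_gt0 : forall p, 0 < lam p.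
Hypothesis lam_mono : forall p, lam p <= lam p.+1.
Local Notation sc := (@scalar_of R k).
Local Notation Hs := (Hs ip lam phi).
Local Notation Hs_sqnorm := (Hs_sqnorm ip lam phi).
Local Notation Hs_norm := (Hs_norm ip lam phi).
Implicit Types (g : nat -> R) (u v : H) (r s : R).

Lemma lam0_le p : lam 0 <= lam p.
Proof. by elim: p => // p /le_trans; apply; exact: lam_mono. Qed.

Lemma lam_powR_split r s p : lam p `^ r = lam p `^ (r - s) * lam p `^ s.
Proof.
rewrite -powRD; first by rewrite subrK.
by rewrite (gt_eqF (lam_gt0 p)) implybT.
Qed.

(** The smallest eigenvalue may lie below 1, so lowering the exponent costs a power of [lam 0]; this
    is the embedding constant of the scale. *)
Lemma lam_powR_le r s p : r <= s -> lam p `^ r <= lam 0 `^ (r - s) * lam p `^ s.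
Proof.
move=> rs; rewrite (lam_powR_split r s) ler_wpM2r ?powR_ge0// -opprB !powRN lef_pV2 ?posrE ?powR_gt0//.
by rewrite ge0_ler_powR ?nnegrE ?subr_ge0 ?(ltW (lam_gt0 _))// lam0_le.
Qed.

Lemma powR2 (x y : R) : x `^ (2 * y) = (x `^ y) ^+ 2.
Proof. by rewrite mulrC powRrM powR_mulrn ?powR_ge0. Qed.

Lemma Hs_sqnormE r v : Hs_sqnorm r v = wsum ip phi (fun p => lam p `^ (2 * r)) v.
Proof. by []. Qed.

Lemma Hs_sqnorm_ge0 r v : (0 <= Hs_sqnorm r v)%E.
Proof. by apply: wsum_ge0 => p; exact: powR_ge0. Qed.

Lemma Hs_norm_ge0 r v : 0 <= Hs_norm r v.
Proof. exact: sqrtr_ge0. Qed.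

Lemma Hs_norm_sqr r v : Hs_norm r v ^+ 2 = fine (Hs_sqnorm r v).
Proof. by rewrite sqr_sqrtr// fine_ge0// Hs_sqnorm_ge0. Qed.

Lemma Hs_sqnorm_fineK r v : Hs r v -> Hs_sqnorm r v = (Hs_norm r v ^+ 2)%:E.
Proof. by move=> h; rewrite Hs_norm_sqr fineK// ge0_fin_numE ?Hs_sqnorm_ge0. Qed.

Lemma Hs0_sqnorm v : Hs_sqnorm 0 v = (rnorm v ^+ 2)%:E.
Proof.
rewrite -(wsum_parseval ip_norm phi_basis) Hs_sqnormE; apply: eq_wsum => p.
by rewrite mulr0 powRr0.
Qed.

Lemma Hs0 v : Hs 0 v.
Proof. by rewrite /Defs.Hs/= Hs0_sqnorm ltry. Qed.

Lemma Hs0_norm v : Hs_norm 0 v = rnorm v.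
Proof. by rewrite /Defs.Hs_norm Hs0_sqnorm sqrtr_sqr ger0_norm// rnorm_ge0. Qed.

(** The relation that [u] is the function [g] of the operator applied to [v], in coordinates. It
    treats constructed solutions and arbitrary given ones alike, without a question of
    convergence. *)
Definition diag_rel g u v := forall p, ip u (phi p) = sc (g p) * ip v (phi p).

Lemma diag_rel_id v : diag_rel (fun=> 1) v v.
Proof. by move=> p; rewrite scalar_of1 mul1r. Qed.

Lemma diag_relB g g' u u' v : diag_rel g u v -> diag_rel g' u' v ->
  diag_rel (fun p => g p - g' p) (u - u') v.
Proof. by move=> h h' p; rewrite ipDl ipNl h h' scalar_ofB mulrBl. Qed.

Lemma diag_relZ g u v (x : R) : diag_rel g u v -> diag_rel (fun p => x * g p) (sc x *: u) v.
Proof. by move=> h p; rewrite ipZl h scalar_ofM mulrA. Qed.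

Lemma Hs_sqnorm_diag g u v r : diag_rel g u v ->
  Hs_sqnorm r u = wsum ip phi (fun p => lam p `^ (2 * r) * g p ^+ 2) v.
Proof.
by move=> h; rewrite Hs_sqnormE; apply: eq_wsum => p; rewrite (acoefM (h p)) mulrA.
Qed.

Lemma diag_bound_sqr g r s (C : R) p : 0 <= C -> lam p `^ r * `|g p| <= C * lam p `^ s ->
  lam p `^ (2 * r) * g p ^+ 2 <= C ^+ 2 * lam p `^ (2 * s).
Proof.
move=> C0 h; rewrite !powR2 -(real_normK (num_real (g p))) -!exprMn.
by rewrite lerXn2r ?nnegrE ?mulr_ge0 ?powR_ge0.
Qed.

Lemma Hs_diag g u v r s (C : R) : diag_rel g u v -> 0 <= C ->
  (forall p, lam p `^ r * `|g p| <= C * lam p `^ s) -> Hs s v ->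
  Hs r u /\ Hs_norm r u <= C * Hs_norm s v.
Proof.
move=> guv C0 gC vs.
have le2 : (Hs_sqnorm r u <= (C ^+ 2)%:E * Hs_sqnorm s v)%E.
  rewrite (Hs_sqnorm_diag r guv) Hs_sqnormE; apply: wsum_le.
  - move=> p; rewrite mulr_ge0 ?powR_ge0 ?sqr_ge0//=; exact: diag_bound_sqr.
  - by move=> p; exact: powR_ge0.
  - exact: sqr_ge0.
rewrite (Hs_sqnorm_fineK vs) -EFinM -exprMn in le2.
have ur : Hs r u by apply: le_lt_trans le2 (ltry _).
split=> //; rewrite (Hs_sqnorm_fineK ur) lee_fin in le2.
by rewrite -ler_sqr ?nnegrE ?mulr_ge0 ?Hs_norm_ge0.
Qed.

Lemma Hs_le r s v : r <= s -> Hs s v -> Hs r v /\ Hs_norm r v <= lam 0 `^ (r - s) * Hs_norm s v.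
Proof.
move=> rs; apply: Hs_diag (diag_rel_id v) (powR_ge0 _ _) _ => p.
by rewrite normr1 mulr1; exact: lam_powR_le.
Qed.

(** Multiplying the symbol by [lam^(r - s)] makes it bounded by [M] and moves the weight to
    [lam^(2 s)], which is summable against [v]; then [wsum_cvg0] applies. *)
Lemma Hs_diag_cvg0 (T : Type) (F : set_system T) {FF : Filter F} (G : T -> nat -> R)
    (u : T -> H) v r s (M : R) : 0 <= M ->
  (\forall x \near F, diag_rel (G x) (u x) v /\
     forall p, lam p `^ r * `|G x p| <= M * lam p `^ s) ->
  (forall p, G x p @[x --> F] --> (0 : R)) -> Hs s v ->
  Hs_norm r (u x) @[x --> F] --> (0 : R).
Proof.
move=> M0 GM G0 vs.
pose G' x p := lam p `^ (r - s) * G x p.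
have e x : diag_rel (G x) (u x) v ->
    Hs_norm r (u x) = Num.sqrt (fine (wsum ip phi (fun p => lam p `^ (2 * s) * G' x p ^+ 2) v)).
  move=> h; rewrite /Defs.Hs_norm (Hs_sqnorm_diag r h); congr (Num.sqrt (fine _)).
  apply: eq_wsum => p; congr (_ * _); rewrite /G' !powR2 -!exprMn; congr (_ ^+ 2).
  by rewrite (lam_powR_split r s) -mulrA mulrCA.
have W0 : fine (wsum ip phi (fun p => lam p `^ (2 * s) * G' x p ^+ 2) v) @[x --> F] --> (0 : R).
  apply: (wsum_cvg0 (M := M)) => //.
  - by move=> p; exact: powR_ge0.
  - apply: filterS GM => x [_ h] p; rewrite /G' normrM ger0_norm ?powR_ge0//.
    by have := h p; rewrite (lam_powR_split r s) mulrAC ler_pM2r// powR_gt0.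
  - move=> p; have h : lam p `^ (r - s) * G x p @[x --> F] --> lam p `^ (r - s) * 0.
      by apply: cvgMr; exact: G0.
    by move: h; rewrite mulr0.
rewrite -[X in _ --> X]sqrtr0.
have W1 := cvg_comp _ _ W0 (@sqrt_continuous R 0); apply: cvg_trans W1.
by apply: near_eq_cvg; apply: filterS GM => x [h _]; rewrite /= e.
Qed.

Lemma rnorm_diag_cvg0 (T : Type) (F : set_system T) {FF : Filter F} (G : T -> nat -> R)
    (u : T -> H) v s (M : R) : 0 <= M ->
  (\forall x \near F, diag_rel (G x) (u x) v /\ forall p, `|G x p| <= M * lam p `^ s) ->
  (forall p, G x p @[x --> F] --> (0 : R)) -> Hs s v ->
  rnorm (u x) @[x --> F] --> (0 : R).
Proof.
move=> M0 GM G0 vs; under eq_fun do rewrite -Hs0_norm.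
apply: Hs_diag_cvg0 M0 _ G0 vs; apply: filterS GM => x [h1 h2]; split=> // p.
by rewrite powRr0 mul1r.
Qed.

Lemma Hs_norm_sqrD r u v : Hs r u -> Hs r v ->
  Hs r (u + v) /\ Hs_norm r (u + v) ^+ 2 <= 2 * Hs_norm r u ^+ 2 + 2 * Hs_norm r v ^+ 2.
Proof.
move=> hu hv.
have le2 : (Hs_sqnorm r (u + v)%R <= 2%:E * Hs_sqnorm r u + 2%:E * Hs_sqnorm r v)%E.
  rewrite !Hs_sqnormE /wsum -!nneseriesZl; last 2 first.
  - by move=> p _; rewrite lee_fin mulr_ge0 ?powR_ge0 ?sqr_ge0.
  - by move=> p _; rewrite lee_fin mulr_ge0 ?powR_ge0 ?sqr_ge0.
  rewrite -nneseriesD; last 2 first.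
  - by move=> p _ _; rewrite -EFinM lee_fin mulr_ge0// mulr_ge0 ?powR_ge0 ?sqr_ge0.
  - by move=> p _ _; rewrite -EFinM lee_fin mulr_ge0// mulr_ge0 ?powR_ge0 ?sqr_ge0.
  apply: lee_nneseries => [p _ _|p _].
    by rewrite lee_fin mulr_ge0 ?powR_ge0 ?sqr_ge0.
  rewrite -!EFinM -EFinD lee_fin !(mulrCA 2) -mulrDr ler_wpM2l ?powR_ge0//.
  apply: (@le_trans _ _ ((acoef ip phi p u + acoef ip phi p v) ^+ 2)).
    rewrite lerXn2r ?nnegrE ?addr_ge0 ?acoef_ge0//.
    by rewrite /acoef ipDl scalar_abs_triangle.
  by move: (acoef _ _ _ u) (acoef _ _ _ v) => x y; have := sqr_ge0 (x - y); nra.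
rewrite (Hs_sqnorm_fineK hu) (Hs_sqnorm_fineK hv) -!EFinM -EFinD in le2.
have huv : Hs r (u + v) by apply: le_lt_trans le2 (ltry _).
by split=> //; rewrite (Hs_sqnorm_fineK huv) lee_fin in le2.
Qed.

Lemma op_power_diag b v : Hs b v -> diag_rel (fun p => lam p `^ b) (op_power ip lam phi b v) v.
Proof.
move=> h; apply: (multiplierP ip_norm phi_basis _).2.
by rewrite (_ : wsum _ _ _ _ = Hs_sqnorm b v)//; apply: eq_wsum => p; rewrite powR2.
Qed.

Lemma diag_rel_inj g u u' v : diag_rel g u v -> diag_rel g u' v -> u = u'.
Proof. by move=> h h'; apply: (coef_ext phi_basis) => p; rewrite h h'. Qed.

Lemma multiplier_diag g v s (C : R) : 0 <= C -> (forall p, `|g p| <= C * lam p `^ s) -> Hs s v ->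
  series (fun p => (sc (g p) * ip v (phi p)) *: phi p) @ \oo --> multiplier ip phi g v /\
  diag_rel g (multiplier ip phi g v) v.
Proof.
move=> C0 gC vs; apply: (multiplierP ip_norm phi_basis).
apply: (wsum_fin (w' := fun p => lam p `^ (2 * s)) (C := C ^+ 2)) vs; last exact: sqr_ge0.
  move=> p; rewrite sqr_ge0/=.
  have := @diag_bound_sqr g 0 s C p C0; rewrite mulr0 !powRr0 !mul1r; exact.
by move=> p; exact: powR_ge0.
Qed.

End SobolevScale.

(** * The Mittag-Leffler solution and its regularity *)

Section Solution.
Context {R : realType} {k : scalar_kind}.
Variable H : completeNormedModType (scalar_field R k).
Variable ip : {dot H for @scalar_conj R k}.
Hypothesis ip_norm : inner_product_norm ip.
Variables (lam : nat -> R) (phi : nat -> H).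
Hypothesis phi_basis : orthonormal_basis ip phi.
Hypothesis lam_gt0 : forall p, 0 < lam p.
Hypothesis lam_mono : forall p, lam p <= lam p.+1.
Local Notation sc := (@scalar_of R k).
Local Notation Hs := (Hs ip lam phi).
Local Notation Hs_norm := (Hs_norm ip lam phi).
Local Notation diag_rel := (diag_rel ip phi).
Local Notation op_power := (op_power ip lam phi).
Implicit Types (a b s t T : R) (theta : H).

Let lamX_ge0 b p : 0 <= lam p `^ b := powR_ge0 _ _.

Lemma mlf_norm_le1 a m t : 0 < a < 1 -> 0 <= m -> `|mlf a m t| <= 1.
Proof. by move=> a01 m0; rewrite ger0_norm ?mlf_le1// ltW// mlf_gt0. Qed.

(** Monotonicity in time extends the decay bound at [d] to all later times. This uniformity is what
    dominated convergence needs near a positive time. *)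
Lemma mlf_decay_from a m d t : 0 < a < 1 -> 0 <= m -> 0 < d -> d <= t ->
  m * mlf a m t <= 2 * d `^ (- a).
Proof.
move=> a01 m0 d0 dt; apply: (@le_trans _ _ (m * mlf a m d)).
  by rewrite ler_wpM2l// mlf_nonincreasing.
rewrite powRN ler_pdivlMr ?powR_gt0// mulrAC.
by apply: mlf_decay => //; exact: ltW.
Qed.

Lemma norm_scaled_mlf_le a m d t : 0 < a < 1 -> 0 <= m -> 0 < d -> d <= t ->
  `|- (m * mlf a m t)| <= 2 * d `^ (- a).
Proof.
move=> a01 m0 d0 dt; rewrite normrN ger0_norm ?mlf_decay_from// mulr_ge0//.
by rewrite ltW// mlf_gt0.
Qed.

Definition mlf_sol a b theta t : H :=
  multiplier ip phi (fun p => mlf a (lam p `^ b) t) theta.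

(** The candidate for the Caputo derivative, read off from the equation as the negative of the
    operator power applied to [mlf_sol]. *)
Definition mlf_der a b theta t : H :=
  multiplier ip phi (fun p => - (lam p `^ b * mlf a (lam p `^ b) t)) theta.

Lemma mlf_solP a b theta t : 0 < a < 1 ->
  series (fun p => (sc (mlf a (lam p `^ b) t) * ip theta (phi p)) *: phi p) @ \oo
    --> mlf_sol a b theta t /\
  diag_rel (fun p => mlf a (lam p `^ b) t) (mlf_sol a b theta t) theta.
Proof.
move=> a01; apply: (multiplier_diag (lam := lam) (s := 0) ip_norm phi_basis ler01) => [p|].
  by rewrite powRr0 mulr1 mlf_norm_le1.
exact: Hs0.
Qed.

Lemma mlf_der_rel a b theta t : 0 < a < 1 -> 0 < t ->
  diag_rel (fun p => - (lam p `^ b * mlf a (lam p `^ b) t)) (mlf_der a b theta t) theta.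
Proof.
move=> a01 t0; have C0 : 0 <= 2 * t `^ (- a) by rewrite mulr_ge0 ?powR_ge0.
apply: (multiplier_diag (lam := lam) (s := 0) ip_norm phi_basis C0 _ _).2 => [p|].
  by rewrite powRr0 mulr1 norm_scaled_mlf_le.
exact: Hs0.
Qed.

(** At [t = 0] the decay is void, so the growth of [lam^b] is compensated by the smoothness of the
    datum instead. *)
Lemma mlf_der_rel_smooth a b s theta t : 0 < a < 1 -> b <= s -> Hs s theta ->
  diag_rel (fun p => - (lam p `^ b * mlf a (lam p `^ b) t)) (mlf_der a b theta t) theta.
Proof.
move=> a01 bs ths; have C0 : 0 <= lam 0 `^ (b - s) := powR_ge0 _ _.
apply: (multiplier_diag (s := s) ip_norm phi_basis C0 _ ths).2 => p.
rewrite normrN normrM (ger0_norm (lamX_ge0 _ _)).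
apply: le_trans (lam_powR_le lam_gt0 lam_mono p bs).
by rewrite -[leRHS]mulr1 ler_wpM2l// mlf_norm_le1.
Qed.

Lemma mlf_sol_dist_cvg0 a b s theta t (F : set_system R) {FF : Filter F} : 0 < a < 1 ->
  F --> t -> Hs s theta ->
  Hs_norm s (mlf_sol a b theta r - mlf_sol a b theta t) @[r --> F] --> (0 : R).
Proof.
move=> a01 Ft ths; have /andP[a0 a1] := a01.
apply: (Hs_diag_cvg0 lam_gt0 (v := theta) (s := s) (M := 2)
   (G := fun r p => mlf a (lam p `^ b) r - mlf a (lam p `^ b) t)) => //.
- apply: nearW => r; split.
    by apply: diag_relB; [exact: (mlf_solP _ _ _ _).2|exact: (mlf_solP _ _ _ _).2].
  move=> p; rewrite mulrC ler_wpM2r//; apply: le_trans (ler_normB _ _) _.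
  by apply: lerD; exact: mlf_norm_le1.
- move=> p; have h : mlf a (lam p `^ b) r - mlf a (lam p `^ b) t @[r --> F] -->
     mlf a (lam p `^ b) t - mlf a (lam p `^ b) t.
    apply: cvgB; last exact: cvg_cst.
    by apply: (cvg_comp _ _ Ft); exact: continuous_mlf.
  by move: h; rewrite subrr.
Qed.

Lemma continuous_mlf_sol a b theta : 0 < a < 1 -> continuous (mlf_sol a b theta).
Proof.
move=> a01 t; apply/cvg_rnormP; under eq_fun do rewrite -(Hs0_norm ip_norm lam phi_basis).
apply: mlf_sol_dist_cvg0 => //; exact: Hs0.
Qed.

Lemma mlf_sol0 a b theta : 0 < a < 1 -> mlf_sol a b theta 0 = theta.
Proof.
move=> a01; have /andP[a0 _] := a01; apply: (coef_ext phi_basis) => p.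
by rewrite (mlf_solP _ _ _ a01).2 mlf_le0// scalar_of1 mul1r.
Qed.

(** Each coefficient of the vector integral is a scalar fractional integral, to which [mlf_caputo]
    applies. *)
Lemma mlf_sol_frac_int a b theta r J : 0 < a < 1 ->
  is_frac_int a (fun t => mlf_sol a b theta t - mlf_sol a b theta 0) r J ->
  diag_rel (fun p => - (lam p `^ b * frac_int 1 (mlf a (lam p `^ b)) r)) J theta.
Proof.
move=> a01 HJ p; have /andP[a0 a1] := a01.
apply: ip_from_rip => c c1.
have cm : continuous (mlf a (lam p `^ b)) by exact: continuous_mlf.
have cm1 : continuous (fun t => mlf a (lam p `^ b) t - 1).
  by move=> x; apply: cvgB; [exact: cm|exact: cvg_cst].
pose x := rip ip theta (c *: phi p).
have cy : continuous (fun t => x * (mlf a (lam p `^ b) t - 1)).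
  by move=> z; apply: cvgMr; exact: cm1.
have c1' : rnorm (c *: phi p) <= 1 by rewrite (rnorm_phiZ ip_norm phi_basis).
rewrite (frac_int_rip ip_norm a01 cy _ c1' HJ).
  rewrite frac_intZ ?subr_gt0// (mlf_caputo _ _ a01) -/x mulrC; congr (_ * _).
  by rewrite mulNr.
move=> t _; rewrite ripBl mulrBr mulr1 mlf_sol0//; congr (_ - _).
by rewrite /rip !ipZr (mlf_solP _ _ _ a01).2 mulrCA scalar_reZ mulrC /x /rip ipZr.
Qed.

(** The coefficient of the difference quotient minus [d] is [- lam^b] times the error of an average
    of the Mittag-Leffler function, and it tends to 0 for each [p]. Only the domination differs
    between the uses: decay at positive times, smoothness of the datum up to time 0. *)
Lemma mlf_sol_caputo_gen a b s T theta t d (M : R) : 0 < a < 1 -> 0 <= t -> 0 <= M -> Hs s theta ->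
  diag_rel (fun p => - (lam p `^ b * mlf a (lam p `^ b) t)) d theta ->
  (\forall r \near within `[0, T] (dnbhs t), forall p,
     lam p `^ b * `|average (mlf a (lam p `^ b)) t r - mlf a (lam p `^ b) t| <= M * lam p `^ s) ->
  is_caputo a T (mlf_sol a b theta) t d.
Proof.
move=> a01 t0 M0 ths dth bnd; have /andP[a0 a1] := a01.
have cu : continuous (fun r => mlf_sol a b theta r - mlf_sol a b theta 0).
  by move=> r; apply: cvgB; [exact: continuous_mlf_sol|exact: cvg_cst].
have [J HJ] := choice (fun r => frac_int_exists ip_norm r a01 cu).
exists J; split=> [r _|]; first exact: HJ.
apply/cvg_rnormP.
apply: (rnorm_diag_cvg0 ip_norm phi_basis lam_gt0 (v := theta) (s := s) (M := M)
   (G := fun r p => (r - t)^-1 * (- (lam p `^ b * frac_int 1 (mlf a (lam p `^ b)) r) -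
      - (lam p `^ b * frac_int 1 (mlf a (lam p `^ b)) t)) -
      - (lam p `^ b * mlf a (lam p `^ b) t))) => //.
- apply: filterS bnd => r h; split.
    apply: diag_relB => //; apply: diag_relZ; apply: diag_relB; exact: mlf_sol_frac_int.
  move=> p; apply: le_trans (h p); rewrite -[X in _ <= X * _](ger0_norm (lamX_ge0 b p)) -normrM.
  by rewrite le_eqVlt -normrN; apply/orP; left; apply/eqP; congr `| _ |; rewrite /average; ring.
- move=> p; pose m := lam p `^ b.
  have h : - m * (average (mlf a m) t r - mlf a m t) @[r --> within `[0, T] (dnbhs t)] -->
      - m * (mlf a m t - mlf a m t).
    apply: cvgMr; apply: cvgB; last exact: cvg_cst.
    by apply: average_cvg => //; exact: continuous_mlf.
  move: h; rewrite subrr mulr0; apply: cvg_trans; apply: near_eq_cvg; apply: nearW => r.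
  by rewrite /average /m; ring.
Qed.

Lemma mlf_sol_caputo a b T theta t : 0 < a < 1 -> 0 < t ->
  is_caputo a T (mlf_sol a b theta) t (mlf_der a b theta t).
Proof.
move=> a01 t0; have /andP[a0 a1] := a01; have t20 : 0 < t / 2 by rewrite divr_gt0.
(* For [r > t / 2] the averages see only times beyond [t / 2], where [lam^b] times the
   Mittag-Leffler function is at most [K]. *)
pose K := 2 * (t / 2) `^ (- a); have K0 : 0 <= K by rewrite mulr_ge0 ?powR_ge0.
apply: (@mlf_sol_caputo_gen a b 0 T theta t _ (K + K)) => //.
- exact: ltW.
- by rewrite addr_ge0.
- exact: Hs0.
- exact: mlf_der_rel.
rewrite near_withinE near_withinE; near=> r; move=> rt.
rewrite /= in_itv/= => /andP[r0 rT] p; rewrite powRr0 mulr1.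
have r2 : t / 2 < r.
  have : `|t - r| < t / 2 by near: r; exact: (nbhsx_ballx t (t / 2) t20).
  by rewrite ltr_norml => /andP[_]; lra.
set m := lam p `^ b; have m0 : 0 < m by exact: powR_gt0.
rewrite mulrC -ler_pdivlMr//; apply: average_dist => //.
- exact: continuous_mlf.
- exact: ltW.
move=> x /andP[x1 _]; rewrite ler_pdivlMr// mulrC -{1}(gtr0_norm m0) -normrM mulrBr.
have x2 : t / 2 <= x.
  by apply: le_trans x1; rewrite le_min (ltW r2) andbT ler_pdivrMr// mulr_natr mulr2n lerDl ltW.
apply: le_trans (ler_normB _ _) _; rewrite -normrN -[X in _ + X]normrN.
apply: lerD; apply: norm_scaled_mlf_le => //; try exact: ltW.
by rewrite ler_pdivrMr// mulr_natr mulr2n lerDl ltW.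
Unshelve. all: by end_near. Qed.

Lemma mlf_sol_caputo_smooth a b s T theta t : 0 < a < 1 -> 0 <= t -> b <= s -> Hs s theta ->
  is_caputo a T (mlf_sol a b theta) t (mlf_der a b theta t).
Proof.
move=> a01 t0 bs ths; have /andP[a0 a1] := a01.
have C0 : 0 <= lam 0 `^ (b - s) := powR_ge0 _ _.
apply: (@mlf_sol_caputo_gen a b s T theta t _ (2 * lam 0 `^ (b - s))) => //.
- by rewrite mulr_ge0.
- exact: mlf_der_rel_smooth bs ths.
rewrite near_withinE near_withinE; apply: nearW => r rt.
rewrite /= in_itv/= => /andP[r0 rT] p.
apply: (@le_trans _ _ (lam p `^ b * 2)).
  rewrite ler_wpM2l//; apply: average_dist => //; first exact: continuous_mlf.
  by move=> x _; apply: le_trans (ler_normB _ _) _; apply: lerD; exact: mlf_norm_le1.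
by rewrite mulrC -mulrA ler_wpM2l// lam_powR_le.
Qed.

(** Shared by the solution in [H^(b + s)] and its derivative in [H^s], whose symbols obey the same
    decay. The weight [t^a] cancels the singularity, and having [d <= t] in the bound gives
    domination near each positive time. *)
Lemma decaying_in_Ca a r s T theta (G : R -> nat -> R) (u : R -> H) : 0 < a ->
  Hs s theta -> (forall t, 0 < t -> diag_rel (G t) (u t) theta) ->
  (forall p, continuous (G ^~ p)) ->
  (forall d t p, 0 < d -> d <= t -> lam p `^ r * `|G t p| <= 2 * d `^ (- a) * lam p `^ s) ->
  in_Ca (Hs r) (Hs_norm r) a T u /\
  (norm_Ca (Hs_norm r) a T u <= (2 * Hs_norm s theta)%:E)%E.
Proof.
move=> a0 ths uG cG bnd.
have C0 t : 0 <= 2 * t `^ (- a) by rewrite mulr_ge0 ?powR_ge0.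
have ut t : 0 < t -> Hs r (u t) /\ Hs_norm r (u t) <= 2 * t `^ (- a) * Hs_norm s theta.
  by move=> t0; apply: Hs_diag (uG t t0) (C0 t) _ ths => p; exact: bnd.
have nb : (norm_Ca (Hs_norm r) a T u <= (2 * Hs_norm s theta)%:E)%E.
  apply: ge_ereal_sup => _ [t /= + <-]; rewrite in_itv/= => /andP[t0 _].
  rewrite lee_fin; apply: (@le_trans _ _ (t `^ a * (2 * t `^ (- a) * Hs_norm s theta))).
    by rewrite ler_wpM2l ?powR_ge0//; case: (ut t t0).
  rewrite powRN le_eqVlt; apply/orP; left; apply/eqP; field.
  by rewrite gt_eqF// powR_gt0.
split=> //; split; last by apply: le_lt_trans nb _; rewrite ltry.
split=> t; rewrite /= in_itv/= => /andP[t0 tT]; first by case: (ut t t0).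
have t20 : 0 < t / 2 by rewrite divr_gt0.
pose K := 2 * (t / 2) `^ (- a).
apply: (Hs_diag_cvg0 lam_gt0 (v := theta) (s := s) (M := K + K)
   (G := fun x p => G x p - G t p)) => //.
- by rewrite addr_ge0 ?C0.
- rewrite near_withinE; near=> x; rewrite /= in_itv/= => /andP[x0 xT]; split.
    by apply: diag_relB; exact: uG.
  have x2 : t / 2 < x.
    have : `|t - x| < t / 2 by near: x; exact: (nbhsx_ballx t (t / 2) t20).
    by rewrite ltr_norml => /andP[_]; lra.
  move=> p; apply: (@le_trans _ _ (lam p `^ r * (`|G x p| + `|G t p|))).
    by rewrite ler_wpM2l// ler_normB.
  rewrite mulrDr mulrDl; apply: lerD; apply: bnd => //; first exact: ltW.
  by rewrite ler_pdivrMr// mulr_natr mulr2n lerDl ltW.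
- move=> p; rewrite -[X in _ --> X](subrr (G t p)); apply: cvgB; last exact: cvg_cst.
  by apply: cvg_within_filter; exact: cG.
Unshelve. all: by end_near. Qed.

Lemma mlf_sol_in_C a b s T theta : 0 < a < 1 -> Hs s theta ->
  in_C (Hs s) (Hs_norm s) T (mlf_sol a b theta) /\
  (norm_C (Hs_norm s) T (mlf_sol a b theta) <= (Hs_norm s theta)%:E)%E.
Proof.
move=> a01 ths.
have ut t : Hs s (mlf_sol a b theta t) /\ Hs_norm s (mlf_sol a b theta t) <= 1 * Hs_norm s theta.
  apply: Hs_diag (mlf_solP b theta t a01).2 ler01 _ ths => p.
  by rewrite mulrC ler_wpM2r// mlf_norm_le1.
split; last first.
  by apply: ge_ereal_sup => _ [t /= _ <-]; rewrite lee_fin -[leRHS]mul1r; case: (ut t).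
split=> t _; first by case: (ut t).
by apply: mlf_sol_dist_cvg0 => //; exact: cvg_within.
Qed.

Lemma mlf_sol_in_Ca a b s T theta : 0 < a < 1 -> Hs s theta ->
  in_Ca (Hs (b + s)) (Hs_norm (b + s)) a T (mlf_sol a b theta) /\
  (norm_Ca (Hs_norm (b + s)) a T (mlf_sol a b theta) <= (2 * Hs_norm s theta)%:E)%E.
Proof.
move=> a01 ths; have /andP[a0 _] := a01.
apply: (decaying_in_Ca _ a0 ths (fun t _ => (mlf_solP b theta t a01).2)).
  by move=> p t; exact: continuous_mlf.
move=> d t p d0 dt; rewrite (lam_powR_split lam_gt0 _ s) addrK mulrAC ler_wpM2r//.
have := norm_scaled_mlf_le a01 (lamX_ge0 b p) d0 dt.
by rewrite normrN normrM (ger0_norm (lamX_ge0 _ _)).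
Qed.

Lemma mlf_der_in_Ca a b s T theta : 0 < a < 1 -> Hs s theta ->
  in_Ca (Hs s) (Hs_norm s) a T (mlf_der a b theta) /\
  (norm_Ca (Hs_norm s) a T (mlf_der a b theta) <= (2 * Hs_norm s theta)%:E)%E.
Proof.
move=> a01 ths; have /andP[a0 _] := a01.
apply: (@decaying_in_Ca a s s T theta
  (fun t p => - (lam p `^ b * mlf a (lam p `^ b) t)) _ a0 ths).
- by move=> t t0; exact: mlf_der_rel.
- by move=> p t; apply: cvgN; apply: cvgMr; exact: continuous_mlf.
- move=> d t p d0 dt; rewrite mulrC ler_wpM2r//; exact: norm_scaled_mlf_le.
Qed.

(** The factor [lam^b] of the symbol consumes exactly the smoothness given up, so the bound by 1
    suffices and time 0 is included. *)
Lemma mlf_der_in_C a b s T theta : 0 < a < 1 -> b <= s -> Hs s theta ->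
  in_C (Hs (s - b)) (Hs_norm (s - b)) T (mlf_der a b theta) /\
  (norm_C (Hs_norm (s - b)) T (mlf_der a b theta) <= (Hs_norm s theta)%:E)%E.
Proof.
move=> a01 bs ths; have /andP[a0 _] := a01.
have rel t := mlf_der_rel_smooth t a01 bs ths.
have split_s p : lam p `^ (s - b) * lam p `^ b = lam p `^ s.
  by rewrite -(lam_powR_split lam_gt0).
have ut t : Hs (s - b) (mlf_der a b theta t) /\
    Hs_norm (s - b) (mlf_der a b theta t) <= 1 * Hs_norm s theta.
  apply: Hs_diag (rel t) ler01 _ ths => p.
  rewrite normrN normrM (ger0_norm (lamX_ge0 _ _)) mulrA split_s mul1r.
  by rewrite -[leRHS]mulr1 ler_wpM2l// mlf_norm_le1.
split; last first.
  by apply: ge_ereal_sup => _ [t /= _ <-]; rewrite lee_fin -[leRHS]mul1r; case: (ut t).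
split=> t _; first by case: (ut t).
apply: (Hs_diag_cvg0 lam_gt0 (v := theta) (s := s) (M := 2)
   (G := fun r p => - (lam p `^ b * mlf a (lam p `^ b) r) - - (lam p `^ b * mlf a (lam p `^ b) t))) => //.
- apply: nearW => r; split; first by apply: diag_relB.
  move=> p; rewrite -opprD normrN -mulrN -mulrDr normrM (ger0_norm (lamX_ge0 _ _)) mulrA split_s.
  rewrite mulrC ler_wpM2r//; apply: le_trans (ler_normB _ _) _.
  by apply: lerD; exact: mlf_norm_le1.
- move=> p; set g := fun r => - (lam p `^ b * mlf a (lam p `^ b) r).
  rewrite -[X in _ --> X](subrr (g t)); apply: cvgB; last exact: cvg_cst.
  apply: cvg_within_filter; apply: cvgN; apply: cvgMr; exact: continuous_mlf.
Qed.

Lemma mlf_sol_solves a b T theta : 0 < a < 1 ->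
  solves ip lam phi a b T theta (mlf_sol a b theta).
Proof.
move=> a01; split=> [|t]; first exact: mlf_sol0.
rewrite in_itv/= => /andP[t0 tT].
have vb : Hs b (mlf_sol a b theta t).
  (* Taken with smoothness 0 and on [(0, t]]: after a positive time a datum in [H] already yields a
     value in the domain of the operator power. *)
  have [[[vC _] _] _] := mlf_sol_in_Ca b t a01 (Hs0 ip_norm lam phi_basis theta).
  by have := vC t; rewrite addr0; apply; rewrite /= in_itv/= t0 lexx.
split=> //; exists (mlf_der a b theta t); first exact: mlf_sol_caputo.
apply: (coef_ext phi_basis) => p.
rewrite ipDl (mlf_der_rel b theta a01 t0) (op_power_diag ip_norm phi_basis vb) (mlf_solP _ _ _ a01).2.
by rewrite ip0l mulrA -scalar_ofM scalar_ofN mulNr addrC subrr.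
Qed.

Lemma mlf_sol_regular a b s T theta : 0 < a < 1 -> Hs s theta ->
  regular_solution_with ip lam phi s a b T theta (mlf_sol a b theta) (mlf_der a b theta).
Proof.
move=> a01 ths; split.
- exact: mlf_sol_solves.
- by case: (mlf_sol_in_C b T a01 ths).
- by case: (mlf_sol_in_Ca b T a01 ths).
- by move=> t; rewrite in_itv/= => /andP[t0 _]; exact: mlf_sol_caputo.
- by case: (mlf_der_in_Ca b T a01 ths).
Qed.

End Solution.

(** * Uniqueness of regular solutions *)

Section Uniqueness.
Context {R : realType} {k : scalar_kind}.
Variable H : completeNormedModType (scalar_field R k).
Variable ip : {dot H for @scalar_conj R k}.
Hypothesis ip_norm : inner_product_norm ip.
Variables (lam : nat -> R) (phi : nat -> H).
Hypothesis phi_basis : orthonormal_basis ip phi.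
Hypothesis lam_gt0 : forall p, 0 < lam p.
Hypothesis lam_mono : forall p, lam p <= lam p.+1.
Local Notation sc := (@scalar_of R k).
Local Notation rip := (rip ip).
Local Notation Hs := (Hs ip lam phi).
Local Notation Hs_norm := (Hs_norm ip lam phi).
Local Notation diag_rel := (diag_rel ip phi).
Implicit Types (a b s t T : R) (theta : H).

(** At an interior point the restriction to [[0, T]] disappears once the increment is smaller than
    [t] and [T - t]. *)
Lemma is_derive0_within (f : R -> R) T t : 0 < t < T ->
  (r - t)^-1 * (f r - f t) @[r --> within `[0, T] (dnbhs t)] --> (0 : R) ->
  is_derive t 1 f 0.
Proof.
move=> /andP[t0 tT] fl.
have fl' : h^-1 *: ((f \o shift t) (h *: (1 : R)) - f t) @[h --> (0 : R)^'] --> (0 : R).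
  apply/cvgrPdist_lt => e e0.
  have /cvgrPdist_lt/(_ _ e0) := fl; rewrite near_withinE near_withinE => /nbhs_ballP[d /= d0 hd].
  rewrite near_withinE; near=> h; move=> h0.
  have hh : `|0 - h| < Num.min d (Num.min t (T - t)).
    near: h; apply: (nbhsx_ballx (0 : R)).
    by rewrite !lt_min d0 t0 subr_gt0.
  move: hh; rewrite sub0r normrN !lt_min => /and3P[hd' ht hT].
  have := hd (h + t); rewrite /ball/= in_itv/= addrK.
  have -> : (h%:A + t : R) = h + t by rewrite /GRing.scale/= mulr1.
  apply.
  - by rewrite opprD addrCA subrr addr0 normrN.
  - by rewrite -subr_eq0 addrK.
  - move: ht hT; rewrite !ltr_norml => /andP[h1 h2] /andP[h3 h4].
    by apply/andP; split; lra.
apply: DeriveDef; first by apply/cvg_ex; exists 0.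
exact: cvg_lim fl'.
Unshelve. all: by end_near. Qed.

Lemma cst_of_within_derive0 (f : R -> R) T t : continuous f -> 0 <= t <= T ->
  (forall x, 0 < x < T ->
    (r - x)^-1 * (f r - f x) @[r --> within `[0, T] (dnbhs x)] --> (0 : R)) ->
  f t = f 0.
Proof.
move=> cf /andP[t0 tT] df; move: t0; rewrite le_eqVlt => /predU1P[<-//|t0].
apply/eqP; rewrite -subr_eq0; apply/eqP.
have [x||c _ ->] := @MVT R f (cst 0) 0 t t0.
- rewrite in_itv/= => /andP[x0 xt]; apply: (@is_derive0_within _ T).
    by rewrite x0 (lt_le_trans xt tT).
  by apply: df; rewrite x0 (lt_le_trans xt tT).
- exact: continuous_subspaceT.
- by rewrite mul0r.
Qed.

(** Freezes a function on [[0, T]] at its end values; the map is 1-Lipschitz, so the extension to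
    the line stays continuous. *)
Definition clamp T t : R := Num.min T (Num.max 0 t).

Lemma clamp_itv T t : 0 <= T -> clamp T t \in `[0, T].
Proof. by move=> T0; rewrite in_itv/= /clamp le_min T0 le_max lexx ge_min lexx. Qed.

Lemma clamp_id T t : 0 <= t <= T -> clamp T t = t.
Proof. by move=> /andP[t0 tT]; rewrite /clamp (max_idPr t0) (min_idPr tT). Qed.

Lemma clamp_dist T s t : 0 <= T -> `|clamp T s - clamp T t| <= `|s - t|.
Proof.
move=> T0; have := ler_norm (s - t); have := ler_norm (t - s); rewrite distrC ler_norml /clamp.
have [?|?] := leP 0 s; have [?|?] := leP 0 t; have [?|?] := leP T s; have [?|?] := leP T t;
  have [?|?] := leP T 0; lra.
Qed.

Lemma continuous_clamp T (u : R -> H) : 0 <= T ->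
  (forall t, t \in `[0, T] -> rnorm (u r - u t) @[r --> within `[0, T] (nbhs t)] --> (0 : R)) ->
  continuous (fun t => u (clamp T t)).
Proof.
move=> T0 cu t; apply/cvg_rnormP/cvgrPdist_lt => e e0.
have /cvgrPdist_lt/(_ _ e0) := cu _ (clamp_itv t T0).
rewrite near_withinE => /nbhs_ballP[d /= d0 hd]; apply/nbhs_ballP; exists d => //= x tx.
apply: hd; last exact: clamp_itv.
by apply: le_lt_trans tx; exact: clamp_dist.
Qed.

Lemma cvg_rip (T : Type) (F : set_system T) {FF : Filter F} (f : T -> H) (l psi : H) :
  f @ F --> l -> rip (f x) psi @[x --> F] --> rip l psi.
Proof.
move=> /cvg_rnormP fl.
have h : rnorm (f x - l) * rnorm psi @[x --> F] --> 0 * rnorm psi by apply: cvgMl.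
rewrite mul0r in h; apply/cvgrPdist_le => e e0.
have /cvgrPdist_le/(_ _ e0) := h; apply: filterS => x.
rewrite sub0r normrN ger0_norm ?mulr_ge0 ?rnorm_ge0//; apply: le_trans.
by rewrite -ripBl rnorm_distC rip_le.
Qed.

Lemma HsB r (u v : H) : Hs r u -> Hs r v -> Hs r (u - v).
Proof.
move=> hu hv; apply: (proj1 (Hs_norm_sqrD (k := k) hu _)).
have hN : diag_rel (fun=> -1) (- v) v.
  by move=> p; rewrite scalar_ofN scalar_of1 mulN1r ipNl.
apply: (proj1 (Hs_diag hN ler01 _ hv)) => p.
by rewrite normrN normr1 mulrC.
Qed.

(** Testing the vector equation against multiples of an eigenvector gives the scalar Caputo equation
    in integrated form; subtracting the Mittag-Leffler solution leaves a function to which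
    [caputo_unique] applies. *)
Lemma regular_solution_diag a b s T theta u : 0 < a < 1 -> 0 < T -> 0 <= s ->
  regular_solution ip lam phi s a b T theta u ->
  forall t, t \in `[0, T] -> diag_rel (fun p => mlf a (lam p `^ b) t) (u t) theta.
Proof.
move=> a01 T0 s0 [w [[u0 usol] [uH uC] _ _ _]] t; rewrite in_itv/= => tT p.
have /andP[a0 a1] := a01; have a1' : 0 < 1 - a by rewrite subr_gt0.
have cu : continuous (fun t => u (clamp T t)).
  apply: continuous_clamp; first exact: ltW.
  move=> x xT.
  have h : lam 0 `^ (0 - s) * Hs_norm s (u r - u x) @[r --> within `[0, T] (nbhs x)] -->
      lam 0 `^ (0 - s) * 0 by apply: cvgMr; exact: uC.
  rewrite mulr0 in h; apply/cvgrPdist_le => e e0.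
  have /cvgrPdist_le/(_ _ e0) := h; rewrite !near_withinE; apply: filterS => r hr rT.
  have := hr rT; rewrite !sub0r !normrN => {}hr.
  apply: le_trans hr; rewrite ger0_norm ?rnorm_ge0//; apply: le_trans (ler_norm _).
  rewrite -(Hs0_norm ip_norm lam phi_basis) -[- s]add0r.
  by apply: (proj2 (Hs_le lam_gt0 lam_mono s0 _)); apply: HsB; exact: uH.
apply: ip_from_rip => c c1; set psi := c *: phi p.
have psi1 : rnorm psi <= 1 by rewrite /psi (rnorm_phiZ ip_norm phi_basis).
pose m := lam p `^ b; have m0 : 0 <= m := powR_ge0 _ _.
pose y r := rip (u (clamp T r)) psi; pose x0 := rip theta psi.
have cy : continuous y by move=> r; apply: cvg_rip; exact: cu.
have yE r : 0 <= r <= T -> y r = rip (u r) psi by move=> rT; rewrite /y clamp_id.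
have y0 : y 0 = x0 by rewrite yE ?lexx ?(ltW T0)// u0.
have cy0 : continuous (fun r => y r - x0) by move=> r; apply: cvgB; [exact: cy|exact: cvg_cst].
have ce : continuous (mlf a m) by exact: continuous_mlf.
(* The Caputo equation says that [f] has derivative 0 inside [(0, T)]. As [f] is continuous and
   vanishes at 0, it vanishes on [[0, T]], and the equation is integrated without differentiating
   [y]. *)
pose f r := frac_int (1 - a) (fun r => y r - x0) r + m * frac_int 1 y r.
have cf : continuous f.
  move=> r; apply: cvgD; first by apply: continuous_frac_int.
  by apply: cvgMr; apply: continuous_frac_int.
have f0 r : 0 <= r <= T -> f r = 0.
  move=> rT; rewrite (cst_of_within_derive0 cf rT).
    by rewrite /f !frac_int_le0// mulr0 addr0.
  move=> x xT; have /andP[x0' xT'] := xT.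
  have [uxb [d [J [HJ Jd]] dE]] := usol x xT.
  have rJ z : z \in `[0, T] -> rip (J z) psi = frac_int (1 - a) (fun r => y r - x0) z.
    move=> zT; apply: (frac_int_rip ip_norm a01 cy0 _ psi1 (HJ z zT)) => q /andP[q0 qz].
    rewrite ripBl u0 yE// (ltW q0)/=; move: zT; rewrite in_itv/= => /andP[_]; apply: le_trans.
    exact: ltW.
  have rd : rip d psi = - (m * y x).
    have -> : d = - op_power ip lam phi b (u x) by apply/eqP; rewrite -addr_eq0 dE.
    rewrite ripNl yE ?(ltW x0') ?(ltW xT')//; congr (- _).
    by rewrite /rip /psi !ipZr (op_power_diag ip_norm phi_basis uxb) mulrCA scalar_reZ.
  have c1' : rip (sc (r - x)^-1 *: (J r - J x)) psi @[r --> within `[0, T] (dnbhs x)] --> rip d psi.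
    exact: cvg_rip.
  have c2' : m * average y x r @[r --> within `[0, T] (dnbhs x)] --> m * y x.
    by apply: cvgMr; apply: average_cvg => //; exact: ltW.
  have h : rip (sc (r - x)^-1 *: (J r - J x)) psi + m * average y x r
      @[r --> within `[0, T] (dnbhs x)] --> rip d psi + m * y x by apply: cvgD.
  move: h; rewrite rd addNr; apply: cvg_trans; apply: near_eq_cvg.
  rewrite near_withinE; apply: nearW => z zT.
  rewrite /= ripZl ripBl !rJ//; last by rewrite in_itv/= (ltW x0') ltW.
  by rewrite /f /average; ring.
pose z r := y r - mlf a m r * x0.
have cz : continuous z.
  by move=> r; apply: cvgB; [exact: cy|apply: cvgMl; exact: ce].
have zJ r : 0 <= r <= T -> frac_int (1 - a) z r = - m * frac_int 1 z r.
  move=> rT.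
  have ce1 : continuous (fun q => mlf a m q - 1).
    by move=> q; apply: cvgB; [exact: ce|exact: cvg_cst].
  have cx (g : R -> R) : continuous g -> continuous (fun q => x0 * g q).
    by move=> cg q; apply: cvgMr; exact: cg.
  have -> : frac_int (1 - a) z r =
      frac_int (1 - a) (fun q => (y q - x0) - x0 * (mlf a m q - 1)) r.
    by apply: eq_frac_int => q _; rewrite /z; ring.
  rewrite (frac_intB r a1' cy0 (cx _ ce1)) (frac_intZ x0 r a1' ce1) (mlf_caputo m r a01).
  have -> : frac_int 1 z r = frac_int 1 (fun q => y q - x0 * mlf a m q) r.
    by apply: eq_frac_int => q _; rewrite /z; ring.
  rewrite (frac_intB r ltr01 cy (cx _ ce)) (frac_intZ x0 r ltr01 ce).
  have := f0 r rT; rewrite /f => /eqP; rewrite addr_eq0 => /eqP ->; ring.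
have := caputo_unique a01 m0 T0 cz zJ tT; rewrite /z yE// => /eqP.
by rewrite subr_eq0 => /eqP.
Qed.

Lemma regular_solution_unique a b s T theta u v : 0 < a < 1 -> 0 < T -> 0 <= s ->
  regular_solution ip lam phi s a b T theta u ->
  regular_solution ip lam phi s a b T theta v ->
  forall t, t \in `[0, T] -> u t = v t.
Proof.
move=> a01 T0 s0 hu hv t tT; apply: (diag_rel_inj phi_basis).
  exact: regular_solution_diag hu t tT.
exact: regular_solution_diag hv t tT.
Qed.

End Uniqueness.

(** * Dependence on the data *)

Section SymbolDistance.
Context {R : realType}.
Implicit Types (a b l t : R).

(** A quantity bounded by 1 and by [X] is bounded by every power of [X] with exponent in [(0, 1]].
    This converts a Lipschitz bound into a Hölder bound with less growth in the eigenvalue. *)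
Lemma powR_le_interpolate (D X g : R) : 0 <= D <= 1 -> D <= X -> 0 < g <= 1 -> D <= X `^ g.
Proof.
move=> /andP[D0 D1] DX /andP[g0 g1]; have X0 := le_trans D0 DX.
have [X1|X1] := leP 1 X.
  by apply: (le_trans D1); have := ge0_ler_powR (ltW g0) _ _ X1; rewrite powR1; apply; rewrite nnegrE.
apply: (le_trans DX); move: X0; rewrite le_eqVlt => /predU1P[<-|X0]; first exact: powR_ge0.
by rewrite -[leLHS]powRr1 ?(ltW X0)// ger_powR// X0 ltW.
Qed.

(** For [l >= 1] the larger exponent dominates; the finite loss for eigenvalues in [[l0, 1)] goes
    into the constant. *)
Lemma powR_le_top (b0 b b1 l0 l : R) : 0 < l0 <= l -> b0 <= b <= b1 ->
  l `^ b <= (1 + l0 `^ (b0 - b1)) * l `^ b1.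
Proof.
move=> /andP[l00 l0l] /andP[b0b bb1]; have l0' := lt_le_trans l00 l0l.
have -> : l `^ b = l `^ (b - b1) * l `^ b1.
  rewrite -powRD; first by rewrite subrK.
  by rewrite (gt_eqF l0') implybT.
rewrite ler_wpM2r ?powR_ge0//.
have [l1|l1] := leP 1 l.
  apply: (@le_trans _ _ 1); last by rewrite lerDl powR_ge0.
  by rewrite -[leRHS](powRr0 l) ler_powR// subr_le0.
apply: (@le_trans _ _ (l0 `^ (b - b1))).
  rewrite -opprB !powRN lef_pV2 ?posrE ?powR_gt0//.
  by rewrite ge0_ler_powR ?nnegrE ?subr_ge0// ltW.
apply: (@le_trans _ _ (l0 `^ (b0 - b1))); last by rewrite lerDr.
by rewrite ger_powR ?lerB// l00/= (le_trans l0l)// ltW.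
Qed.

Lemma norm_ln_le_powR (b1 l0 l : R) : 0 < b1 -> 0 < l0 <= l ->
  `|ln l| <= (b1^-1 + `|ln l0| * l0 `^ (- b1)) * l `^ b1.
Proof.
move=> b10 /andP[l00 l0l]; have l0' := lt_le_trans l00 l0l.
have [l1|l1] := leP 1 l.
  apply: (@le_trans _ _ (b1^-1 * l `^ b1)); last first.
    by rewrite ler_wpM2r ?powR_ge0// lerDl mulr_ge0 ?powR_ge0.
  rewrite ger0_norm ?ln_ge0// mulrC ler_pdivlMr// mulrC -ln_powR.
  by apply: ltW; apply: ln_sublinear; exact: powR_gt0.
apply: (@le_trans _ _ (`|ln l0| * l0 `^ (- b1) * l `^ b1)); last first.
  by rewrite ler_wpM2r ?powR_ge0// lerDr invr_ge0 ltW.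
have l01 : l0 < 1 by exact: le_lt_trans l0l l1.
rewrite ler0_norm ?ln_le0 ?(ltW l1)//; apply: (@le_trans _ _ `|ln l0|).
  by rewrite ler0_norm ?ln_le0 ?(ltW l01)// lerN2 ler_ln ?posrE.
rewrite -mulrA ler_peMr// powRN mulrC ler_pdivlMr ?powR_gt0// mul1r.
by rewrite ge0_ler_powR ?nnegrE ?(ltW b10) ?(ltW l00) ?(ltW l0').
Qed.

(** The relative bound [1 - m1 / m2] becomes [1 - exp (- x)] with [x] the difference of the
    logarithms, hence at most [x]. The exponents are ordered through the values of the powers, since
    [l] may be below 1. *)
Lemma mlf_dist_exponent a b b' l t : 0 < a < 1 -> 0 < l -> 0 <= t ->
  `|mlf a (l `^ b') t - mlf a (l `^ b) t| <= `|ln l| * `|b' - b|.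
Proof.
move=> a01 l0 t0.
have aux c c' : l `^ c <= l `^ c' ->
    `|mlf a (l `^ c) t - mlf a (l `^ c') t| <= `|ln l| * `|c' - c|.
  move=> cc; have /andP[h1 h2] := mlf_lipschitz_rate a01 (powR_gt0 c l0) cc t0.
  rewrite ger0_norm//; apply: (le_trans h2).
  rewrite mulrBl divff ?gt_eqF ?powR_gt0// /powR !gt_eqF// -expRN -expRD.
  apply: (@le_trans _ _ (ln l * (c' - c))); last by rewrite -normrM ler_norm.
  have := expR_ge1Dx (c * ln l - c' * ln l).
  by rewrite mulrBr (mulrC (ln l)) (mulrC (ln l)); lra.
have [h|/ltW h] := leP (l `^ b) (l `^ b'); last first.
  by rewrite [`|b' - b|]distrC; exact: aux.
by rewrite [`|mlf _ _ _ - _|]distrC; exact: aux.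
Qed.

(** The order is changed first, at exponent [b'], then the exponent. The first change costs [l^b'],
    the second [ln l], and both are bounded by a multiple of [l^b1]. *)
Lemma mlf_symbol_dist (al0 al1 b0 b1 l0 T : R) : 0 < al0 -> al1 < 1 -> 0 < b1 -> 0 < l0 ->
  exists2 C, 0 <= C & forall a a' b b' l t,
    al0 <= a <= al1 -> al0 <= a' <= al1 -> b0 <= b <= b1 -> b0 <= b' <= b1 ->
    l0 <= l -> 0 <= t <= T ->
    `|mlf a' (l `^ b') t - mlf a (l `^ b) t| <= C * l `^ b1 * (`|a' - a| + `|b' - b|).
Proof.
move=> al00 al11 b10 l00; have [C C0 HC] := mlf_dist_order T al00 al11.
pose c0 := 1 + l0 `^ (b0 - b1); pose c1 := b1^-1 + `|ln l0| * l0 `^ (- b1).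
have c00 : 0 <= c0 by rewrite addr_ge0 ?powR_ge0.
have c10 : 0 <= c1 by rewrite addr_ge0 ?invr_ge0 ?(ltW b10)// mulr_ge0 ?powR_ge0.
exists (C * c0 + c1) => [|a a' b b' l t ha ha' hb hb' l0l tT].
  by rewrite addr_ge0// mulr_ge0.
have ll : 0 < l0 <= l by rewrite l00.
have /andP[a1 a2] := ha; have a01 : 0 < a < 1.
  by rewrite (lt_le_trans al00 a1) (le_lt_trans a2 al11).
have /andP[t0 _] := tT; have lp := lt_le_trans l00 l0l.
rewrite -(subrKA (mlf a (l `^ b') t)); apply: le_trans (ler_normD _ _) _.
rewrite mulrDr; apply: lerD.
  apply: (le_trans (HC a a' _ t ha ha' (powR_ge0 l b') tT)).
  rewrite ler_wpM2r// (@le_trans _ _ (C * (c0 * l `^ b1)))//.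
    by rewrite ler_wpM2l//; exact: powR_le_top.
  by rewrite mulrA ler_wpM2r ?powR_ge0// lerDl.
apply: le_trans (mlf_dist_exponent b b' a01 lp t0) _; rewrite ler_wpM2r//.
apply: le_trans (norm_ln_le_powR b10 ll) _.
by rewrite ler_wpM2r ?powR_ge0// lerDr mulr_ge0.
Qed.

End SymbolDistance.

(** * Stability of solutions in the Sobolev scale *)

Section ContinuousDependence.
Context {R : realType} {k : scalar_kind}.
Variable H : completeNormedModType (scalar_field R k).
Variable ip : {dot H for @scalar_conj R k}.
Hypothesis ip_norm : inner_product_norm ip.
Variables (lam : nat -> R) (phi : nat -> H).
Hypothesis phi_basis : orthonormal_basis ip phi.
Hypothesis lam_gt0 : forall p, 0 < lam p.
Hypothesis lam_mono : forall p, lam p <= lam p.+1.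
Local Notation Hs := (Hs ip lam phi).
Local Notation Hs_norm := (Hs_norm ip lam phi).
Local Notation diag_rel := (diag_rel ip phi).
Implicit Types (a b s t T : R) (theta v : H).

(* The data difference and the parameter difference are separated by the solution
   with the new parameters and the old datum. *)
Lemma solution_dist_split a' b' r s t theta theta' v v' : 0 < a' < 1 -> r <= s ->
  Hs s theta -> Hs s theta' ->
  diag_rel (fun p => mlf a' (lam p `^ b') t) v' theta' ->
  Hs r (mlf_sol ip lam phi a' b' theta t - v) ->
  Hs_norm r (v' - v) ^+ 2 <= 2 * (lam 0 `^ (r - s) * Hs_norm s (theta' - theta)) ^+ 2
    + 2 * Hs_norm r (mlf_sol ip lam phi a' b' theta t - v) ^+ 2.
Proof.
move=> a01 rs ths ths' hv' hy; set z := mlf_sol ip lam phi a' b' theta t.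
have hz := (mlf_solP ip_norm lam phi_basis b' theta t a01).2.
have hx : diag_rel (fun p => mlf a' (lam p `^ b') t) (v' - z) (theta' - theta).
  by move=> p; rewrite !ipDl !ipNl hv' hz mulrBr.
have hd : Hs s (theta' - theta) by exact: HsB.
have [xr xn] : Hs r (v' - z) /\
    Hs_norm r (v' - z) <= lam 0 `^ (r - s) * Hs_norm s (theta' - theta).
  apply: Hs_diag hx (powR_ge0 _ _) _ hd => p.
  apply: le_trans (lam_powR_le lam_gt0 lam_mono p rs).
  by rewrite -[leRHS]mulr1 ler_wpM2l ?powR_ge0// mlf_norm_le1 ?powR_ge0.
have [_] := Hs_norm_sqrD xr hy; rewrite -/z addrA subrK => h.
apply: (le_trans h); rewrite lerD2r ler_wpM2l//.
by rewrite lerXn2r ?nnegrE ?mulr_ge0 ?powR_ge0 ?Hs_norm_ge0.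
Qed.

(** Datum and solution are measured in the same space, so no smoothness is left for a rate; the
    change of parameters is treated by dominated convergence along the filter of pairs
    [(a', b')]. *)
Lemma solution_continuous_dependence a b b0 b1 s T t theta v : 0 < a < 1 -> 0 < b1 ->
  b0 <= b <= b1 -> 0 <= t <= T -> Hs s theta ->
  diag_rel (fun p => mlf a (lam p `^ b) t) v theta ->
  forall e, 0 < e -> exists2 d : R, 0 < d & forall a' b' theta' v',
    0 < a' < 1 -> b0 <= b' <= b1 -> Hs s theta' ->
    diag_rel (fun p => mlf a' (lam p `^ b') t) v' theta' ->
    Hs_norm s (theta' - theta) < d -> `|a' - a| < d -> `|b' - b| < d ->
    Hs_norm s (v' - v) < e.
Proof.
move=> a01 b10 hb tT ths hv e e0; have /andP[a0 a1] := a01.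
have e2 : 0 < e / 2 by rewrite divr_gt0.
pose D := [set x : R * R | 0 < x.1 < 1 /\ b0 <= x.2 <= b1].
pose F := within D (nbhs (a, b)).
(* The Lipschitz constant needs orders in a compact part of [(0, 1)]; [[a / 2, (1 + a) / 2]] is a
   neighbourhood of [a] of this kind. *)
have al0 : 0 < a / 2 by rewrite divr_gt0.
have al1 : (1 + a) / 2 < 1 by lra.
have [C C0 HC] := mlf_symbol_dist b0 T al0 al1 b10 (lam_gt0 0).
have hz x : 0 < x.1 < 1 ->
    diag_rel (fun p => mlf x.1 (lam p `^ x.2) t) (mlf_sol ip lam phi x.1 x.2 theta t) theta.
  by move=> x1; exact: (mlf_solP _ _ _ _ _ _ _).2.
have lim0 : Hs_norm s (mlf_sol ip lam phi x.1 x.2 theta t - v) @[x --> F] --> (0 : R).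
  apply: (Hs_diag_cvg0 lam_gt0 (v := theta) (s := s) (M := 2)
    (G := fun x p => mlf x.1 (lam p `^ x.2) t - mlf a (lam p `^ b) t)) => //.
    rewrite near_withinE; apply: nearW => x [x1 x2]; split.
      by apply: diag_relB; [exact: hz|exact: hv].
    move=> p; rewrite mulrC ler_wpM2r ?powR_ge0//; apply: le_trans (ler_normB _ _) _.
    by apply: lerD; rewrite mlf_norm_le1 ?powR_ge0.
  move=> p; apply/cvgrPdist_le => q q0; rewrite near_withinE.
  pose K := C * lam p `^ b1 + 1.
  have K0 : 0 < K by rewrite ltr_wpDl// mulr_ge0 ?powR_ge0.
  have Kp : 0 < q / (2 * K) by rewrite divr_gt0// mulr_gt0.
  (* The first entry makes the Lipschitz bound at most [q]; the others keep the order inside the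
     compact interval. *)
  pose r := Num.min (q / (2 * K)) (Num.min (a / 2) ((1 - a) / 2)).
  have r0 : 0 < r by rewrite !lt_min Kp al0/= divr_gt0// subr_gt0.
  apply/nbhs_ballP; exists r => //= x [/= xa xb] [_ x2].
  move: xa xb; rewrite /ball/= !lt_min => /and3P[xa1 xa2 xa3] /and3P[xb1 _ _].
  rewrite sub0r normrN; apply: (@le_trans _ _ (C * lam p `^ b1 * (`|x.1 - a| + `|x.2 - b|))).
    apply: HC => //; last exact: lam0_le.
      by apply/andP; split; lra.
    by move: xa2 xa3; rewrite !ltr_norml => /andP[? ?] /andP[? ?]; apply/andP; split; lra.
  apply: (@le_trans _ _ (K * (q / (2 * K) + q / (2 * K)))).
    apply: ler_pM; rewrite ?addr_ge0 ?mulr_ge0 ?powR_ge0 ?lerDl//.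
    by apply: lerD; rewrite distrC ltW.
  by rewrite le_eqVlt; apply/orP; left; apply/eqP; field; rewrite gt_eqF.
have := lim0 => /cvgrPdist_lt/(_ _ e2); rewrite near_withinE => /nbhs_ballP[d /= d0 hd].
(* Both halves use [e / 2], because [2 (e / 2)^2 + 2 (e / 2)^2 = e^2]. *)
exists (Num.min d (e / 2)) => [|a' b' theta' v' ha' hb' ths' hv'].
  by rewrite lt_min d0.
rewrite !lt_min => /andP[_ th] /andP[da _] /andP[db _].
have h1 : Hs_norm s (mlf_sol ip lam phi a' b' theta t - v) < e / 2.
  have := hd (a', b'); rewrite sub0r normrN ger0_norm ?Hs_norm_ge0//; apply.
    by split; rewrite /ball/= distrC.
  by [].
have h2 : Hs s (mlf_sol ip lam phi a' b' theta t - v).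
  apply: (Hs_diag (diag_relB (hz (a', b') ha') hv) (ler0n _ 2) _ ths).1 => p.
  rewrite mulrC ler_wpM2r ?powR_ge0//; apply: le_trans (ler_normB _ _) _.
  by apply: lerD; rewrite mlf_norm_le1 ?powR_ge0.
have := solution_dist_split ha' (lexx s) ths ths' hv' h2.
rewrite subrr powRr0 mul1r => h; rewrite -ltr_sqr ?nnegrE ?Hs_norm_ge0 ?(ltW e0)//.
apply: le_lt_trans h _.
have -> : e ^+ 2 = 2 * (e / 2) ^+ 2 + 2 * (e / 2) ^+ 2 by field.
by apply: ltrD; rewrite ltr_pM2l// ltr_sqr ?nnegrE ?Hs_norm_ge0 ?(ltW e2).
Qed.

(** Interpolating the Lipschitz bound for the symbol with the trivial bound 1 lowers its growth to
    [lam^(b1 * gamma)], which the gap between [rho] and [s] can absorb. *)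
Lemma solution_holder_dependence al0 al1 b0 b1 rho s T : 0 < al0 -> al1 < 1 -> 0 < b1 ->
  rho < s -> let gamma := Num.min 1 ((s - rho) / b1) in
  exists C : R, forall a a' b b' theta theta' v v' t,
    al0 <= a <= al1 -> al0 <= a' <= al1 -> b0 <= b <= b1 -> b0 <= b' <= b1 ->
    0 <= t <= T -> Hs s theta -> Hs s theta' ->
    diag_rel (fun p => mlf a (lam p `^ b) t) v theta ->
    diag_rel (fun p => mlf a' (lam p `^ b') t) v' theta' ->
    Hs_norm rho (v' - v) ^+ 2 <= C * Hs_norm s (theta' - theta) ^+ 2
      + C * Hs_norm s theta ^+ 2 * (`|a' - a| + `|b' - b|) `^ (2 * gamma).
Proof.
move=> al00 al11 b10 rs gamma.
have [C C0 HC] := mlf_symbol_dist b0 T al00 al11 b10 (lam_gt0 0).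
have g0 : 0 < gamma by rewrite lt_min ltr01 divr_gt0// subr_gt0.
have g1 : gamma <= 1 by rewrite ge_min lexx.
(* The second entry of the minimum defining [gamma] is the largest exponent for which this holds. *)
have gs : rho + b1 * gamma <= s.
  by rewrite -lerBrDl mulrC -ler_pdivlMr// ge_min lexx orbT.
pose c := lam 0 `^ (rho - s); pose K := C `^ gamma * lam 0 `^ (rho + b1 * gamma - s).
have c0 : 0 <= c by exact: powR_ge0.
have K0 : 0 <= K by rewrite mulr_ge0 ?powR_ge0.
exists (2 * c ^+ 2 + 2 * K ^+ 2) => a a' b b' theta theta' v v' t ha ha' hb hb' tT ths ths' hv hv'.
have a01 : 0 < a < 1 by case/andP: ha => h1 h2; rewrite (lt_le_trans al00 h1) (le_lt_trans h2 al11).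
have a01' : 0 < a' < 1 by case/andP: ha' => h1 h2; rewrite (lt_le_trans al00 h1) (le_lt_trans h2 al11).
set d := `|a' - a| + `|b' - b|; have d0 : 0 <= d by rewrite addr_ge0.
have hz := (mlf_solP ip_norm lam phi_basis b' theta t a01').2.
have bnd p : lam p `^ rho * `|mlf a' (lam p `^ b') t - mlf a (lam p `^ b) t|
    <= K * d `^ gamma * lam p `^ s.
  have l0 := lam_gt0 p.
  have h1 : `|mlf a' (lam p `^ b') t - mlf a (lam p `^ b) t| <= (C * lam p `^ b1 * d) `^ gamma.
    apply: powR_le_interpolate; rewrite ?g0//; last exact: HC (lam0_le lam_mono p) tT.
    rewrite normr_ge0/= ler_norml.
    have := mlf_gt0 t a01 (powR_ge0 (lam p) b); have := mlf_le1 t a01 (powR_ge0 (lam p) b).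
    have := mlf_gt0 t a01' (powR_ge0 (lam p) b'); have := mlf_le1 t a01' (powR_ge0 (lam p) b').
    by move=> h1 h2 h3 h4; apply/andP; split; lra.
  apply: (@le_trans _ _ (lam p `^ rho * (C * lam p `^ b1 * d) `^ gamma)).
    by rewrite ler_wpM2l ?powR_ge0.
  rewrite !powRM ?mulr_ge0 ?powR_ge0// -powRrM.
  have -> : lam p `^ rho * (C `^ gamma * lam p `^ (b1 * gamma) * d `^ gamma) =
     C `^ gamma * d `^ gamma * (lam p `^ rho * lam p `^ (b1 * gamma)) by ring.
  rewrite -powRD; last by rewrite (gt_eqF l0) implybT.
  have -> : K * d `^ gamma * lam p `^ s =
    C `^ gamma * d `^ gamma * (lam 0 `^ (rho + b1 * gamma - s) * lam p `^ s) by rewrite /K; ring.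
  by rewrite ler_wpM2l ?mulr_ge0 ?powR_ge0// lam_powR_le.
have [yr yn] := Hs_diag (diag_relB hz hv) (mulr_ge0 K0 (powR_ge0 d gamma)) bnd ths.
apply: le_trans (solution_dist_split a01' (ltW rs) ths ths' hv' yr) _; apply: lerD.
  by rewrite -/c exprMn mulrA ler_wpM2r ?sqr_ge0// lerDl mulr_ge0 ?sqr_ge0.
apply: (@le_trans _ _ (2 * (K * d `^ gamma * Hs_norm s theta) ^+ 2)).
  by rewrite ler_wpM2l// lerXn2r ?nnegrE ?mulr_ge0 ?powR_ge0 ?Hs_norm_ge0.
have -> : 2 * (K * d `^ gamma * Hs_norm s theta) ^+ 2 =
    2 * K ^+ 2 * (Hs_norm s theta ^+ 2 * (d `^ gamma) ^+ 2) by ring.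
rewrite powR2 -[leRHS]mulrA ler_wpM2r//.
  by rewrite mulr_ge0// sqr_ge0.
by rewrite lerDr mulr_ge0// sqr_ge0.
Qed.

End ContinuousDependence.

Theorem theorem4p3 (R : realType) (k : scalar_kind)
    (H : completeNormedModType (scalar_field R k))
    (ip : {dot H for @scalar_conj R k})
    (ip_norm : inner_product_norm ip)
    (DA : set H) (A : H -> H)
    (A_op : densely_defined_operator DA A)
    (lam : nat -> R) (phi : nat -> H)
    (phi_dom : forall p, DA (phi p))
    (A_phi : forall p, A (phi p) = scalar_of k (lam p) *: phi p)
    (lam_gt0 : forall p, 0 < lam p)
    (lam_mono : forall p, lam p <= lam p.+1)
    (lam_oo : lam @ \oo --> +oo)
    (phi_basis : orthonormal_basis ip phi)
    (T s alpha0 alpha1 beta0 beta1 : R)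
    (T_gt0 : 0 < T) (s_ge0 : 0 <= s)
    (alpha0_gt0 : 0 < alpha0) (alpha01 : alpha0 < alpha1) (alpha1_lt1 : alpha1 < 1)
    (beta0_gt0 : 0 < beta0) (beta01 : beta0 < beta1) :
  (* (a) *)
  (exists C : R, forall (alpha beta : R) (theta : H),
     alpha \in `[alpha0, alpha1] -> beta \in `[beta0, beta1] ->
     Hs ip lam phi s theta ->
     exists v w : R -> H,
     [/\ regular_solution_with ip lam phi s alpha beta T theta v w,
         (forall u, regular_solution ip lam phi s alpha beta T theta u ->
            forall t, t \in `[0, T] -> u t = v t),
         (forall t, t \in `[0, T] ->
            series (fun p =>
              (ip theta (phi p) *
               scalar_of k (mittag_leffler alpha (- (lam p `^ beta * t `^ alpha))))
              *: phi p) @ \oo --> v t),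
         (norm_C (Hs_norm ip lam phi s) T v
          + norm_Ca (Hs_norm ip lam phi (beta + s)) alpha T v
          + norm_Ca (Hs_norm ip lam phi s) alpha T w
          <= (C * Hs_norm ip lam phi s theta)%:E)%E
       & (beta <= s ->
          [/\ (forall t, t \in `[0, T] -> is_caputo alpha T v t (w t)),
              in_C (Hs ip lam phi (s - beta)) (Hs_norm ip lam phi (s - beta)) T w
            & (norm_C (Hs_norm ip lam phi (s - beta)) T w ^+ 2
               <= (C * Hs_norm ip lam phi s theta ^+ 2)%:E)%E])]) /\
  (* (b)(i) *)
  (forall (alpha beta : R) (theta : H) (v : R -> H),
     alpha \in `]0, 1[ -> beta \in `[beta0, beta1] ->
     Hs ip lam phi s theta ->
     regular_solution ip lam phi s alpha beta T theta v ->
     forall t, t \in `[0, T] ->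
     forall eps : R, 0 < eps ->
     exists2 delta : R, 0 < delta &
       forall (alpha' beta' : R) (theta' : H) (v' : R -> H),
         alpha' \in `]0, 1[ -> beta' \in `[beta0, beta1] ->
         Hs ip lam phi s theta' ->
         regular_solution ip lam phi s alpha' beta' T theta' v' ->
         Hs_norm ip lam phi s (theta' - theta) < delta ->
         `|alpha' - alpha| < delta -> `|beta' - beta| < delta ->
         Hs_norm ip lam phi s (v' t - v t) < eps) /\
  (* (b)(ii) *)
  (forall rho : R, 0 <= rho -> rho < s ->
     exists C : R, forall (alpha alpha' beta beta' : R) (theta theta' : H)
                          (v v' : R -> H),
       alpha \in `[alpha0, alpha1] -> alpha' \in `[alpha0, alpha1] ->
       beta \in `[beta0, beta1] -> beta' \in `[beta0, beta1] ->
       Hs ip lam phi s theta -> Hs ip lam phi s theta' ->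
       regular_solution ip lam phi s alpha beta T theta v ->
       regular_solution ip lam phi s alpha' beta' T theta' v' ->
       forall t, t \in `[0, T] ->
       let gamma := Num.min 1 ((s - rho) / beta1) in
       Hs_norm ip lam phi rho (v' t - v t) ^+ 2
       <= C * Hs_norm ip lam phi s (theta' - theta) ^+ 2
          + C * Hs_norm ip lam phi s theta ^+ 2
            * (`|alpha' - alpha| + `|beta' - beta|) `^ (2 * gamma)).
Proof.
have a01 a : alpha0 <= a <= alpha1 -> 0 < a < 1.
  by move=> /andP[a0 a1]; rewrite (lt_le_trans alpha0_gt0 a0) (le_lt_trans a1 alpha1_lt1).
have beta1_gt0 := lt_trans beta0_gt0 beta01.
split; last split.
(* The three norms contribute 1, 2 and 2. *)
- exists 5 => alpha beta theta; rewrite !in_itv/= => /a01 ha _ ths.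
  exists (mlf_sol ip lam phi alpha beta theta), (mlf_der ip lam phi alpha beta theta).
  have reg := mlf_sol_regular ip_norm phi_basis lam_gt0 beta T ha ths.
  split=> //.
  + move=> u hu; apply: (regular_solution_unique ip_norm phi_basis lam_gt0 lam_mono ha T_gt0 s_ge0 hu).
    by exists (mlf_der ip lam phi alpha beta theta).
  + move=> t; rewrite in_itv/= => /andP[t0 _].
    have := (mlf_solP ip_norm lam phi_basis beta theta t ha).1.
    by under eq_fun do rewrite mulrC mlfE ppowE//.
  + have [_ h1] := mlf_sol_in_C ip_norm phi_basis lam_gt0 beta T ha ths.
    have [_ h2] := mlf_sol_in_Ca ip_norm phi_basis lam_gt0 beta T ha ths.
    have [_ h3] := mlf_der_in_Ca ip_norm phi_basis lam_gt0 beta T ha ths.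
    apply: le_trans (leeD (leeD h1 h2) h3) _; rewrite -!EFinD lee_fin.
    by rewrite le_eqVlt; apply/orP; left; apply/eqP; ring.
  + move=> bs.
    have [h1 h2] := mlf_der_in_C ip_norm phi_basis lam_gt0 lam_mono T ha bs ths.
    split=> //.
      move=> t; rewrite in_itv/= => /andP[t0 _].
      exact: (mlf_sol_caputo_smooth ip_norm phi_basis lam_gt0 lam_mono T ha t0 bs ths).
    have N0 := Hs_norm_ge0 ip lam phi s theta.
    (* Squaring preserves the order only for nonnegative extended reals; the value at time 0 shows
       that the supremum is nonnegative. *)
    have n0 : (0 <= norm_C (Hs_norm ip lam phi (s - beta)) T (mlf_der ip lam phi alpha beta theta))%E.
      apply: (@le_trans _ _ (Hs_norm ip lam phi (s - beta) (mlf_der ip lam phi alpha beta theta 0))%:E).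
        by rewrite lee_fin Hs_norm_ge0.
      by apply: ereal_sup_ubound; exists 0 => //=; rewrite in_itv/= lexx ltW.
    apply: (@le_trans _ _ ((Hs_norm ip lam phi s theta)%:E ^+ 2)%E).
      by rewrite !expe2; apply: lee_pmul.
    rewrite -EFin_expe lee_fin -[leLHS]mul1r ler_wpM2r ?sqr_ge0//.
    by rewrite ler1n.
- move=> alpha beta theta v; rewrite !in_itv/= => ha hb ths hv t; rewrite in_itv/= => tT e e0.
  (* An arbitrary regular solution is replaced by its coefficients, so the stability estimates apply
     to it directly. *)
  have hv' := regular_solution_diag ip_norm phi_basis lam_gt0 lam_mono ha T_gt0 s_ge0 hv.
  have [d d0 hd] := solution_continuous_dependence ip_norm phi_basis lam_gt0 lam_mono
    ha beta1_gt0 hb tT ths (hv' t tT) e0.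
  exists d => // alpha' beta' theta' v'; rewrite !in_itv/= => ha' hb' ths' hu.
  apply: hd => //.
  exact: (regular_solution_diag ip_norm phi_basis lam_gt0 lam_mono ha' T_gt0 s_ge0 hu).
- move=> rho rho0 rhos.
  have [C HC] := solution_holder_dependence ip_norm phi_basis lam_gt0 lam_mono beta0 T
    alpha0_gt0 alpha1_lt1 beta1_gt0 rhos.
  exists C => alpha alpha' beta beta' theta theta' v v'.
  rewrite !in_itv/= => ha ha' hb hb' ths ths' hv hv' t; rewrite in_itv/= => tT.
  apply: (HC _ _ _ _ _ _ _ _ t) => //.
    exact: (regular_solution_diag ip_norm phi_basis lam_gt0 lam_mono (a01 _ ha) T_gt0 s_ge0 hv).
  exact: (regular_solution_diag ip_norm phi_basis lam_gt0 lam_mono (a01 _ ha') T_gt0 s_ge0 hv').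
Qed.
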